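(* Let $\mathbf{k}$ be an algebraically closed and uncountable field. Let $n$ be a positive integer. Let $X$ be a reduced, connected, affine variety over $\mathbf{k}$. If its automorphism group $\mathrm{Aut}(X)$ is isomorphic to $\mathrm{Aut}(\mathbb{A}^n_{\mathbf{k}})$ as an abstract group, then $X$ is isomorphic to $\mathbb{A}^n_{\mathbf{k}}$ as a variety over $\mathbf{k}$.
   Context: $\mathbb{A}^n_{\mathbf{k}}$ is the affine space of dimension $n$ over $\mathbf{k}$. Varieties may be reducible, and no assumption is made on $\dim(X)$. $\mathrm{Aut}(X)$ denotes the group of automorphisms of $X$ as a variety over $\mathbf{k}$. *)

(* Defs.v *)
From HB Require Import structures.
From mathcomp Require Import all_boot all_order all_algebra.
From mathcomp Require Import mpoly.
From mathcomp Require Import all_classical.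
From mathcomp Require Import topology.

Set Implicit Arguments.
Unset Strict Implicit.
Unset Printing Implicit Defensive.

Import GRing.Theory.
Local Open Scope classical_set_scope.
Local Open Scope ring_scope.

(* The set k^n of k-points of A^n; over an algebraically closed field, reduced
   varieties are determined by their k-points. The alias carries the Zariski
   topology, so `closed`, `connected`, ... below are taken in it. *)
Definition affine_space (k : fieldType) (n : nat) : Type := {ffun 'I_n -> k}.

HB.instance Definition _ (k : fieldType) (n : nat) :=
  Choice.on (affine_space k n).

Definition zero_locus (k : fieldType) (n : nat) (S : set {mpoly k[n]}) :
  set (affine_space k n) := [set x | forall p, S p -> p.@[x] = 0].

Definition zariski_open (k : fieldType) (n : nat) :
  set_system (affine_space k n) := [set U | exists S, U = ~` zero_locus S].

Section ZariskiTopology.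
Variables (k : fieldType) (n : nat).

Lemma zariski_openT : zariski_open [set: affine_space k n].
Proof.
exists setT; apply/esym/seteqP; split=> // x _ /(_ 1 I).
by rewrite meval1 => /eqP; rewrite oner_eq0.
Qed.

Lemma zariski_openI : setI_closed (@zariski_open k n).
Proof.
move=> _ _ [S ->] [T ->].
exists [set r | exists p q, [/\ S p, T q & r = p * q]].
rewrite -setCU; congr (~` _); apply/seteqP; split=> x /=.
  case=> H _ [p [q [Sp Tq ->]]]; rewrite mevalM.
    by rewrite (H p Sp) mul0r.
  by rewrite (H q Tq) mulr0.
move=> H; have [xS|/existsNP[p /not_implyP[Sp /eqP px]]] := pselect (zero_locus S x).
  by left.
right=> q Tq; have /eqP := H (p * q) (ex_intro _ p (ex_intro _ q (And3 Sp Tq erefl))).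
by rewrite mevalM mulf_eq0 (negPf px) /= => /eqP.
Qed.

Lemma zariski_open_bigU (I : Type) (f : I -> set (affine_space k n)) :
  (forall i, zariski_open (f i)) -> zariski_open (\bigcup_i f i).
Proof.
move=> /choice[S fS]; exists (\bigcup_i S i).
rewrite (eq_bigcupr (fun i _ => fS i)) -setC_bigcap; congr (~` _).
apply/seteqP; split=> x /= H; first by move=> p [i _]; exact: H.
by move=> i _ p Sp; apply: H; exists i.
Qed.

HB.instance Definition _ := isOpenTopological.Build (affine_space k n)
  zariski_openT zariski_openI zariski_open_bigU.

End ZariskiTopology.

(* A reduced affine variety: a Zariski-closed subset of some A^m. It may be
   reducible. Reducedness is built in: the regular functions are the
   restrictions of polynomials, as functions on the points. *)
Record affine_variety (k : fieldType) := AffineVariety {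
  ambient_dim : nat;
  points :> set (affine_space k ambient_dim);
  points_closed : closed points }.

Definition affine_space_variety (k : fieldType) (n : nat) : affine_variety k :=
  AffineVariety (@closedT (affine_space k n)).

Definition regular (k : fieldType) (X Y : affine_variety k) (f : X -> Y) :=
  exists p : 'I_(ambient_dim Y) -> {mpoly k[ambient_dim X]},
    forall (x : X) i, (val (f x) : affine_space _ _) i
                      = (p i).@[(val x : affine_space _ _)].

Record variety_iso (k : fieldType) (X Y : affine_variety k) := VarietyIso {
  iso_fun :> X -> Y;
  iso_inv : Y -> X;
  iso_fun_regular : regular iso_fun;
  iso_inv_regular : regular iso_inv;
  iso_funK : cancel iso_fun iso_inv;
  iso_invK : cancel iso_inv iso_fun }.

Definition isomorphic (k : fieldType) (X Y : affine_variety k) : Prop :=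
  inhabited (variety_iso X Y).

Definition Aut (k : fieldType) (X : affine_variety k) : Type := variety_iso X X.

Section AutGroup.
Variables (k : fieldType) (X : affine_variety k).
Implicit Types f g h : Aut X.

HB.instance Definition _ := gen_eqMixin (Aut X).
HB.instance Definition _ := gen_choiceMixin (Aut X).

Lemma regular_id : regular (@id X).
Proof. by exists (fun i => 'X_i) => x i; rewrite mevalXU. Qed.

Lemma regular_comp (f g : X -> X) : regular f -> regular g -> regular (f \o g).
Proof.
move=> [p fp] [q gq]; exists (fun i => p i \mPo [tuple q j | j < _]) => x i.
rewrite /= fp comp_mpoly_meval; apply: meval_eq => j.
by rewrite gq tnth_mktuple.
Qed.

Lemma Aut_eq f g : f =1 g -> f = g.
Proof.
case: f g => [f f' rf rf' fK f'K] [g g' rg rg' gK g'K] /= /funext fg.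
case: _ / fg in rg gK g'K *.
have fg' : f' = g' by apply/funext => x; rewrite -{1}(g'K x) fK.
case: _ / fg' in rg' gK g'K *.
by congr VarietyIso; exact: Prop_irrelevance.
Qed.

Definition Aut_one : Aut X :=
  @VarietyIso k X X id id regular_id regular_id (fun=> erefl) (fun=> erefl).

Definition Aut_mul f g : Aut X :=
  @VarietyIso k X X (f \o g) (iso_inv g \o iso_inv f)
    (regular_comp (iso_fun_regular f) (iso_fun_regular g))
    (regular_comp (iso_inv_regular g) (iso_inv_regular f))
    (can_comp (iso_funK f) (iso_funK g)) (can_comp (iso_invK g) (iso_invK f)).

Definition Aut_inv f : Aut X :=
  @VarietyIso k X X (iso_inv f) f (iso_inv_regular f) (iso_fun_regular f)
    (iso_invK f) (iso_funK f).

Lemma Aut_mulA : associative Aut_mul.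
Proof. by move=> f g h; apply: Aut_eq. Qed.

Lemma Aut_1mul : left_id Aut_one Aut_mul.
Proof. by move=> f; apply: Aut_eq. Qed.

Lemma Aut_mul1 : right_id Aut_one Aut_mul.
Proof. by move=> f; apply: Aut_eq. Qed.

Lemma Aut_Vmul : left_inverse Aut_one Aut_inv Aut_mul.
Proof. by move=> f; apply: Aut_eq => x /=; rewrite iso_funK. Qed.

Lemma Aut_mulV : right_inverse Aut_one Aut_inv Aut_mul.
Proof. by move=> f; apply: Aut_eq => x /=; rewrite iso_invK. Qed.

HB.instance Definition _ := isGroup.Build (Aut X)
  Aut_mulA Aut_1mul Aut_mul1 Aut_Vmul Aut_mulV.

End AutGroup.

(* Main.v *)
(* An isomorphism Aut X ~ Aut A^n endows X with commuting one-parameter groups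
   of "translations" V_i ~ (k, +) and "dilations" T_i ~ k^*, related to each
   other and to their centralizers as in A^n, but a priori only as abstract
   groups.
   - Since k is uncountable, infinitely many elements of T_i have bounded
     degree; counting zero patterns of polynomials and using quantifier
     elimination, all of T_i, hence all of T V, has bounded degree. So T V acts
     linearly in suitable coordinates w_1, ..., w_r of X.
   - The roots of unity in T_i are diagonal in such coordinates; by independence
     of characters, so is a one-dimensional algebraic torus commuting with
     their centralizer, which therefore lies in T_i and equals it.
   - A coefficient of the representation of V_i that is additive and
     semi-invariant under T_i makes the abstract identification k ~ V_i
     algebraic up to a field automorphism and a Frobenius twist.
   - If f is a V-invariant function, the shears x |-> u_1(s f(x)) x centralize
     V, hence lie in V; comparing weights, f is constant off the fixed locus of
     V_1, and by connectedness everywhere.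
   - So V has a dense orbit through a T-fixed point, on which homogeneous
     functions are monomials; the monoid of their exponents is stable under
     translations of the variables, hence is a product of q_i N, and
     k[X] = k[b_1^q_1, ..., b_n^q_n]. *)
Require Import Defs.
From mathcomp Require Import all_boot all_order all_algebra all_field.
From mathcomp Require Import mpoly.
From mathcomp Require Import all_classical.
From mathcomp Require Import topology.
From mathcomp Require Import zify ring.

Set Implicit Arguments.
Unset Strict Implicit.
Unset Printing Implicit Defensive.

Import Order.TTheory GRing.Theory.
Local Open Scope classical_set_scope.
Local Open Scope ring_scope.

(** * Zero patterns and definable sets *)

(** The group isomorphism carries no topology and no algebraic structure. The bridge to geometry is
    that the relevant subgroups are centralizers: with a degree bound, a centralizer becomes a
    closed set of coefficient vectors. The hard step is therefore a uniform degree bound on the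
    dilations. Uncountability directly gives a bound only for infinitely many translations along an
    axis. Consider scalars a_l for which the sums of the a_l u_l, with u_l ranging over these
    translation parameters, determine the u_l. Their number is at most the number of coordinates
    that separate translations; maximality of such a family makes every nonzero scalar a quotient
    s'/s where both translations have bounded degree. The dilation by s'/s is definable from the
    coefficients of these two, and saturation makes the bound uniform. Positive characteristic
    shapes the later choices: roots of unity have order invertible in k, so that they act
    diagonalizably, and a Frobenius power is absorbed into the parameter of the translations, so
    that the remaining torus weight is invertible in k. *)

Section ZeroPatterns.
Variables (k : fieldType) (M : nat).

Lemma card_bmultinom B : (#|{: 'X_{1..M < B}}| <= B ^ M)%N.
Proof.
case: B => [|B].
  rewrite (_ : #|_| = 0)%N //; apply: eq_card0 => m.
  by have := bmdeg m; rewrite ltn0.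
pose f (m : 'X_{1..M < B.+1}) : {ffun 'I_M -> 'I_B.+1} := [ffun i => inord ((m : 'X_{1..M}) i)].
have inj_f : injective f.
  move=> m1 m2 /ffunP f12; apply/val_inj/mnmP => i.
  have := f12 i; rewrite !ffunE => /(congr1 val) /=.
  have bound (m : 'X_{1..M < B.+1}) : ((m : 'X_{1..M}) i < B.+1)%N.
    by apply: leq_ltn_trans (bmdeg m); rewrite mdegE (bigD1 i) //= leq_addr.
  by rewrite !inordK.
rewrite (leq_trans (leq_card f inj_f)) // card_ffun !card_ord //.
Qed.

Lemma msize_prod_le (I : Type) (r : seq I) (Q : pred I) (P : I -> {mpoly k[M]}) D :
  (forall i, msize (P i) <= D)%N ->
  (msize (\prod_(i <- r | Q i) P i) <= (size r * D.+1).+1)%N.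
Proof.
move=> hD; elim: r => [|i r IH]; first by rewrite big_nil msize1.
rewrite big_cons /=; case: ifP => _; last by rewrite (leq_trans IH) // ltnS leq_mul.
apply: (leq_trans (msizeM_le _ _)); rewrite mulSn.
set a := msize (P i); set b := msize _.
have : (a <= D)%N by exact: hD.
have : (b <= (size r * D.+1).+1)%N by exact: IH.
set c := (size r * D.+1)%N. lia.
Qed.

(* The polynomials [prod_(i not in S) P i], for S ranging over the realized
   zero patterns S, are triangular for inclusion when evaluated at points
   realizing these patterns. *)
Lemma card_zero_patterns (I T : finType) (P : I -> {mpoly k[M]}) D
    (z : T -> 'I_M -> k) :
  (forall i, msize (P i) <= D)%N ->
  injective (fun t => [set i | (P i).@[z t] == 0]%SET) ->
  (#|T| <= (#|I| * D.+1).+1 ^ M)%N.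
Proof.
move=> hD; set pat := fun t => _ => inj_pat.
pose f t := \prod_(i in ~: pat t) P i.
pose B := (#|I| * D.+1).+1.
have fB t : (msize (f t) <= B)%N.
  rewrite /B; have -> : #|I| = size (index_enum I) by rewrite cardT enumT [index_enum I]unlock.
  exact: msize_prod_le.
have f_eq0 t t' : ((f t).@[z t'] == 0) = ~~ (pat t' \subset pat t).
  rewrite /f rmorph_prod prodf_seq_eq0; apply/hasP/subsetPn => /=.
    case=> i _ /andP[]; rewrite inE => it fi; exists i => //.
    by rewrite /pat inE.
  case=> i it' it; exists i; first by rewrite mem_index_enum.
  by rewrite inE it /=; move: it'; rewrite inE.
pose m0 : nat := #|T|.
(* The matrix of the values [(f i).@[z j]] factors through the monomials of degree less than [B],
   whose number bounds its rank; independence of its rows then suffices. *)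
pose A := \matrix_(i < m0, j < #|{: 'X_{1..M < B}}|) (f (enum_val i))@_(enum_val j).
pose C := \matrix_(j < #|{: 'X_{1..M < B}}|, i < m0) ('X_[k, enum_val j] : {mpoly k[M]}).@[z (enum_val i)].
have AC i j : (A *m C) i j = (f (enum_val i)).@[z (enum_val j)].
  rewrite mxE [f _ in RHS](mpolywE (fB _)) raddf_sum /= (reindex (fun j : 'I_#|{: 'X_{1..M < B}}| => enum_val j)) /=; last first.
    by apply: onW_bij; exact: enum_val_bij.
  by apply: eq_bigr => l _; rewrite !mxE mevalZ.
suff free : row_free (A *m C).
  have : (\rank (A *m C) <= #|{: 'X_{1..M < B}}|)%N.
    by rewrite (leq_trans (mxrankM_maxl _ _)) // rank_leq_col.
  by rewrite (eqP free) => /leq_trans; apply; exact: card_bmultinom.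
apply/row_freeP; apply/row_freeP; rewrite -kermx_eq0; apply/rowV0P => u.
move=> /sub_kermxP uK; apply/eqP; apply: contraT => /rV0Pn[i0 ui0].
(* A pattern of maximal size in the support of [u] leaves only the diagonal term in its column. *)
have [i /= ui max_i] := @arg_maxnP _ i0 (fun i => u 0 i != 0) (fun i => #|pat (enum_val i)|) ui0.
have /rowP/(_ i) := uK; rewrite [X in X = _]mxE [X in _ = X]mxE (bigD1 i) //= big1 ?addr0 => [|j ji].
  rewrite AC => /eqP; rewrite mulf_eq0 (negPf ui) /= f_eq0.
  by rewrite subxx.
rewrite AC; have [->|uj] := eqVneq (u 0 j) 0; first by rewrite mul0r.
apply/eqP; rewrite mulf_eq0 (negPf uj) /= f_eq0; apply: contra ji => sub_ij.
have /eqP e : pat (enum_val i) == pat (enum_val j) by rewrite eqEcard sub_ij max_i.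
by apply/eqP/enum_val_inj/inj_pat.
Qed.

End ZeroPatterns.

Section Definable.
Variable k : closedFieldType.
Implicit Types (e z : seq k) (t : GRing.term k) (f : GRing.formula k).

Definition definable (S : seq k -> Prop) :=
  exists f, forall e, GRing.holds e f <-> S e.

Definition polynomial_term (g : seq k -> k) :=
  exists t, forall e, GRing.eval e t = g e.

Lemma definable_and S1 S2 : definable S1 -> definable S2 ->
  definable (fun e => S1 e /\ S2 e).
Proof. by case=> f1 h1 [f2 h2]; exists (GRing.And f1 f2) => e /=; rewrite h1 h2. Qed.

Lemma definable_not S : definable S -> definable (fun e => ~ S e).
Proof. by case=> f h; exists (GRing.Not f) => e /=; rewrite h. Qed.

Lemma definable_eq S1 S2 : (forall e, S1 e <-> S2 e) -> definable S1 -> definable S2.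
Proof. by move=> h12 [f h]; exists f => e; rewrite h h12. Qed.

Lemma definable_imp S1 S2 : definable S1 -> definable S2 ->
  definable (fun e => S1 e -> S2 e).
Proof. by case=> f1 h1 [f2 h2]; exists (GRing.Implies f1 f2) => e /=; rewrite h1 h2. Qed.

Lemma definable_all (I : Type) (r : seq I) (S : I -> seq k -> Prop) :
  (forall i, definable (S i)) -> definable (fun e => foldr (fun i P => S i e /\ P) True r).
Proof.
move=> h; elim: r => [|i r IH] /=; first by exists (GRing.Bool true).
exact: definable_and.
Qed.

Lemma definable_all_in (I : eqType) (r : seq I) (S : I -> seq k -> Prop) :
  (forall i, definable (S i)) -> definable (fun e => {in r, forall i, S i e}).
Proof.
move=> h; apply: definable_eq (definable_all r h) => e; elim: r => [|i r IH] /=.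
  by split.
rewrite IH; split=> [[h1 h2] j|h1]; last first.
  by split=> [|j jr]; apply: h1; rewrite inE ?eqxx ?jr ?orbT.
by rewrite inE => /orP[/eqP->//|/h2].
Qed.

Lemma definable_forall (I : finType) (S : I -> seq k -> Prop) :
  (forall i, definable (S i)) -> definable (fun e => forall i, S i e).
Proof.
move=> h; apply: definable_eq (definable_all_in (enum I) h) => e.
by split=> [h1 i|h1 i _]; [apply: h1; rewrite mem_enum | exact: h1].
Qed.

(** The quantified block occupies the positions [a] to [a + b - 1] of the environment. Padding to
    length [maxn (a + b) (size e)] makes them exist and agrees with the default value 0 of [nth]. *)
Lemma definable_exists a b (S : seq k -> Prop) : definable S ->
  definable (fun e => exists g : nat -> k,
    S (mkseq (fun i => if (a <= i < a + b)%N then g i else e`_i) (maxn (a + b) (size e)))).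
Proof.
case=> f h; exists (foldr GRing.Exists f (iota a b)) => e.
rewrite -GRing.foldExistsP; split=> [[e' ee' he']|[g hg]].
  exists (nth 0 e'); apply/h; apply: GRing.eq_holds he' => i.
  have [ib|ib] := ltnP i (maxn (a + b) (size e)); last first.
    rewrite [RHS]nth_default ?size_mkseq // -ee' ?nth_default //.
      by apply: leq_trans ib; rewrite leq_maxr.
    by rewrite inE /= mem_iota; move: ib; set n := size e; lia.
  rewrite nth_mkseq //; case: ifPn => // iab; rewrite -ee' // inE mem_iota //.
exists (mkseq (fun i => if (a <= i < a + b)%N then g i else e`_i) (maxn (a + b) (size e))); last exact/h.
move=> i; rewrite inE mem_iota => iab.
have [ib|ib] := ltnP i (maxn (a + b) (size e)).
  by rewrite nth_mkseq // (negPf iab).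
rewrite !nth_default ?size_mkseq //.
by apply: leq_trans ib; rewrite leq_maxr.
Qed.

Lemma definable_eqf g1 g2 : polynomial_term g1 -> polynomial_term g2 ->
  definable (fun e => g1 e = g2 e).
Proof. by case=> t1 h1 [t2 h2]; exists (GRing.Equal t1 t2) => e /=; rewrite h1 h2. Qed.

Lemma polynomial_var i : polynomial_term (fun e => e`_i).
Proof. by exists (GRing.Var _ i). Qed.

Lemma polynomial_cst c : polynomial_term (fun=> c).
Proof. by exists (GRing.Const c). Qed.

Lemma polynomial_add g1 g2 : polynomial_term g1 -> polynomial_term g2 ->
  polynomial_term (fun e => g1 e + g2 e).
Proof. by case=> t1 h1 [t2 h2]; exists (GRing.Add t1 t2) => e /=; rewrite h1 h2. Qed.

Lemma polynomial_mul g1 g2 : polynomial_term g1 -> polynomial_term g2 ->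
  polynomial_term (fun e => g1 e * g2 e).
Proof. by case=> t1 h1 [t2 h2]; exists (GRing.Mul t1 t2) => e /=; rewrite h1 h2. Qed.

Lemma polynomial_exp g n : polynomial_term g -> polynomial_term (fun e => g e ^+ n).
Proof. by case=> t h; exists (GRing.Exp t n) => e /=; rewrite h. Qed.

Lemma polynomial_eq g1 g2 : g1 =1 g2 -> polynomial_term g1 -> polynomial_term g2.
Proof. by move=> h12 [t h]; exists t => e; rewrite h h12. Qed.

Lemma polynomial_sum (I : Type) (r : seq I) (Q : pred I) (g : I -> seq k -> k) :
  (forall i, polynomial_term (g i)) -> polynomial_term (fun e => \sum_(i <- r | Q i) g i e).
Proof.
move=> h; elim: r => [|i r IH].
  by apply: polynomial_eq (polynomial_cst 0) => e; rewrite big_nil.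
case Qi: (Q i); last by apply: polynomial_eq IH => e; rewrite big_cons Qi.
by apply: polynomial_eq (polynomial_add (h i) IH) => e; rewrite big_cons Qi.
Qed.

Lemma polynomial_prod (I : Type) (r : seq I) (Q : pred I) (g : I -> seq k -> k) :
  (forall i, polynomial_term (g i)) -> polynomial_term (fun e => \prod_(i <- r | Q i) g i e).
Proof.
move=> h; elim: r => [|i r IH].
  by apply: polynomial_eq (polynomial_cst 1) => e; rewrite big_nil.
case Qi: (Q i); last by apply: polynomial_eq IH => e; rewrite big_cons Qi.
by apply: polynomial_eq (polynomial_mul (h i) IH) => e; rewrite big_cons Qi.
Qed.

Lemma polynomial_meval n (p : {mpoly k[n]}) (x : 'I_n -> seq k -> k) :
  (forall i, polynomial_term (x i)) -> polynomial_term (fun e => p.@[x^~ e]).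
Proof.
move=> h; apply: (@polynomial_eq (fun e => \sum_(m <- msupp p) p@_m * \prod_i x i e ^+ m i)).
  by move=> e; rewrite mevalE.
apply: polynomial_sum => m; apply: polynomial_mul (polynomial_cst _) _.
by apply: polynomial_prod => i; exact: polynomial_exp.
Qed.

Fixpoint atoms f : seq (GRing.term k) :=
  match f with
  | GRing.Equal t1 t2 => [:: GRing.Add t1 (GRing.Opp t2)]
  | GRing.And f1 f2 | GRing.Or f1 f2 | GRing.Implies f1 f2 => atoms f1 ++ atoms f2
  | GRing.Not f1 => atoms f1
  | _ => [::]
  end.

Lemma atoms_rterm f : GRing.rformula f -> all (@GRing.rterm k) (atoms f).
Proof.
elim: f => //=.
- by move=> t1 t2 /andP[-> ->].
- by move=> f1 IH1 f2 IH2 /andP[/IH1 + /IH2]; rewrite all_cat => -> ->.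
- by move=> f1 IH1 f2 IH2 /andP[/IH1 + /IH2]; rewrite all_cat => -> ->.
- by move=> f1 IH1 f2 IH2 /andP[/IH1 + /IH2]; rewrite all_cat => -> ->.
Qed.

Lemma eq_atoms f e e' : GRing.rformula f ->
  all (fun t => (GRing.eval e t == 0) == (GRing.eval e' t == 0)) (atoms f) ->
  GRing.qf_eval e f = GRing.qf_eval e' f.
Proof.
elim: f => //=.
- by move=> t1 t2 _; rewrite andbT !subr_eq0 => /eqP.
- by move=> f1 IH1 f2 IH2 /andP[r1 r2]; rewrite all_cat => /andP[/IH1 -> // /IH2 ->].
- by move=> f1 IH1 f2 IH2 /andP[r1 r2]; rewrite all_cat => /andP[/IH1 -> // /IH2 ->].
- by move=> f1 IH1 f2 IH2 /andP[r1 r2]; rewrite all_cat => /andP[/IH1 -> // /IH2 ->].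
- by move=> f IH rf h; rewrite IH.
Qed.

Lemma definable_qf S : definable S -> exists f, GRing.rformula f /\
  forall e, S e <-> GRing.qf_eval e f.
Proof.
case=> f h; have rf := GRing.to_rform_rformula f.
have wf := @ClosedFieldQE.wf_ex_elim k.
have ok := ClosedFieldQE.holds_ex_elim (@GRing.solve_monicpoly k).
exists (GRing.quantifier_elim (@ClosedFieldQE.ex_elim k) (GRing.to_rform f)); split.
  by case/andP: (GRing.quantifier_elim_wf wf rf).
move=> e; rewrite -h; have := GRing.to_rformP e f => to_f.
by split=> [/to_f/(GRing.quantifier_elim_rformP wf ok e rf)|/(GRing.quantifier_elim_rformP wf ok e rf)/to_f].
Qed.

Lemma rterm_poly t e i : GRing.rterm t ->
  exists p : {poly k}, forall x, GRing.eval (set_nth 0 e i x) t = p.[x].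
Proof.
elim: t => //=.
- move=> j _; have [->|ji] := eqVneq j i.
    by exists 'X => x; rewrite nth_set_nth /= eqxx hornerX.
  by exists (e`_j)%:P => x; rewrite nth_set_nth /= (negPf ji) hornerC.
- by move=> c _; exists c%:P => x; rewrite hornerC.
- by move=> m _; exists m%:R%:P => x; rewrite hornerC.
- move=> t1 IH1 t2 IH2 /andP[/IH1[p1 h1] /IH2[p2 h2]].
  by exists (p1 + p2) => x; rewrite h1 h2 hornerD.
- by move=> t1 IH1 /IH1[p1 h1]; exists (- p1) => x; rewrite h1 hornerN.
- by move=> t1 IH1 m /IH1[p1 h1]; exists (p1 *+ m) => x; rewrite h1 hornerMn.
- move=> t1 IH1 t2 IH2 /andP[/IH1[p1 h1] /IH2[p2 h2]].
  by exists (p1 * p2) => x; rewrite h1 h2 hornerM.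
- by move=> t1 IH1 m /IH1[p1 h1]; exists (p1 ^+ m) => x; rewrite h1 horner_exp.
Qed.

(** Strong minimality of algebraically closed fields: after quantifier elimination only polynomial
    equations in the chosen variable remain, and [p] is the product of their left-hand sides that
    are not identically zero. *)
Lemma definable1 S e i : definable S -> exists2 p : {poly k}, p != 0 &
  forall x y, p.[x] != 0 -> p.[y] != 0 ->
    S (set_nth 0 e i x) -> S (set_nth 0 e i y).
Proof.
case/definable_qf=> f [rf hf].
suff [p p0 hp] : exists2 p : {poly k}, p != 0 & forall x y, p.[x] != 0 -> p.[y] != 0 ->
    all (fun t => (GRing.eval (set_nth 0 e i x) t == 0) ==
      (GRing.eval (set_nth 0 e i y) t == 0)) (atoms f).
  exists p => // x y px py; rewrite !hf => fx.
  by rewrite -(eq_atoms rf (hp _ _ px py)).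
elim: (atoms f) (atoms_rterm rf) => [|t ts IH] /=; first by exists 1 => //; exact: oner_neq0.
case/andP=> rt /IH[p p0 hp]; have [q hq] := rterm_poly e i rt.
have [q0|q0] := eqVneq q 0.
  by exists p => // x y px py; rewrite /= hp // !hq q0 !horner0 eqxx.
exists (p * q); first by rewrite mulf_neq0.
move=> x y; rewrite !hornerM !mulf_eq0 !negb_or => /andP[px qx] /andP[py qy].
by rewrite /= hp // !hq (negPf qx) (negPf qy).
Qed.

End Definable.

(** * Saturation over an uncountable field *)

Section Saturation.
Variable k : closedFieldType.
Hypothesis k_uncountable : ~ countable [set: k].

Lemma poly_roots (p : {poly k}) : p != 0 -> exists rs : seq k, forall x, root p x = (x \in rs).
Proof.
move=> p0; have [rs ->] := closed_field_poly_normal p; exists rs => x.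
by rewrite rootZ ?lead_coef_eq0 // root_prod_XsubC.
Qed.

Lemma infinite_nonroot (A : set k) (p : {poly k}) :
  infinite_set A -> p != 0 -> exists2 x, A x & p.[x] != 0.
Proof.
move=> infA p0; have [rs hrs] := poly_roots p0.
apply: contrapT => h; apply: infA; apply: (@sub_finite_set _ _ [set` rs]); last exact: finite_seq.
move=> x Ax /=; rewrite -hrs; apply/rootP/eqP; apply: contrapT => /negP px.
by apply: h; exists x.
Qed.

(** Either some [S i] holds at a point off its exceptional roots, hence at all but finitely many
    [x], and monotonicity absorbs the rest; or every [x] is a root of one of countably many nonzero
    polynomials, against uncountability. *)
Lemma saturation1 (S : nat -> seq k -> Prop) e j :
  (forall i, definable (S i)) -> (forall i e', S i e' -> S i.+1 e') ->
  (forall x, exists i, S i (set_nth 0 e j x)) -> exists i, forall x, S i (set_nth 0 e j x).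
Proof.
move=> defS incS covS.
have leS i i' e' : (i <= i')%N -> S i e' -> S i' e'.
  by move=> /subnK <-; elim: (i' - i)%N => // d IH Si; rewrite addSn; apply/incS/IH.
have hp i := definable1 e j (defS i).
have [p p0 {}hp] : exists2 p : nat -> {poly k}, (forall i, p i != 0) &
    forall i x y, (p i).[x] != 0 -> (p i).[y] != 0 ->
      S i (set_nth 0 e j x) -> S i (set_nth 0 e j y).
  have /choice[p hp'] i : exists p : {poly k}, p != 0 /\ forall x y, p.[x] != 0 -> p.[y] != 0 ->
      S i (set_nth 0 e j x) -> S i (set_nth 0 e j y).
    by have [p p0 pS] := hp i; exists p.
  by exists p => i; have [] := hp' i.
have [[i [x [px Sx]]]|none] := pselect (exists i x, (p i).[x] != 0 /\ S i (set_nth 0 e j x)).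
  have [rs hrs] := poly_roots (p0 i).
  have [i' hi'] : exists i', forall y, y \in rs -> S i' (set_nth 0 e j y).
    elim: rs {hrs} => [|y rs [i' IH]]; first by exists 0%N.
    have [i'' hy] := covS y; exists (maxn i' i'') => z; rewrite inE => /orP[/eqP->|zrs].
      by apply: leS hy; rewrite leq_maxr.
    by apply: leS (IH z zrs); rewrite leq_maxl.
  exists (maxn i i') => y; have [py|py] := boolP (root (p i) y).
    by apply: (@leS i'); rewrite ?leq_maxr //; apply: hi'; rewrite -hrs.
  by apply: (@leS i); rewrite ?leq_maxl //; apply: (hp i x y).
exfalso; apply: k_uncountable.
have sub : [set: k] `<=` \bigcup_i [set x | root (p i) x].
  move=> x _; have [i Si] := covS x; exists i => //=.
  by apply/rootP/eqP; apply: contrapT => /negP px; apply: none; exists i, x.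
apply: sub_countable (subset_card_le sub) _; apply: bigcup_countable => // i _.
apply: finite_set_countable; have [rs hrs] := poly_roots (p0 i).
by apply: (@sub_finite_set _ _ [set` rs]); [move=> x /=; rewrite hrs | exact: finite_seq].
Qed.

(** Variables are bound one at a time: universal quantification of an increasing definable family
    gives a family of the same kind. *)
Lemma saturation (S : nat -> seq k -> Prop) q :
  (forall i, definable (S i)) -> (forall i e, S i e -> S i.+1 e) ->
  (forall e, exists i, S i e) -> exists i, forall e, (size e <= q)%N -> S i e.
Proof.
move=> /choice[f hf] incS covS.
pose F I i e := GRing.holds e (foldr GRing.Forall (f i) I).
have incF I i e : F I i e -> F I i.+1 e.
  elim: I e => [|j I IH] e /=; first by rewrite /F /= !hf; apply: incS.
  by move=> h x; apply: IH; apply: h.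
have covF I e : exists i, F I i e.
  elim: I e => [|j I IH] e; first by have [i Si] := covS e; exists i; apply/hf.
  apply: (@saturation1 (F I) e j) => [i|i e'|x]; last exact: IH.
    by exists (foldr GRing.Forall (f i) I).
  exact: incF.
have [i hi] := covF (iota 0 q) [::].
exists i => e se; apply/hf; move: hi; rewrite /F -GRing.foldForallP => /(_ e); apply => j.
rewrite inE mem_iota /= add0n -leqNgt => qj.
by rewrite !nth_default // (leq_trans se).
Qed.

End Saturation.

Section NoSection.
Variable k : closedFieldType.

(** The point is that [D] does not depend on the first variable, which the grid argument below
    specializes to many values. [rterm_size] is the dual bound, in the first variable and uniform in
    the others. *)
Lemma rterm_mpoly (t : GRing.term k) M : GRing.rterm t -> exists D, forall x : k,
  exists2 p : {mpoly k[M]}, (msize p <= D)%N &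
    forall z : 'I_M -> k, GRing.eval (x :: mkseq (fun i => if insub i is Some j then z j else 0) M) t = p.@[z].
Proof.
elim: t => //=.
- move=> [|j] _; first by exists 1%N => x; exists x%:MP; rewrite ?msizeC ?leq_b1 // => z; rewrite mevalC.
  have [jM|jM] := ltnP j M.
    exists 2 => x; exists 'X_(Ordinal jM); first by rewrite msizeX mdeg1.
    by move=> z; rewrite /= nth_mkseq // mevalXU; case: insubP => [u _ /= uj|]; [congr z; apply: val_inj | rewrite jM].
  by exists 0%N => x; exists 0; rewrite ?msize0 // => z; rewrite /= nth_default ?size_mkseq // meval0.
- by move=> c _; exists 1%N => x; exists c%:MP; rewrite ?msizeC ?leq_b1 // => z; rewrite mevalC.
- by move=> m _; exists 1%N => x; exists m%:R%:MP; rewrite ?msizeC ?leq_b1 // => z; rewrite mevalC.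
- move=> t1 IH1 t2 IH2 /andP[/IH1[D1 h1] /IH2[D2 h2]]; exists (maxn D1 D2) => x.
  have [[p1 s1 {}h1] [p2 s2 {}h2]] := (h1 x, h2 x).
  exists (p1 + p2) => [|z]; last by rewrite h1 h2 mevalD.
  by rewrite (leq_trans (msizeD_le _ _)) // geq_max !leq_max s1 s2 orbT.
- move=> t1 IH1 /IH1[D1 h1]; exists D1 => x; have [p1 s1 {}h1] := h1 x.
  by exists (- p1) => [|z]; rewrite ?msizeN // h1 mevalN.
- move=> t1 IH1 m /IH1[D1 h1]; exists D1 => x; have [p1 s1 {}h1] := h1 x.
  exists (p1 *+ m) => [|z]; last by rewrite h1 mevalMn.
  rewrite -scaler_nat; exact: leq_trans (msizeZ_le _ _) s1.
- move=> t1 IH1 t2 IH2 /andP[/IH1[D1 h1] /IH2[D2 h2]]; exists (D1 + D2).+1 => x.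
  have [[p1 s1 {}h1] [p2 s2 {}h2]] := (h1 x, h2 x).
  exists (p1 * p2) => [|z]; last by rewrite h1 h2 mevalM.
  by rewrite (leq_trans (msizeM_le _ _)) // ltnS leq_add.
- move=> t1 IH1 m /IH1[D1 h1].
  exists (m * D1.+1).+1 => x; have [p1 s1 {}h1] := h1 x.
  exists (p1 ^+ m) => [|z]; last by rewrite h1 rmorphXn.
  elim: m => [|m IH]; first by rewrite expr0 msize1.
  rewrite exprS (leq_trans (msizeM_le _ _)) // ltnS mulSn addSn.
  have := leq_add s1 IH; rewrite addnS => h; apply: leq_trans h _.
  by rewrite leqnn.
Qed.

Lemma rterm_size (t : GRing.term k) : GRing.rterm t -> exists D, forall z : seq k,
  exists2 p : {poly k}, (size p <= D)%N & forall x, GRing.eval (x :: z) t = p.[x].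
Proof.
elim: t => //=.
- move=> [|j] _; first by exists 2 => z; exists 'X; rewrite ?size_polyX // => x; rewrite hornerX.
  by exists 1%N => z; exists (z`_j)%:P; rewrite ?size_polyC ?leq_b1 // => x; rewrite hornerC.
- by move=> c _; exists 1%N => x; exists c%:P; rewrite ?size_polyC ?leq_b1 // => z; rewrite hornerC.
- by move=> m _; exists 1%N => x; exists m%:R%:P; rewrite ?size_polyC ?leq_b1 // => z; rewrite hornerC.
- move=> t1 IH1 t2 IH2 /andP[/IH1[D1 h1] /IH2[D2 h2]]; exists (maxn D1 D2) => x.
  have [[p1 s1 {}h1] [p2 s2 {}h2]] := (h1 x, h2 x).
  exists (p1 + p2) => [|z]; last by rewrite h1 h2 hornerD.
  by rewrite (leq_trans (size_polyD _ _)) // geq_max !leq_max s1 s2 orbT.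
- move=> t1 IH1 /IH1[D1 h1]; exists D1 => x; have [p1 s1 {}h1] := h1 x.
  by exists (- p1) => [|z]; rewrite ?size_polyN // h1 hornerN.
- move=> t1 IH1 m /IH1[D1 h1]; exists D1 => x; have [p1 s1 {}h1] := h1 x.
  exists (p1 *+ m) => [|z]; last by rewrite h1 hornerMn.
  rewrite -scaler_nat; exact: leq_trans (size_scale_leq _ _) s1.
- move=> t1 IH1 t2 IH2 /andP[/IH1[D1 h1] /IH2[D2 h2]]; exists (D1 + D2)%N => x.
  have [[p1 s1 {}h1] [p2 s2 {}h2]] := (h1 x, h2 x).
  exists (p1 * p2) => [|z]; last by rewrite h1 h2 hornerM.
  by rewrite (leq_trans (size_polyMleq _ _)) // (leq_trans (leq_pred _)) // leq_add.
- move=> t1 IH1 m /IH1[D1 h1].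
  exists (D1 * m).+1 => x; have [p1 s1 {}h1] := h1 x.
  exists (p1 ^+ m) => [|z]; last by rewrite h1 horner_exp.
  rewrite (leq_trans (size_poly_exp_leq _ _)) // ltnS leq_mul2r; apply/orP; right.
  by rewrite (leq_trans (leq_pred _)).
Qed.

End NoSection.

Local Close Scope classical_set_scope.

Lemma infinite_seq (T : choiceType) (A : set T) g : infinite_set A ->
  exists c : 'I_g -> T, injective c /\ forall a, A (c a).
Proof.
move=> infA.
have [s [us ss sA]] : exists s : seq T, [/\ uniq s, size s = g & forall x, x \in s -> A x].
  elim: g => [|g [s [us ss sA]]]; first by exists [::].
  have [x Ax xs] : exists2 x, A x & x \notin s.
    apply: contrapT => h; apply: infA; apply: (@sub_finite_set _ _ [set` s]%classic); last exact: finite_seq.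
    by move=> x Ax /=; apply: contrapT => /negP xs; apply: h; exists x.
  exists (x :: s); split; rewrite /= ?xs ?us ?ss // => y; rewrite inE => /orP[/eqP->//|]; exact: sA.
exists (fun a => tnth (in_tuple s) (cast_ord (esym ss) a)); split=> [a b|a].
  by move/(tuple_uniqP (in_tuple s)): us => h /h /(congr1 val) /= ab; exact: val_inj.
by apply: sA; exact: mem_tnth.
Qed.

Definition seq_of (k : fieldType) M (z : 'I_M -> k) : seq k :=
  mkseq (fun i => if insub i is Some j then z j else 0) M.

Section NoSection.
Variable k : closedFieldType.

(* Quantifier elimination makes each [y i] a root of one of finitely many
   nonzero polynomials over z; restricting [y] to a grid of g^m points and
   counting zero patterns in M variables gives g^m = O(g^M). *)
Lemma no_definable_section M m (Psi : 'I_m -> seq k -> Prop) (Y : set k) :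
  (M < m)%N -> infinite_set Y -> (forall i, definable (Psi i)) ->
  (forall y : 'I_m -> k, (forall i, Y (y i)) -> exists z : 'I_M -> k,
     forall i x, Psi i (x :: seq_of z) <-> x = y i) -> False.
Proof.
move=> ltMm infY defPsi hPsi.
have infk : infinite_set [set: k]%classic by apply: sub_infinite_set infY.
have /choice[f hf] i := definable_qf (defPsi i).
pose ts := flatten [seq atoms (f i) | i <- enum 'I_m].
have rts : all (@GRing.rterm k) ts.
  rewrite /ts; elim: (enum 'I_m) => //= i r IH; rewrite all_cat IH andbT.
  by apply: atoms_rterm; have [] := hf i.
have all_ts i (Q : pred (GRing.term k)) : all Q ts -> all Q (atoms (f i)).
  rewrite /ts; have := mem_enum 'I_m i; elim: (enum 'I_m) => //= j r IH.
  by rewrite inE all_cat => /orP[/eqP<-|/IH h] /andP[].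
pose L := size ts; pose t (l : 'I_L) := nth (GRing.NatConst _ 0) ts l.
have rt l : GRing.rterm (t l) by exact: (all_nthP _ rts).
have /choice[D1 hD1] l := rterm_mpoly M (rt l).
have /choice[D2 hD2] l := rterm_size (rt l).
pose E1 := (\max_l D1 l).+1; pose E2 := (\max_l D2 l)%N.
(* [(L * E1).+1 ^ M * g ^ M] will bound the number of zero patterns and [(L * E2) ^ m] the number of
   grid points sharing one; [C < g] and [M < m] then give [C * g ^ M < g ^ m]. *)
pose C := ((L * E1).+1 ^ M * (L * E2) ^ m)%N; pose g := C.+1.
have [c [inj_c Yc]] := infinite_seq g infY.
pose T := {ffun 'I_m -> 'I_g}.
have /choice[z hz] (y : T) := hPsi (fun i => c (y i)) (fun i => Yc _).
have /choice[P hP] (la : 'I_L * 'I_g) : exists p : {mpoly k[M]}, (msize p < E1)%N /\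
    forall z, GRing.eval (c la.2 :: seq_of z) (t la.1) = p.@[z].
  have [p sp hp] := hD1 la.1 (c la.2); exists p; split=> //.
  by rewrite ltnS (leq_trans sp) // leq_bigmax.
pose pat (y : T) := [set la | (P la).@[z y] == 0].
pose row (S : {set 'I_L * 'I_g}) l := [set a | (l, a) \in S].
(* In a realized pattern, a row with more than [E2] zeros comes from an atom vanishing identically
   in [x], which carries no information. *)
pose cand S := \bigcup_(l | (#|row S l| <= E2)%N) row S l.
have card_cand S : (#|cand S| <= L * E2)%N.
  rewrite /cand -[L in (L * _)%N]card_ord -sum_nat_const.
  apply: (@leq_trans (\sum_(l | (#|row S l| <= E2)%N) #|row S l|)).
    elim/big_ind2: _ => [|A a B b hA hB|//]; first by rewrite cards0.
    by rewrite (leq_trans (leq_card_setU _ _)) // leq_add.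
  by rewrite big_mkcond leq_sum // => l _; case: ifP.
have pat_cand (y : T) i : y i \in cand (pat y).
  have [rfi hfi] := hf i.
  have /choice[q hq] l : exists q : {poly k}, (size q <= E2)%N /\
      forall x, GRing.eval (x :: seq_of (z y)) (t l) = q.[x].
    have [p sp hp] := hD2 l (seq_of (z y)); exists p; split=> //.
    by rewrite (leq_trans sp) // leq_bigmax.
  (* If no nonzero [q l] vanished at [c (y i)], a generic [x] would give all atoms the same zero
     pattern as [c (y i)] does, against the uniqueness in [hPsi]. *)
  have [l ql0 /rootP qly] : exists2 l, q l != 0 & (q l).[c (y i)] = 0.
    apply: contrapT => none.
    pose p := ('X - (c (y i))%:P) * \prod_(l | q l != 0) q l.
    have p0 : p != 0.
      by rewrite mulf_neq0 ?polyXsubC_eq0 //; apply/prodf_neq0.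
    have [x _] := infinite_nonroot infk p0.
    rewrite hornerM !hornerE mulf_eq0 negb_or subr_eq0 => /andP[/eqP xy].
    rewrite horner_prod => /prodf_neq0 hx; apply: xy.
    apply/(hz y i); apply/hfi.
    have -> : GRing.qf_eval (x :: seq_of (z y)) (f i) =
        GRing.qf_eval (c (y i) :: seq_of (z y)) (f i).
      apply: eq_atoms => //.
      apply: all_ts.
      apply/(all_nthP (GRing.NatConst _ 0)) => l lL.
      have [_ hql] := hq (Ordinal lL); rewrite -/(t (Ordinal lL)) !hql.
      have [->|ql0] := eqVneq (q (Ordinal lL)) 0; first by rewrite !horner0.
      rewrite (negPf (hx _ ql0)) eq_sym eqbF_neg; apply/eqP => qy; apply: none.
      by exists (Ordinal lL).
    by apply/hfi/(hz y i).
  apply/bigcupP; exists l; last first.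
    rewrite !inE; have [_ <-] := hP (l, y i); have [_ ->] := hq l.
    by apply/eqP/rootP.
  have [sq hql] := hq l; apply: leq_trans sq; rewrite -ltnS ltnW // ltnS.
  rewrite cardE -(size_map c); apply: max_poly_roots => //; last by rewrite map_inj_uniq // enum_uniq.
  apply/allP => _ /mapP[a + ->]; rewrite mem_enum !inE; have [_ <-] := hP (l, a).
  by rewrite hql.
pose pats := [set pat y | y in [set: T]].
have card_pats : (#|pats| <= (L * E1).+1 ^ M * g ^ M)%N.
  have rep (S : {S | S \in pats}) : exists y, pat y = val S.
    by case: S => S /= /imsetP[y _ ->]; exists y.
  have {rep}/choice[rep repS] := rep.
  have := @card_zero_patterns _ M _ {S | S \in pats} P (\max_l D1 l) (z \o rep).
  rewrite card_sig card_prod !card_ord => h; apply: leq_trans (h _ _) _.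
  - by move=> la; rewrite -ltnS; have [] := hP la.
  - by move=> S1 S2 /= h12; apply: val_inj; rewrite -!repS.
  rewrite -expnMn; have le_base : ((L * g * E1).+1 <= (L * E1).+1 * g)%N.
    by rewrite mulSn -mulnA [(g * _)%N]mulnC mulnA -addn1 addnC leq_add2r.
  by elim: (M) => // M' IH; rewrite !expnS leq_mul.
have : (#|T| <= #|pats| * (L * E2) ^ m)%N.
  have -> : #|T| = (\sum_(y : T) 1)%N by rewrite sum1_card.
  rewrite (partition_big pat (mem pats)) /=; last first.
    by move=> y _; apply: imset_f.
  rewrite -sum_nat_const leq_sum // => S _; rewrite sum1_card.
  apply: (@leq_trans (#|cand S| ^ #|'I_m|)); last first.
    rewrite card_ord.
    by elim: (m) => // m' IH; rewrite !expnS leq_mul.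
  rewrite -card_ffun_on; apply/subset_leq_card/fintype.subsetP => y; rewrite -[_ \in _]/(pat y == S) => /eqP <-.
  by apply/ffun_onP => i.
rewrite card_ffun !card_ord leqNgt => /negP; apply.
apply: (@leq_ltn_trans (C * g ^ M)).
  by rewrite /C mulnAC leq_mul2r card_pats orbT.
apply: (@leq_trans (g * g ^ M)); first by rewrite ltn_mul2r expn_gt0 ltnSn.
by rewrite -expnS leq_pexp2l.
Qed.
End NoSection.

(** * Dickson's lemma and noetherianity *)

Section Noetherian.

Lemma nondecreasing_subsequence (u : nat -> nat) :
  exists phi : nat -> nat, (forall i, phi i < phi i.+1)%N /\
    forall i j, (i <= j)%N -> (u (phi i) <= u (phi j))%N.
Proof.
(* [next a] is an index beyond [a] at which [u] attains its minimum over all indices beyond [a]. *)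
have /choice[next hnext] a : exists b, (a < b)%N /\ forall c, (a < c)%N -> (u b <= u c)%N.
  have ex : exists v, `[< exists2 b, (a < b)%N & u b = v >].
    by exists (u a.+1); apply/asboolP; exists a.+1.
  case: (ex_minnP ex) => v /asboolP[b' ab' ub'] hmin.
  exists b'; split=> // c ac; rewrite ub'; apply: hmin; apply/asboolP; by exists c.
pose phi := fix phi i := if i is i'.+1 then next (phi i') else next 0%N.
exists phi; split=> [i|i j /subnK <-]; first by have [] := hnext (phi i).
have phi_ge a i' : (a < phi i')%N -> (a < phi i'.+1)%N.
  by move=> h; apply: ltn_trans h _; have [] := hnext (phi i').
elim: (j - i)%N => // d IH; rewrite addSn; apply: leq_trans IH _.
have [a [h1 h2]] : exists a, (a < phi (d + i)%N)%N /\ forall c, (a < c)%N -> (u (phi (d + i)%N) <= u c)%N.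
  by case: (d + i)%N => [|l]; [exists 0%N | exists (phi l)]; exact: hnext.
by apply: h2; exact: phi_ge.
Qed.

Lemma mnm_wqo n (f : nat -> 'X_{1..n}) : exists i j, (i < j)%N /\ (f i <= f j)%MM.
Proof.
have [phi [phi_inc hphi]] : exists phi : nat -> nat, (forall i, phi i < phi i.+1)%N /\
    forall l, l \in enum 'I_n -> forall i j, (i <= j)%N -> (f (phi i) l <= f (phi j) l)%N.
  elim: (enum 'I_n) => [|l r [phi [phi_inc hphi]]]; first by exists id.
  have [psi [psi_inc hpsi]] := nondecreasing_subsequence (fun i => f (phi i) l).
  have mono (g : nat -> nat) : (forall i, g i < g i.+1)%N -> forall i j, (i <= j)%N -> (g i <= g j)%N.
    by move=> g_inc i j /subnK <-; elim: (j - i)%N => // d IH; rewrite addSn (leq_trans IH) // ltnW.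
  exists (phi \o psi); split=> [i /=|l' + i j ij].
    by apply: (@leq_trans (phi (psi i).+1)) => //; apply: mono.
  by rewrite inE => /orP[/eqP->|/hphi]; [exact: hpsi | apply; apply: mono].
exists (phi 0%N), (phi 1%N); split=> //; apply/mnm_lepP => l.
by apply: hphi; rewrite ?mem_enum.
Qed.

(** Otherwise each finite list in [A] can be extended by an element that no member of the list
    divides, and the resulting sequence contradicts [mnm_wqo]. *)
Lemma dickson n (A : 'X_{1..n} -> Prop) : exists s : seq 'X_{1..n},
  (forall m, m \in s -> A m) /\ forall m, A m -> exists2 m', m' \in s & (m' <= m)%MM.
Proof.
apply: contrapT => none.
have /choice[F hF] (s : {s : seq 'X_{1..n} | forall m, m \in s -> A m}) :
    exists m, A m /\ forall m', m' \in sval s -> ~ (m' <= m)%MM.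
  case: s => s sA /=; apply: contrapT => h; apply: none; exists s; split=> // m Am.
  apply: contrapT => h'; apply: h; exists m; split=> // m' m's m'm; apply: h'.
  by exists m'.
have stepA (s : {s : seq 'X_{1..n} | forall m, m \in s -> A m}) m : m \in F s :: sval s -> A m.
  by rewrite inE => /orP[/eqP->|]; [have [] := hF s | exact: (svalP s)].
pose step s := exist (fun s : seq 'X_{1..n} => forall m, m \in s -> A m) _ (@stepA s).
have nilA : forall m : 'X_{1..n}, m \in [::] -> A m by [].
pose L := fix L i := if i is i'.+1 then step (L i') else exist _ [::] nilA.
have [i [j [ij le]]] := mnm_wqo (F \o L).
have [_ /(_ (F (L i)))] := hF (L j); apply=> //.
have inL : F (L i) \in sval (L i.+1) by rewrite /= inE eqxx.
rewrite -(subnK ij); elim: (j - i.+1)%N => //= d IH.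
by rewrite inE IH orbT.
Qed.

Variables (k : fieldType) (n : nat).

(** Hilbert's basis theorem, phrased through zeros so that no ideal has to be generated: [I]
    collects the polynomials vanishing wherever some finitely many members of [S] do. By Dickson's
    lemma finitely many leading monomials suffice, and division by the corresponding elements of [I]
    terminates. *)
Lemma noetherian_zeros (S : {mpoly k[n]} -> Prop) : exists s : seq {mpoly k[n]},
  (forall p, p \in s -> S p) /\
  forall x, (forall p, p \in s -> p.@[x] = 0) -> forall p, S p -> p.@[x] = 0.
Proof.
pose I f := exists s : seq {mpoly k[n]}, (forall p, p \in s -> S p) /\
  forall x, (forall p, p \in s -> p.@[x] = 0) -> f.@[x] = 0.
have I_sub f g c : I f -> I g -> I (f - c * g).
  move=> [s [sS hf]] [t [tS hg]]; exists (s ++ t); split=> [p|x h].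
    by rewrite mem_cat => /orP[/sS|/tS].
  rewrite mevalB mevalM hf ?hg ?mulr0 ?subr0 // => p ps; apply: h.
    by rewrite mem_cat ps orbT.
  by rewrite mem_cat ps.
have [ms [msA hms]] := dickson (fun m => exists f, [/\ I f, f != 0 & mlead f = m]).
have [gs [gsI hgs]] : exists gs : seq {mpoly k[n]}, (forall g, g \in gs -> I g /\ g != 0) /\
    forall m, m \in ms -> exists2 g, g \in gs & mlead g = m.
  elim: ms msA {hms} => [|m ms IH] msA; first by exists [::].
  have [f [If f0 fm]] := msA m (mem_head _ _).
  have [|gs [gsI hgs]] := IH; first by move=> m' m's; apply: msA; rewrite inE m's orbT.
  exists (f :: gs); split=> [g|m'].
    by rewrite inE => /orP[/eqP->|/gsI].
  rewrite inE => /orP[/eqP->|/hgs[g ggs gm]]; first by exists f; rewrite ?mem_head.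
  by exists g => //; rewrite inE ggs orbT.
have zero_gs x : (forall g, g \in gs -> g.@[x] = 0) -> forall f, I f -> f.@[x] = 0.
  move=> hx f; elim/mleadrect: f => f IH If.
  have [->|f0] := eqVneq f 0; first by rewrite meval0.
  have [m /hgs[g ggs <-] le_gf] := hms _ (ex_intro _ f (And3 If f0 erefl)).
  have [Ig g0] := gsI g ggs.
  (* [c * g] has the leading term of [f]; subtracting it stays in [I], lowers the leading monomial
     and keeps the value at [x]. *)
  pose c := ((f@_(mlead f) / g@_(mlead g)) *: 'X_[mlead f - mlead g] : {mpoly k[n]}).
  have c0 : f@_(mlead f) / g@_(mlead g) != 0.
    by rewrite mulf_neq0 ?invr_eq0 // mleadc_eq0.
  have lead_c : mlead c = (mlead f - mlead g)%MM.
    by rewrite mleadZ_proper ?mleadXm // mcoeffX eqxx mulr1.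
  have cn0 : c != 0 by rewrite -mleadc_eq0 lead_c mcoeffZ mcoeffX eqxx mulr1.
  have lead_cg : mlead (c * g) = mlead f by rewrite mleadM // lead_c submK.
  have coef_cg : (c * g)@_(mlead f) = f@_(mlead f).
    rewrite -{1}lead_cg mleadM // mleadcM lead_c mcoeffZ mcoeffX eqxx mulr1 divfK //.
    by rewrite mleadc_eq0.
  have := I_sub f g c If Ig; set q := f - c * g => Iq.
  have -> : f.@[x] = q.@[x] by rewrite /q mevalB mevalM (hx g) // mulr0 subr0.
  have [->|q0] := eqVneq q 0; first by rewrite meval0.
  apply: IH => //; rewrite lt_neqAle; apply/andP; split.
    apply: contraNneq q0 => e; rewrite -mleadc_eq0 e /q mcoeffB coef_cg subrr //.
  by apply: le_trans (mleadB_le _ _) _; rewrite lead_cg joinxx.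
have [s [sS hs]] : exists s : seq {mpoly k[n]}, (forall p, p \in s -> S p) /\
    forall x, (forall p, p \in s -> p.@[x] = 0) -> forall g, g \in gs -> g.@[x] = 0.
  elim: gs gsI {hgs zero_gs} => [|g gs IH] gsI; first by exists [::].
  have [|s [sS hs]] := IH; first by move=> g' g's; apply: gsI; rewrite inE g's orbT.
  have [[t [tS ht]] _] := gsI g (mem_head _ _).
  exists (t ++ s); split=> [p|x hx]; first by rewrite mem_cat => /orP[/tS|/sS].
  move=> g'; rewrite inE => /orP[/eqP->|]; [apply: ht|apply: hs] => p ps.
    by apply: hx; rewrite mem_cat ps.
  by apply: hx; rewrite mem_cat ps orbT.
exists s; split=> // x hx p Sp; apply: zero_gs; first exact: hs.
exists [:: p]; split=> [q|y]; first by rewrite inE => /eqP->.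
by apply; rewrite mem_head.
Qed.
End Noetherian.

(** * Characters, eigenvectors and lattices *)

Section Artin.
Variables (k : fieldType) (G : Type) (mul : G -> G -> G) (one : G).

Lemma artin_uniq (fs : seq (G -> k)) (a : (G -> k) -> k) : uniq fs ->
  (forall f, f \in fs -> f one = 1 /\ forall g h, f (mul g h) = f g * f h) ->
  (forall g, \sum_(f <- fs) a f * f g = 0) -> forall f, f \in fs -> a f = 0.
Proof.
elim: fs a => [//|f fs IH] a /= /andP[ffs ufs] mulfs sum0.
have [f1 fM] := mulfs f (mem_head _ _).
have mulfs' f' : f' \in fs -> f' one = 1 /\ forall g h, f' (mul g h) = f' g * f' h.
  by move=> f'fs; apply: mulfs; rewrite inE f'fs orbT.
have a0 f' : f' \in fs -> a f' = 0.
  move=> f'fs; have [h /eqP ffh] : exists h, f' h <> f h.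
    apply: contrapT => none; move: ffs; rewrite (_ : f = f') ?f'fs //.
    by apply/funext => h; apply: contrapT => ffh; apply: none; exists h => /esym.
  (* Subtracting [f h] times the relation from its translate by [h] eliminates [f] and multiplies
     the coefficient of [f'] by [f' h - f h], nonzero for the chosen [h]. *)
  have := IH (fun f' => a f' * (f' h - f h)) ufs mulfs' _ f' f'fs.
  move=> /(_ _)/eqP; rewrite mulf_eq0 subr_eq0 (negPf ffh) orbF => H.
  apply/eqP/H => g.
  have := sum0 (mul h g); have := sum0 g; rewrite !big_cons => s1 s2.
  transitivity (\sum_(j <- fs) a j * j (mul h g) - f h * \sum_(j <- fs) a j * j g).
    rewrite big_distrr /= -sumrB big_seq [RHS]big_seq; apply: eq_bigr => j /mulfs'[_ ->].
    by ring.
  move/eqP: s1; rewrite addrC addr_eq0 => /eqP ->.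
  move/eqP: s2; rewrite addrC addr_eq0 => /eqP ->.
  by rewrite fM; ring.
move=> f'; rewrite inE => /orP[/eqP->|]; last exact: a0.
have := sum0 one; rewrite big_cons f1 mulr1 big_seq big1 ?addr0 // => j /a0 ->.
by rewrite mul0r.
Qed.

(* Linear independence of characters; the [chi i] may repeat, which is why the
   conclusion is tested against functions [W] of the character. *)
Lemma artin (I : eqType) (r : seq I) (c : I -> k) (chi : I -> G -> k) (W : (G -> k) -> k) :
  (forall i, chi i one = 1 /\ forall g h, chi i (mul g h) = chi i g * chi i h) ->
  (forall g, \sum_(i <- r) c i * chi i g = 0) ->
  \sum_(i <- r) c i * W (chi i) = 0.
Proof.
move=> mulchi sum0.
pose fs := undup [seq chi i | i <- r]; pose a f := \sum_(i <- r | `[< chi i = f >]) c i.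
have group (V : (G -> k) -> k) : \sum_(i <- r) c i * V (chi i) = \sum_(f <- fs) a f * V f.
  rewrite /a; under [RHS]eq_bigr do rewrite big_distrl /=.
  rewrite (exchange_big_dep xpredT) //= big_seq [RHS]big_seq; apply: eq_bigr => i ir.
  rewrite (big_rem (chi i)) /=; last by rewrite mem_undup map_f.
  rewrite asboolT // big_seq_cond big_pred0 ?addr0 // => f'; apply/negP => /andP[].
  rewrite mem_rem_uniq ?undup_uniq // inE => /andP[/eqP ne _] /asboolP.
  by move/esym.
rewrite group big_seq big1 // => f ffs; rewrite (artin_uniq (undup_uniq _) _ _ ffs) ?mul0r //.
  by move=> f'; rewrite mem_undup => /mapP[i _ ->].
by move=> g; rewrite -(group (fun f => f g)).
Qed.

End Artin.

Section Subspaces.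
Variable k : fieldType.

(** A matrix of maximal rank among those whose row space lies in [P] already contains every vector
    of [P]. This turns predicates into matrices. *)
Lemma subspace_mx r (P : 'rV[k]_r -> Prop) : P 0 ->
  (forall (a : k) u v, P u -> P v -> P (a *: u + v)) ->
  exists U : 'M[k]_r, forall u, (u <= U)%MS <-> P u.
Proof.
move=> P0 PL.
have ex : exists d, `[< exists2 U : 'M[k]_r, \rank U = d & forall u : 'rV_r, (u <= U)%MS -> P u >].
  exists 0%N; apply/asboolP; exists 0; first by rewrite mxrank0.
  by move=> u; rewrite submx0 => /eqP->.
have bd d : `[< exists2 U : 'M[k]_r, \rank U = d & forall u : 'rV_r, (u <= U)%MS -> P u >] -> (d <= r)%N.
  by move=> /asboolP[U <- _]; exact: rank_leq_row.
case: (ex_maxnP ex bd) => d /asboolP[U rU PU] hmax; exists U => u; split; first exact: PU.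
move=> Pu; apply: contraT => uU.
have : (\rank (U + u)%MS <= d)%N.
  apply: hmax; apply/asboolP; exists (U + u)%MS => // v /sub_addsmxP[[u1 u2] /= ->].
  rewrite addrC [u2]mx11_scalar mul_scalar_mx; apply: PL => //; apply: PU; exact: submxMl.
rewrite -rU leqNgt => /negP; case; apply: rank_ltmx.
by rewrite ltmxE addsmxSl /= addsmx_sub submx_refl.
Qed.

End Subspaces.

Section CommonEigenvector.
Variable k : closedFieldType.

(* Commuting operators have a common eigenvector in a nonzero quotient U'/U
   of stable subspaces: they are all scalar on a minimal such quotient. *)
Lemma common_eigenvector_mod r (Fs : 'M[k]_r -> Prop) (U U' : 'M[k]_r) :
  (forall F G, Fs F -> Fs G -> F *m G = G *m F) ->
  (forall F, Fs F -> (U *m F <= U)%MS) -> (forall F, Fs F -> (U' *m F <= U')%MS) ->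
  (U <= U')%MS -> ~~ (U' <= U)%MS ->
  exists u : 'rV_r, [/\ (u <= U')%MS, ~~ (u <= U)%MS &
    forall F, Fs F -> exists l, (u *m F - l *: u <= U)%MS].
Proof.
case: r Fs U U' => [|r] Fs U U' comF stU stU' UU' nU'U.
  by move: nU'U; rewrite [U']flatmx0 sub0mx.
pose good (W : 'M_r.+1) := [/\ (U <= W)%MS, (W <= U')%MS, ~~ (W <= U)%MS & forall F, Fs F -> (W *m F <= W)%MS].
have ex : exists d, `[< exists2 W : 'M_r.+1, \rank W = d & good W >].
  by exists (\rank U'); apply/asboolP; exists U'.
case: (ex_minnP ex) => d /asboolP[W rW [UW WU' nWU stW]] hmin.
have [i uU] : exists i, ~~ (row i W <= U)%MS by apply/existsP; rewrite -negb_forall; apply: contra nWU => /forallP h; apply/row_subP.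
have stWx F (u : 'rV_r.+1) : Fs F -> (u <= W)%MS -> (u *m F <= W)%MS.
  by move=> FF uW; apply: submx_trans (stW F FF); exact: submxMr.
have stUx F (u : 'rV_r.+1) : Fs F -> (u <= U)%MS -> (u *m F <= U)%MS.
  by move=> FF uW; apply: submx_trans (stU F FF); exact: submxMr.
suff scal F : Fs F -> exists l, forall u : 'rV_r.+1, (u <= W)%MS -> (u *m F - l *: u <= U)%MS.
  exists (row i W); split=> // [|F /scal[l hl]]; first by apply: submx_trans WU'; exact: row_sub.
  by exists l; apply: hl; exact: row_sub.
move=> FF; set u := row i W in uU; have uW : (u <= W)%MS by exact: row_sub.
(* [q] is a minimal polynomial of [u] modulo [U]; splitting off a root [l] leaves an eigenvector
   [u'] for [l] modulo [U]. *)
have exq : exists s, `[< exists2 q : {poly k}, q != 0 & size q = s /\ (u *m horner_mx F q <= U)%MS >].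
  exists (size (char_poly F)); apply/asboolP; exists (char_poly F).
    by rewrite monic_neq0 // char_poly_monic.
  by split=> //; rewrite Cayley_Hamilton mulmx0 sub0mx.
case: (ex_minnP exq) => s /asboolP[q q0 [sq uq]] qmin.
have [l] : exists l, root q l.
  apply/closed_rootP; apply: contra uU => /size_poly1P[c c0 eq].
  by move: uq; rewrite eq horner_mx_C mul_mx_scalar (eqmx_scale _ c0).
case/factor_theorem=> q' eq; exists l.
have q'0 : q' != 0 by apply: contraNneq q0 => q'0; rewrite eq q'0 mul0r.
pose u' := u *m horner_mx F q'.
have u'U : ~~ (u' <= U)%MS.
  apply/negP => u'U; have : (s <= size q')%N.
    by apply: qmin; apply/asboolP; exists q'.
  by rewrite -sq eq size_Mmonic ?monicXsubC // size_XsubC addn2 /= ltnn.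
have u'W : (u' <= W)%MS.
  rewrite /u'; elim/poly_ind: (q') => [|p c IH]; first by rewrite rmorph0 mulmx0 sub0mx.
  rewrite rmorphD rmorphM /= horner_mx_X horner_mx_C mulmxDr mul_mx_scalar.
  by rewrite addmx_sub ?scalemx_sub // mulmxA stWx.
have u'l : (u' *m F - l *: u' <= U)%MS.
  move: uq; rewrite eq rmorphM /= rmorphB /= horner_mx_X horner_mx_C.
  by rewrite -mulmxE mulmxA -/u' mulmxBr mul_mx_scalar.
(* The eigenvectors for [l] modulo [U] inside [W] form a stable subspace because the family
   commutes; minimality of [W] makes it all of [W]. *)
have [K hK] : exists K : 'M_r.+1, forall v : 'rV_r.+1, (v <= K)%MS <-> (v <= W)%MS /\ (v *m F - l *: v <= U)%MS.
  apply: (@subspace_mx _ _ (fun v => (v <= W)%MS /\ (v *m F - l *: v <= U)%MS)) => [|a v w [vW vU] [wW wU]].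
    by rewrite mul0mx scaler0 subrr !sub0mx.
  split; first by rewrite addmx_sub ?scalemx_sub.
  rewrite mulmxDl -scalemxAl scalerDr scalerA mulrC -scalerA opprD addrACA -scalerBr.
  by rewrite addmx_sub ?scalemx_sub.
suff WK : (W <= K)%MS by move=> v vW; have /hK[] := submx_trans vW WK.
have KW : (K <= W)%MS by apply/row_subP => j; have /hK[] := row_sub j K.
rewrite -(mxrank_leqif_sup KW) eqn_leq mxrankS //= rW; apply: hmin; apply/asboolP; exists K => //; split.
- apply/row_subP => j; apply/hK; split; first by apply: submx_trans UW; exact: row_sub.
  by rewrite addmx_sub ?eqmx_opp ?scalemx_sub ?stUx ?row_sub.
- exact: submx_trans KW WU'.
- by apply: contra u'U; apply: submx_trans; apply/hK.
- move=> G FG; apply/row_subP => j; rewrite row_mul; have /hK[jW jU] := row_sub j K.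
  apply/hK; split; first exact: stWx.
  by rewrite -mulmxA (comF G F) // mulmxA scalemxAl -mulmxBl stUx.
Qed.

End CommonEigenvector.

Section FunctionBasis.
Variables (k : fieldType) (X : Type).

(** Independence is certified by points at which the matrix of values is invertible, and [K] bounds
    the length of such families. In a maximal one, bordering the matrix by [f] and a further point
    [y] multiplies the determinant by [f y - \sum_j c j * w j y], which must therefore vanish. *)
Lemma function_basis K (phi : 'I_K -> X -> k) (Fs : (X -> k) -> Prop) :
  (forall f, Fs f -> exists c : 'I_K -> k, forall x, f x = \sum_j c j * phi j x) ->
  exists r (w : 'I_r -> X -> k) (x : 'I_r -> X),
    [/\ forall j, Fs (w j), \matrix_(i, j) w j (x i) \in unitmx &
      forall f, Fs f -> exists c : 'I_r -> k, forall y, f y = \sum_j c j * w j y].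
Proof.
move=> span.
pose good r := exists (w : 'I_r -> X -> k) (x : 'I_r -> X),
  (forall j, Fs (w j)) /\ \matrix_(i, j) w j (x i) \in unitmx.
have ex : exists r, `[< good r >].
  exists 0%N; apply/asboolP; have h (i : 'I_0) : False by case: i.
  exists (fun i => False_rect _ (h i)), (fun i => False_rect _ (h i)); split=> [[]//|].
  by rewrite unitmxE det_mx00 unitr1.
have bd r : `[< good r >] -> (r <= K)%N.
  move=> /asboolP[w [x [Fw uw]]].
  have /choice[c hc] j := span (w j) (Fw j).
  have e : \matrix_(i, j) w j (x i) = (\matrix_(i, l) phi l (x i)) *m (\matrix_(l, j) c j l).
    apply/matrixP => i j; rewrite !mxE hc; apply: eq_bigr => l _.
    by rewrite !mxE mulrC.
  move/mxrank_unit: uw => <-; rewrite e.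
  by rewrite (leq_trans (mxrankM_maxl _ _)) // rank_leq_col.
case: (ex_maxnP ex bd) => r /asboolP[w [x [Fw uw]]] hmax.
exists r, w, x; split=> // f Ff.
set A := \matrix_(i, j) w j (x i) in uw.
pose c := invmx A *m \col_i f (x i); exists (fun j => c j 0) => y.
apply/eqP; rewrite eq_sym -subr_eq0; apply: contraT => ne.
suff : (r + 1 <= r)%N by rewrite addn1 ltnn.
apply: hmax; apply/asboolP.
exists (fun j : 'I_(r + 1) => match fintype.split j with inl j => w j | inr _ => f end),
  (fun i : 'I_(r + 1) => match fintype.split i with inl i => x i | inr _ => y end).
split=> [j|]; first by case: (fintype.split j).
set A' := \matrix_(i, j) _.
have A'E : A' = block_mx A (\col_i f (x i)) (\row_j w j y) (f y)%:M.
  apply/matrixP => i j; rewrite !mxE; case: (fintype.split i) => i'; rewrite !mxE; case: (fintype.split j) => j'; rewrite !mxE //.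
  by rewrite !ord1 eqxx mulr1n.
suff : A' *m block_mx 1%:M (- c) 0 1%:M \in unitmx by rewrite unitmx_mul => /andP[].
rewrite A'E mulmx_block !mulmx1 !mulmx0 !addr0 !mulmxN mulKVmx // addNr.
rewrite unitmxE det_lblock unitrM -unitmxE uw /= det_mx11 !mxE eqxx mulr1n unitfE.
rewrite -(opprK (f y)) -opprD oppr_eq0.
move: ne; congr (_ != 0); congr (_ - _); apply: eq_bigr => j _.
by rewrite !mxE mulrC.
Qed.

End FunctionBasis.

Section Codiagonalize.
Variable k : closedFieldType.

Lemma uniq_roots_of_unity m : m%:R != 0 :> k ->
  exists2 rs : seq k, uniq rs & 'X^m - 1 = \prod_(z <- rs) ('X - z%:P).
Proof.
move=> m0; have m_gt0 : (0 < m)%N by case: m m0 => //; rewrite eqxx.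
have [rs e] := closed_field_poly_normal ('X^m - 1 : {poly k}).
have lead1 : lead_coef ('X^m - 1 : {poly k}) = 1.
  by apply/eqP; rewrite -monicE -polyC1 monicXnsubC.
exists rs; last by rewrite e lead1 scale1r.
by rewrite -separable_prod_XsubC -[X in separable_poly X]scale1r -lead1 -e separable_Xn_sub_1.
Qed.

Lemma diagonalizable_finite_order r (A : 'M[k]_r.+1) m :
  m%:R != 0 :> k -> A ^+ m = 1 -> diagonalizable A.
Proof.
move=> m0 Am; apply/diagonalizableP; have [rs urs e] := uniq_roots_of_unity m0.
exists rs => //; rewrite -e; apply: mxminpoly_min.
by rewrite rmorphB rmorphXn /= horner_mx_X Am rmorph1 subrr.
Qed.

(** The family may be infinite, but a finite subfamily spans it linearly. Each member is
    diagonalizable because its minimal polynomial divides the separable ['X^m - 1]. *)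
Lemma codiagonalizable_family r (Fs : 'M[k]_r -> Prop) :
  (forall A B, Fs A -> Fs B -> A *m B = B *m A) ->
  (forall A, Fs A -> exists2 m, m%:R != 0 :> k & iter m (mulmx A) 1%:M = 1%:M) ->
  exists2 P, P \in unitmx & forall A, Fs A -> exists d : 'rV_r, P *m A = diag_mx d *m P.
Proof.
case: r Fs => [|r] Fs comF ordF.
  by exists 1%:M; rewrite ?unitmx1 // => A _; exists 0; rewrite [RHS]flatmx0 [LHS]flatmx0.
pose fn (A : 'M[k]_r.+1) (ij : 'I_r.+1 * 'I_r.+1) := A ij.1 ij.2.
have [f [B [FB sp]]] : exists s (B : 'I_s -> 'M[k]_r.+1), (forall j, Fs (B j)) /\
    forall A : 'M_r.+1, Fs A -> exists c : 'I_s -> k, forall i j, A i j = \sum_l c l * B l i j.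
  have [|s [w [_ [Fw _ sp]]]] := @function_basis k _ _ (fun l : 'I_(#|{: 'I_r.+1 * 'I_r.+1}|) => fun ij => (ij == enum_val l)%:R)
    (fun f => exists2 A, Fs A & f = fn A).
    move=> _ [A _ ->]; exists (fun l => fn A (enum_val l)) => ij.
    rewrite (bigD1 (enum_rank ij)) //= enum_rankK eqxx mulr1 big1 ?addr0 // => l ne.
    rewrite (_ : (ij == enum_val l) = false) ?mulr0 //; apply: contraNF ne => /eqP ->.
    by rewrite enum_valK.
  have /choice[B hB] j : exists B, Fs B /\ w j = fn B by have [B] := Fw j; exists B.
  exists s, B; split=> [j|A FA]; first by have [] := hB j.
  have [|c hc] := sp (fn A); first by exists A.
  exists c => i j; have := hc (i, j); rewrite /fn /= => ->.
  by apply: eq_bigr => l _; have [_ ->] := hB l.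
have [P Pu /allP hP] : codiagonalizable [seq B j | j <- enum 'I_f].
  apply/codiagonalizableP; split=> [_ _ /mapP[i _ ->] /mapP[j _ ->]|_ /mapP[i _ ->]].
    exact: comF.
  have [m m0 om] := ordF _ (FB i); apply: (diagonalizable_finite_order m0).
  rewrite -idmxE -om; elim: (m) => //= m' IH; by rewrite exprS IH mulmxE.
exists P => // C /sp[c hc].
have /choice[d hd] j : exists d : 'rV_r.+1, P *m B j = diag_mx d *m P.
  have /diagonalizable_forPex[d /(simmxP Pu) hd] := hP (B j) (map_f _ (mem_enum _ j)).
  by exists d.
exists (\row_l \sum_j c j * d j 0 l).
have -> : C = \sum_j c j *: B j.
  by apply/matrixP => i l; rewrite hc summxE; apply: eq_bigr => j _; rewrite mxE.
have -> : diag_mx (\row_l \sum_j c j * d j 0 l) = \sum_j c j *: diag_mx (d j).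
  apply/matrixP => i l; rewrite summxE !mxE -sumrMnl; apply: eq_bigr => j _.
  by rewrite !mxE mulrnAr.
rewrite mulmx_sumr mulmx_suml; apply: eq_bigr => j _.
by rewrite -scalemxAr hd -scalemxAl.
Qed.

End Codiagonalize.

Section Lattice.

(** Saturation makes [L] the set of integer points of its rational span, so [a0] lies outside that
    span; some column of the cokernel matrix does not kill [a0], and clearing its denominators gives
    [h]. *)
Lemma saturated_orthogonal r (L : ('I_r -> int) -> Prop) (a0 : 'I_r -> int) :
  L (fun=> 0) -> (forall (c : int) a b, L a -> L b -> L (fun j => c * a j + b j)) ->
  (forall (c : int) a, c != 0 -> L (fun j => c * a j) -> L a) -> ~ L a0 ->
  exists h : 'I_r -> int, (exists j, h j != 0) /\ forall a, L a -> \sum_j h j * a j = 0.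
Proof.
move=> L0 Llin Lsat La0.
pose P (v : 'rV[rat]_r) := exists c : int, c != 0 /\ exists2 a, L a & forall j, c%:~R * v 0 j = (a j)%:~R.
have [||U hU] := @subspace_mx rat r P.
- by exists 1; split=> //; exists (fun=> 0) => // j; rewrite mxE mulr0.
- move=> q u v [c [c0 [a La ha]]] [d [d0 [b Lb hb]]].
  exists (denq q * (c * d)); split; first by rewrite !mulf_neq0 ?denq_neq0.
  exists (fun j => (numq q * d) * a j + (denq q * c) * b j).
    have -> : (fun j => numq q * d * a j + denq q * c * b j) =
        (fun j => numq q * d * a j + (denq q * c * b j + 0)) by apply/funext => j; rewrite addr0.
    by apply: (Llin) => //; apply: (Llin).
  move=> j; rewrite !mxE !rmorphD !rmorphM /= -ha -hb.
  by rewrite numqE; ring.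
pose v0 : 'rV[rat]_r := \row_j (a0 j)%:~R.
have v0U : ~~ (v0 <= U)%MS.
  apply/negP => /hU[c [c0 [a La ha]]]; apply: La0; apply: (Lsat c) => //.
  rewrite (_ : (fun j => _) = a) //; apply/funext => j.
  by apply: (@intr_inj rat); rewrite rmorphM /= -ha mxE.
have [j hj] : exists j, (v0 *m cokermx U) 0 j != 0 by apply/rV0Pn; rewrite -submxE.
pose b l := cokermx U l j.
pose D := \prod_l denq (b l).
have /choice[h hh] l : exists h : int, h%:~R = D%:~R * b l :> rat.
  exists ((\prod_(l' | l' != l) denq (b l')) * numq (b l)).
  by rewrite /D [X in _ = X%:~R * _](bigD1 l) //= !rmorphM /= numqE; ring.
have D0 : D%:~R != 0 :> rat by rewrite intr_eq0; apply/prodf_neq0 => l _; rewrite denq_neq0.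
exists h; split.
  apply: contrapT => none; move/negP: hj; apply; rewrite [X in X == _]mxE big1 // => l _.
  have hl : h l = 0 by apply/eqP; apply: contrapT => /negP hl; apply: none; exists l.
  have /eqP : D%:~R * b l = 0 by rewrite -hh hl.
  by rewrite mulf_eq0 (negPf D0) /= => /eqP; rewrite /b => ->; rewrite mulr0.
move=> a La; apply: (@intr_inj rat); rewrite rmorph_sum /=.
have /hU : P (\row_l (a l)%:~R).
  by exists 1; split=> //; exists a => // l; rewrite mxE mul1r.
rewrite submxE => /eqP/matrixP/(_ 0 j); rewrite [X in X = _]mxE [X in _ = X]mxE => e.
rewrite -[RHS](mulr0 D%:~R) -[X in _ = _ * X]e mulr_sumr; apply: eq_bigr => l _.
by rewrite rmorphM /= hh [X in _ = _ * (X * _)]mxE /b; ring.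
Qed.

End Lattice.

(** * Regular functions and automorphisms *)

Section PolynomialFunctions.
Variables (k : fieldType) (E : Type) (nv : nat) (x : 'I_nv -> E -> k).

Implicit Types f g : E -> k.

(** [E] and [x] stay abstract: the notion serves both for regular functions on [X], in several
    systems of coordinates, and for functions of coefficient vectors. *)
Definition polyfun (f : E -> k) := exists p : {mpoly k[nv]}, forall e, f e = p.@[x^~ e].

Lemma polyfun_eq f g : f =1 g -> polyfun f -> polyfun g.
Proof. by move=> fg [p hp]; exists p => e; rewrite -fg hp. Qed.

Lemma polyfun_cst c : polyfun (fun=> c).
Proof. by exists c%:MP => e; rewrite mevalC. Qed.

Lemma polyfun_var j : polyfun (x j).
Proof. by exists 'X_j => e; rewrite mevalXU. Qed.

Lemma polyfunD f g : polyfun f -> polyfun g -> polyfun (fun e => f e + g e).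
Proof. by case=> p hp [q hq]; exists (p + q) => e; rewrite mevalD hp hq. Qed.

Lemma polyfunM f g : polyfun f -> polyfun g -> polyfun (fun e => f e * g e).
Proof. by case=> p hp [q hq]; exists (p * q) => e; rewrite mevalM hp hq. Qed.

Lemma polyfunZ c f : polyfun f -> polyfun (fun e => c * f e).
Proof. by apply: polyfunM; exact: polyfun_cst. Qed.

Lemma polyfunB f g : polyfun f -> polyfun g -> polyfun (fun e => f e - g e).
Proof. by case=> p hp [q hq]; exists (p - q) => e; rewrite mevalB hp hq. Qed.

Lemma polyfunX f m : polyfun f -> polyfun (fun e => f e ^+ m).
Proof. by case=> p hp; exists (p ^+ m) => e; rewrite rmorphXn /= hp. Qed.

Lemma polyfun_sum (I : Type) (r : seq I) (P : pred I) (f : I -> E -> k) :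
  (forall i, polyfun (f i)) -> polyfun (fun e => \sum_(i <- r | P i) f i e).
Proof.
move=> /choice[p hp]; exists (\sum_(i <- r | P i) p i) => e.
by rewrite raddf_sum; apply: eq_bigr => i _; rewrite hp.
Qed.

Lemma polyfun_prod (I : Type) (r : seq I) (P : pred I) (f : I -> E -> k) :
  (forall i, polyfun (f i)) -> polyfun (fun e => \prod_(i <- r | P i) f i e).
Proof.
move=> /choice[p hp]; exists (\prod_(i <- r | P i) p i) => e.
by rewrite rmorph_prod; apply: eq_bigr => i _; rewrite hp.
Qed.

Lemma polyfun_meval m (p : {mpoly k[m]}) (f : 'I_m -> E -> k) :
  (forall i, polyfun (f i)) -> polyfun (fun e => p.@[f^~ e]).
Proof.
move=> hf; apply: (@polyfun_eq (fun e => \sum_(m <- msupp p) p@_m * \prod_i f i e ^+ m i)).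
  by move=> e; rewrite mevalE.
by apply: polyfun_sum => i; apply: polyfunZ; apply: polyfun_prod => j; apply: polyfunX.
Qed.

End PolynomialFunctions.

Section RegularFunctions.
Variables (k : closedFieldType) (X : affine_variety k).
Local Notation N := (ambient_dim X).

Definition crd (j : 'I_N) (x : X) : k := (val x : affine_space k N) j.
Local Notation regfun := (polyfun crd).

Lemma regfun_comp (g : Aut X) f : regfun f -> regfun (f \o g).
Proof.
case=> p hp; have [q hq] := iso_fun_regular g.
apply: (@polyfun_eq _ _ _ _ (fun x => p.@[fun j => crd j (g x)])) => [x|]; first by rewrite /= hp.
by apply: polyfun_meval => j; exists (q j) => x; exact: hq.
Qed.

Lemma crd_inj x y : crd^~ x =1 crd^~ y -> x = y.
Proof. by move=> h; apply/val_inj/ffunP. Qed.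

(** Generators of the coordinate ring, in other words another closed embedding of [X]. *)
Definition coordinates r (w : 'I_r -> X -> k) :=
  (forall j, regfun (w j)) /\
  forall f, regfun f -> exists p : {mpoly k[r]}, forall x, f x = p.@[w^~ x].

Lemma coordinates_crd : coordinates crd.
Proof. by split=> [j|//]; exact: polyfun_var. Qed.

Lemma coordinates_inj r (w : 'I_r -> X -> k) x y :
  coordinates w -> w^~ x =1 w^~ y -> x = y.
Proof.
move=> [_ wg] wxy; apply: crd_inj => j; have [p hp] := wg _ (polyfun_var crd j).
by rewrite !hp; exact: meval_eq.
Qed.

Lemma points_zero_locus : exists S : {mpoly k[N]} -> Prop,
  forall y : affine_space k N, @points k X y <-> forall p, S p -> p.@[y] = 0.
Proof.
have : closed (@points k X) by exact: points_closed.
rewrite -openC.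
move=> [S hS]; exists S => y; split=> [Xy|Sy].
  by apply: contrapT => Sy; have : (~` zero_locus S)%classic y by []; rewrite -hS.
by apply: contrapT => Xy; have : (~` @points k X)%classic y by []; rewrite hS; apply.
Qed.

(** The original coordinates are polynomials [q] in [w]; the point with coordinates [q] of [y]
    satisfies the equations of [X], and the relations expressing [w] back through [q] also hold at
    [y]. *)
Lemma coordinates_closed r (w : 'I_r -> X -> k) (y : 'I_r -> k) : coordinates w ->
  (forall p : {mpoly k[r]}, (forall x, p.@[w^~ x] = 0) -> p.@[y] = 0) ->
  exists x, forall j, w j x = y j.
Proof.
move=> [wr wg] hy; have /choice[q hq] j := wg _ (polyfun_var crd j).
pose y0 : affine_space k N := [ffun j => (q j).@[y]].
have hcomp (p : {mpoly k[N]}) z : (p \mPo [tuple q j | j < _]).@[z] = p.@[fun j => (q j).@[z]].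
  by rewrite comp_mpoly_meval; apply: meval_eq => j; rewrite tnth_mktuple.
have [S hS] := points_zero_locus.
have Xy0 : y0 \in @points k X.
  apply/mem_set/hS => p Sp; rewrite (meval_eq _ (v2 := fun j => (q j).@[y])); last by move=> j; rewrite ffunE.
  rewrite -hcomp; apply: hy => x; rewrite hcomp.
  rewrite (meval_eq _ (v2 := crd^~ x)) => [|j]; last by rewrite hq.
  by have /set_mem/hS := valP x; apply.
exists (exist _ y0 Xy0) => j.
have [p hp] := wr j; rewrite hp.
have : ('X_j - (p \mPo [tuple q j | j < _]) : {mpoly k[r]}).@[y] = 0.
  apply: hy => x; rewrite mevalB mevalXU hcomp hp; apply/eqP; rewrite subr_eq0; apply/eqP.
  by apply: meval_eq => l; rewrite hq.
rewrite mevalB mevalXU hcomp => /eqP; rewrite subr_eq0 => /eqP ->.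
by apply: meval_eq => l; rewrite /crd /= ffunE.
Qed.

Lemma regfun_endo_regular r (w : 'I_r -> X -> k) (g : X -> X) : coordinates w ->
  (forall j, regfun (w j \o g)) -> regular g.
Proof.
move=> [wr wg] hg.
have /choice[p hp] j : exists p : {mpoly k[N]}, forall x, crd j (g x) = p.@[crd^~ x].
  have [q hq] := wg _ (polyfun_var crd j).
  have [p hp] := polyfun_meval q hg; exists p => x; rewrite hq -hp.
  exact: meval_eq.
by exists p => x j; rewrite -hp.
Qed.

Lemma Aut_of r (w : 'I_r -> X -> k) (g h : X -> X) : coordinates w ->
  (forall j, regfun (w j \o g)) -> (forall j, regfun (w j \o h)) ->
  cancel g h -> cancel h g -> exists a : Aut X, forall x, a x = g x.
Proof.
move=> cw hg hh gK hK.
by exists (VarietyIso (regfun_endo_regular cw hg) (regfun_endo_regular cw hh) gK hK).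
Qed.

Lemma Aut_mulE (g h : Aut X) x : (g * h)%g x = g (h x).
Proof. by []. Qed.

Lemma Aut_invK (g : Aut X) x : g (g^-1%g x) = x.
Proof. by rewrite /= iso_invK. Qed.

End RegularFunctions.

Arguments crd {k X} j x.
Notation regfun := (polyfun (@crd _ _)).

(** * Translations and dilations as abstract groups *)

Section Frame.
Variables (k : closedFieldType).

(* The abstract group-theoretic data carried over from Aut A^n: [tr i] are the
   translations along the i-th axis, [dil i] the dilations of the i-th
   coordinate ([dil i 0] is unspecified). *)
Record frame (X : affine_variety k) (n : nat) := Frame {
  tr : 'I_n -> k -> Aut X;
  dil : 'I_n -> k -> Aut X;
  trD : forall i a b, tr i (a + b) = (tr i a * tr i b)%g;
  tr_inj : forall i, injective (tr i);
  trC : forall i j a b, commute (tr i a) (tr j b);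
  dilM : forall i l m, l != 0 -> m != 0 -> dil i (l * m) = (dil i l * dil i m)%g;
  dilC : forall i j l m, l != 0 -> m != 0 -> commute (dil i l) (dil j m);
  dil_tr : forall i l a, l != 0 -> (dil i l * tr i a)%g = (tr i (l * a) * dil i l)%g;
  dil_trC : forall i j l a, i != j -> l != 0 -> commute (dil i l) (tr j a);
  cent_tr : forall g, (forall i a, commute g (tr i a)) ->
    exists b : 'I_n -> k, g = \big[*%g/1%g]_(i < n) tr i (b i);
  cent_tr1 : forall i g, (forall j a, commute g (tr j a)) ->
    (forall j l, j != i -> l != 0 -> commute g (dil j l)) -> exists a, g = tr i a;
  cent_dil1 : forall i g, (forall j a, j != i -> commute g (tr j a)) ->
    (forall j l, l != 0 -> commute g (dil j l)) -> exists2 l, l != 0 & g = dil i l }.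

(** All fields of [frame] are about products, equality and commutation in the group, so they pull
    back along an isomorphism of groups. *)
Lemma frame_transport (X Y : affine_variety k) n (phi : {multiplicative Aut X -> Aut Y}) :
  bijective phi -> frame Y n -> frame X n.
Proof.
move=> bij F; have /cid[psi [phiK psiK]] : exists psi, cancel phi psi /\ cancel psi phi.
  by case: bij => psi; exists psi.
have psiM : forall g h, psi (g * h)%g = (psi g * psi h)%g.
  by move=> g h; apply: (can_inj phiK); rewrite gmulfM !psiK.
have psi1 : psi 1%g = 1%g by apply: (mulgI (psi 1%g)); rewrite -psiM !mulg1.
have com g h : commute g (psi h) <-> commute (phi g) h.
  rewrite /commute; split=> [e|e]; first by rewrite -[h]psiK -!gmulfM e.
  by apply: (can_inj phiK); rewrite !gmulfM psiK.
have com' g h : commute (psi g) (psi h) <-> commute g h by rewrite com psiK.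
apply: (@Frame X n (fun i a => psi (tr F i a)) (fun i l => psi (dil F i l))).
- by move=> i a b; rewrite trD psiM.
- by move=> i a b /(can_inj psiK)/tr_inj.
- by move=> i j a b; apply/com'; exact: trC.
- by move=> i l m l0 m0; rewrite dilM.
- by move=> i j l m l0 m0; apply/com'; exact: dilC.
- by move=> i l a l0; rewrite -!psiM dil_tr.
- by move=> i j l a ij l0; apply/com'; exact: dil_trC.
- move=> g hg; have [|b hb] := @cent_tr _ _ F (phi g).
    by move=> i a; apply/com; exact: hg.
  exists b; rewrite -[g]phiK hb; apply: (big_morph psi psiM psi1).
- move=> i g hg hg'; have [||a ha] := @cent_tr1 _ _ F i (phi g).
  + by move=> j a; apply/com; exact: hg.
  + by move=> j l ji l0; apply/com; exact: hg'.
  by exists a; rewrite -ha phiK.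
- move=> i g hg hg'; have [||l l0 hl] := @cent_dil1 _ _ F i (phi g).
  + by move=> j a ij; apply/com; exact: hg.
  + by move=> j l l0; apply/com; exact: hg'.
  by exists l => //; rewrite -hl phiK.
Qed.

Lemma scalar_neq01 : exists2 l : k, l != 0 & l != 1.
Proof.
have /closed_nonrootP[l] : 'X * ('X - 1) != 0 :> {poly k}.
  by rewrite mulf_neq0 ?polyX_eq0 // -polyC1 polyXsubC_eq0.
by rewrite rootM -polyC1 root_XsubC rootE hornerX negb_or => /andP[]; exists l.
Qed.

Section AffineSpace.
Variable n : nat.
Local Notation A := (affine_space_variety k n).

Definition pt (y : 'I_n -> k) : A := exist _ [ffun i => y i] (mem_set I).

Lemma crd_pt y (j : 'I_n) : @crd k A j (pt y) = y j.
Proof. by rewrite /crd /= ffunE. Qed.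

Lemma Aut_translation (i : 'I_n) a : exists g : Aut A, forall x (j : 'I_n),
  @crd k A j (g x) = @crd k A j x + (if j == i then a else 0).
Proof.
pose f a (x : A) := pt (fun j => @crd k A j x + (if j == i then a else 0)).
have fr b (j : 'I_n) : @polyfun k A _ (@crd k A) (@crd k A j \o f b).
  apply: (@polyfun_eq _ _ _ _ (fun x => @crd k A j x + (if j == i then b else 0))).
    by move=> x; rewrite /= crd_pt.
  by apply: polyfunD; [exact: polyfun_var | exact: polyfun_cst].
have fK b : cancel (f b) (f (- b)).
  move=> x; apply: crd_inj => j; rewrite !crd_pt -addrA.
  by case: ifP; rewrite ?addrN ?addr0.
have [|g hg] := Aut_of (@coordinates_crd k A) (fr a) (fr (- a)) (fK a).
  by rewrite -{2}[a]opprK; exact: fK.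
by exists g => x j; rewrite hg crd_pt.
Qed.

Lemma Aut_dilation (i : 'I_n) l : l != 0 -> exists g : Aut A, forall x (j : 'I_n),
  @crd k A j (g x) = (if j == i then l else 1) * @crd k A j x.
Proof.
move=> l0; pose f l (x : A) := pt (fun j => (if j == i then l else 1) * @crd k A j x).
have fr b (j : 'I_n) : @polyfun k A _ (@crd k A) (@crd k A j \o f b).
  apply: (@polyfun_eq _ _ _ _ (fun x => (if j == i then b else 1) * @crd k A j x)).
    by move=> x; rewrite /= crd_pt.
  by apply: polyfunZ; exact: polyfun_var.
have fK b : b != 0 -> cancel (f b) (f b^-1).
  move=> b0 x; apply: crd_inj => j; rewrite !crd_pt mulrA.
  by case: ifP; rewrite ?mulVf ?mul1r.
have [|g hg] := Aut_of (@coordinates_crd k A) (fr l) (fr l^-1) (fK _ l0).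
  by rewrite -{2}[l]invrK; apply: fK; rewrite invr_eq0.
by exists g => x j; rewrite hg crd_pt.
Qed.

Lemma frame_affine_space : frame A n.
Proof.
have /cid[T hT] : exists T : 'I_n -> k -> Aut A, forall i a x (j : 'I_n),
    @crd k A j (T i a x) = @crd k A j x + (if j == i then a else 0).
  have /choice[T hT] (ia : 'I_n * k) := Aut_translation ia.1 ia.2.
  by exists (fun i a => T (i, a)) => i a; exact: hT (i, a).
have /cid[D hD] : exists D : 'I_n -> k -> Aut A, forall i l x (j : 'I_n), l != 0 ->
    @crd k A j (D i l x) = (if j == i then l else 1) * @crd k A j x.
  have /choice[D hD] (il : 'I_n * k) : exists g : Aut A, il.2 != 0 -> forall x (j : 'I_n),
      @crd k A j (g x) = (if j == il.1 then il.2 else 1) * @crd k A j x.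
    have [l0|l0] := eqVneq il.2 0; first by exists 1%g.
    by have [g hg] := Aut_dilation il.1 l0; exists g.
  by exists (fun i l => D (i, l)) => i l x j l0; exact: hD (i, l) l0 x j.
have eqA (g h : Aut A) : (forall x (j : 'I_n), @crd k A j (g x) = @crd k A j (h x)) -> g = h.
  by move=> gh; apply: Aut_eq => x; apply: crd_inj => j; exact: gh.
have TT (b : 'I_n -> k) x (j : 'I_n) :
    @crd k A j ((\big[*%g/1%g]_(i < n) T i (b i)) x) = @crd k A j x + b j.
  have -> : b j = \sum_i (if j == i then b i else 0).
    by rewrite (bigD1 j) //= eqxx big1 ?addr0 // => i /negPf; rewrite eq_sym => ->.
  elim: (index_enum _) => [|i r IH]; first by rewrite !big_nil addr0.
  by rewrite !big_cons Aut_mulE hT IH addrC addrCA addrA.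
(* Translations act transitively, so an automorphism commuting with them is determined by the image
   of the origin. *)
have cpt (g : Aut A) : (forall i a, commute g (T i a)) -> forall x (j : 'I_n),
    @crd k A j (g x) = @crd k A j x + @crd k A j (g (pt (fun=> 0))).
  move=> hg x j; pose h := \big[*%g/1%g]_(i < n) T i (@crd k A i x).
  have -> : x = h (pt (fun=> 0)) by apply: crd_inj => l; rewrite TT crd_pt add0r.
  have gh : commute g h.
    rewrite /h; elim/big_ind: _ => [|a b|i _]; [exact: commute1 | exact: commuteM | exact: hg].
  by rewrite -Aut_mulE gh Aut_mulE !TT crd_pt add0r addrC.
apply: (@Frame A n T D).
- move=> i a b; apply: eqA => x j; rewrite Aut_mulE !hT -addrA; congr (_ + _).
  by case: ifP; rewrite ?addr0 // addrC.
- by move=> i a b /(congr1 (fun g : Aut A => @crd k A i (g (pt (fun=> 0))))); rewrite !hT eqxx => /addrI.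
- by move=> i j a b; apply: eqA => x l; rewrite !Aut_mulE !hT addrAC.
- move=> i l m l0 m0; apply: eqA => x j; rewrite Aut_mulE !hD ?mulf_neq0 // mulrA.
  by case: ifP; rewrite ?mulr1.
- by move=> i j l m l0 m0; apply: eqA => x c; rewrite !Aut_mulE !hD // mulrCA.
- move=> i l a l0; apply: eqA => x j; rewrite !Aut_mulE hD // !hT hD // mulrDr.
  by case: ifP; rewrite ?mulr0.
- move=> i j l a ij l0; apply: eqA => x c; rewrite !Aut_mulE hD // !hT hD // mulrDr.
  case: (eqVneq c j) => [->|]; rewrite ?mulr0 //.
  by rewrite eq_sym (negPf ij) !mul1r.
- move=> g /cpt hg; exists (fun j => @crd k A j (g (pt (fun=> 0)))).
  by apply: eqA => x j; rewrite TT hg.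
- move=> i g /cpt hg hgD; exists (@crd k A i (g (pt (fun=> 0)))).
  apply: eqA => x j; rewrite hg hT; congr (_ + _); case: (eqVneq j i) => [->//|ji].
  have [l l0 l1] : exists2 l : k, l != 0 & l != 1.
    exact: scalar_neq01.
  have := congr1 (fun h : Aut A => @crd k A j (h (pt (fun=> 0)))) (hgD j l ji l0).
  have D0 : D j l (pt (fun=> 0)) = pt (fun=> 0).
    by apply: crd_inj => c; rewrite hD // !crd_pt mulr0.
  rewrite !Aut_mulE D0 hD // eqxx => /eqP; rewrite -subr_eq0 -{1}[X in X - _]mul1r -mulrBl.
  by rewrite mulf_eq0 subr_eq0 eq_sym (negPf l1) /= => /eqP.
- move=> i g hg hgD; have [l1 l10 l11] := scalar_neq01.
  pose o := pt (fun=> 0); pose e := pt (fun j => (j == i)%:R).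
  have fixed j x : D j l1 x = x -> @crd k A j (g x) = 0.
    move=> Dx; have := congr1 (fun h : Aut A => @crd k A j (h x)) (hgD j l1 l10).
    rewrite !Aut_mulE Dx hD // eqxx => /eqP; rewrite -subr_eq0 -{1}[X in X - _]mul1r -mulrBl.
    by rewrite mulf_eq0 subr_eq0 eq_sym (negPf l11) /= => /eqP.
  have go : g o = o.
    apply: crd_inj => j; rewrite crd_pt fixed //.
    by apply: crd_inj => c; rewrite hD // !crd_pt mulr0.
  pose c := @crd k A i (g e).
  have ge j : @crd k A j (g e) = (j == i)%:R * c.
    case: (eqVneq j i) => [->|ji]; rewrite ?mul1r // mul0r fixed //.
    apply: crd_inj => c'; rewrite hD // !crd_pt.
    by case: (eqVneq c' j) => [->|]; rewrite ?mul1r // (negPf ji) mulr0.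
  (* The dilations of coordinate [i] move [e] along the punctured axis, so [g] multiplies the whole
     axis by [c]; translations along the other axes then reduce a general point to this case. *)
  have gl l j : @crd k A j (g (pt (fun j => (j == i)%:R * l))) = (j == i)%:R * (l * c).
    case: (eqVneq l 0) => [->|l0].
      rewrite (_ : pt _ = o) ?go ?crd_pt ?mul0r ?mulr0 //.
      by apply: crd_inj => c'; rewrite !crd_pt mulr0.
    have -> : pt (fun j => (j == i)%:R * l) = D i l e.
      apply: crd_inj => c'; rewrite hD // !crd_pt.
      by case: (eqVneq c' i) => _; rewrite ?mul1r ?mulr1 // !mul0r ?mulr0.
    have /(congr1 (fun h : Aut A => @crd k A j (h e))) := hgD i l l0.
    rewrite !Aut_mulE => ->; rewrite hD // ge.
    by case: (eqVneq j i) => _; rewrite ?mul1r // !mul0r.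
  have gx x j : @crd k A j (g x) = (if j == i then c else 1) * @crd k A j x.
    pose h := \big[*%g/1%g]_(j < n) T j (if j == i then 0 else @crd k A j x).
    have T0 j' : T j' 0 = 1%g by apply: eqA => y c'; rewrite hT if_same addr0.
    have gh : commute g h.
      rewrite /h; elim/big_ind: _ => [|a b|j' _]; [exact: commute1 | exact: commuteM |].
      by case: (eqVneq j' i) => [_|ji]; [rewrite T0; exact: commute1 | exact: hg].
    have {1}-> : x = h (pt (fun j => (j == i)%:R * @crd k A i x)).
      apply: crd_inj => c'; rewrite TT crd_pt.
      by case: (eqVneq c' i) => [->|_]; rewrite ?mul1r ?addr0 // mul0r add0r.
    rewrite -Aut_mulE gh Aut_mulE TT gl.
    by case: (eqVneq j i) => [->|_]; [rewrite mul1r addr0 mulrC | rewrite mul0r add0r mul1r].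
  have c0 : c != 0.
    apply/eqP => c0; have := congr1 (@crd k A i) (can_inj (iso_funK g) (_ : g e = g o)).
    rewrite !crd_pt eqxx => /(_ _)/eqP; rewrite oner_eq0 => h; suff : False by []. 
    apply: notF; apply: h; apply: crd_inj => j; rewrite go crd_pt ge c0 mulr0 //.
  exists c => //; apply: eqA => x j; by rewrite gx hD.
Qed.
End AffineSpace.
End Frame.

(** * Bounded degree *)

Section Degree.
Variables (k : closedFieldType) (X : affine_variety k).
Local Notation N := (ambient_dim X).
Implicit Types g h : Aut X.

Definition represents (P : 'I_N -> {mpoly k[N]}) g :=
  forall x j, crd j (g x) = (P j).@[crd^~ x].

(** Bounding the inverse too makes the notion symmetric and lets invertibility be expressed by
    polynomial identities in the coefficients. *)
Definition degree_le d g := exists P Q : 'I_N -> {mpoly k[N]},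
  [/\ represents P g, represents Q g^-1%g & forall j, (msize (P j) <= d)%N /\ (msize (Q j) <= d)%N].

Lemma degree_exists g : exists d, degree_le d g.
Proof.
have [P hP] := iso_fun_regular g; have [Q hQ] := iso_fun_regular (g^-1%g).
exists (maxn (\max_j msize (P j)) (\max_j msize (Q j))), P, Q; split.
- by move=> x j; exact: hP.
- by move=> x j; exact: hQ.
- move=> j; rewrite !leq_max; split; apply/orP; [left|right].
    exact: (leq_bigmax (F := fun j => msize (P j))).
  exact: (leq_bigmax (F := fun j => msize (Q j))).
Qed.

Lemma degree_leW d d' g : (d <= d')%N -> degree_le d g -> degree_le d' g.
Proof.
move=> dd' [P [Q [hP hQ hd]]]; exists P, Q; split=> // j; have [h1 h2] := hd j.
by rewrite !(leq_trans _ dd').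
Qed.

Lemma degree_leV d g : degree_le d g -> degree_le d g^-1%g.
Proof.
move=> [P [Q [hP hQ hd]]]; exists Q, P; split; first exact: hQ.
  by move=> x j; rewrite invgK; exact: hP.
by move=> j; have [] := hd j.
Qed.

Lemma msize_comp_le d d' : exists D, forall (p : {mpoly k[N]}) (q : 'I_N -> {mpoly k[N]}),
  (msize p <= d)%N -> (forall j, msize (q j) <= d')%N -> (msize (p \mPo [tuple q j | j < N]) <= D)%N.
Proof.
pose E := (d * d'.+1).+1.
exists (N * E.+1).+1 => p q hp hq.
rewrite (comp_mpolywE _ hp).
apply: (big_ind (fun p => (msize p <= (N * E.+1).+1)%N)) => [|a b ha hb|m _]; first by rewrite msize0.
  by rewrite (leq_trans (msizeD_le _ _)) // geq_max ha.
rewrite (leq_trans (msizeZ_le _ _)) //.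
have := @msize_prod_le _ _ _ (index_enum 'I_N) xpredT (fun i => tnth [tuple q j | j < N] i ^+ (m : 'X_{1..N}) i) E.
have -> : size (index_enum 'I_N) = N by rewrite -[RHS]card_ord cardT enumT [index_enum _]unlock.
apply=> i; rewrite tnth_mktuple.
have mi : ((m : 'X_{1..N}) i <= d)%N.
  by apply: ltnW; apply: leq_ltn_trans (bmdeg m); rewrite mdegE (bigD1 i) //= leq_addr.
have := @msize_prod_le _ _ _ (nseq ((m : 'X_{1..N}) i) tt) xpredT (fun=> q i) d' (fun=> hq i).
rewrite size_nseq big_nseq iter_mulr_1 => h.
apply: leq_trans (_ : (((m : 'X_{1..N}) i) * d'.+1).+1 <= _)%N; last by rewrite ltnS leq_mul2r mi orbT.
exact: h.
Qed.

Definition bounded (A : Aut X -> Prop) := exists d, forall g, A g -> degree_le d g.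

Lemma bounded1 g : bounded (fun h => h = g).
Proof. by have [d hd] := degree_exists g; exists d => _ ->. Qed.

Lemma boundedM A B : bounded A -> bounded B ->
  bounded (fun g => exists a b, [/\ A a, B b & g = (a * b)%g]).
Proof.
move=> [d hA] [d' hB]; have [D hD] := msize_comp_le (maxn d d') (maxn d d').
exists D => _ [a [b [/hA[P [Q [hP hQ hd]]] /hB[P' [Q' [hP' hQ' hd']]] ->]]].
have hcomp (p : {mpoly k[N]}) (q : 'I_N -> {mpoly k[N]}) z :
    (p \mPo [tuple q j | j < _]).@[z] = p.@[fun j => (q j).@[z]].
  by rewrite comp_mpoly_meval; apply: meval_eq => j; rewrite tnth_mktuple.
exists (fun j => P j \mPo [tuple P' l | l < _]), (fun j => Q' j \mPo [tuple Q l | l < _]); split.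
- by move=> x j; rewrite Aut_mulE hP hcomp; apply: meval_eq => l.
- by move=> x j; rewrite invgM Aut_mulE hQ' hcomp; apply: meval_eq => l.
have bd1 j : (msize (P j) <= maxn d d')%N by rewrite leq_max; have [->] := hd j.
have bd2 j : (msize (Q j) <= maxn d d')%N by rewrite leq_max; have [_ ->] := hd j.
have bd3 j : (msize (P' j) <= maxn d d')%N by rewrite leq_max orbC; have [->] := hd' j.
have bd4 j : (msize (Q' j) <= maxn d d')%N by rewrite leq_max orbC; have [_ ->] := hd' j.
by move=> j; split; apply: hD.
Qed.

Lemma bounded_sub (A B : Aut X -> Prop) : (forall g, A g -> B g) -> bounded B -> bounded A.
Proof. by move=> AB [d hd]; exists d => g /AB/hd. Qed.

Lemma boundedV A : bounded A -> bounded (fun g => A g^-1%g).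
Proof. by move=> [d hd]; exists d => g /hd/degree_leV; rewrite invgK. Qed.

Lemma bounded_prod (I : Type) (r : seq I) (A : I -> Aut X -> Prop) : (forall i, bounded (A i)) ->
  bounded (fun g => exists2 f, (forall i, A i (f i)) & g = \big[*%g/1%g]_(i <- r) f i).
Proof.
move=> bA; elim: r => [|i r IH].
  by apply: bounded_sub (bounded1 1%g) => g [f _ ->]; rewrite big_nil.
apply: bounded_sub (boundedM (bA i) IH) => g [f Af ->]; rewrite big_cons.
by exists (f i), (\big[*%g/1%g]_(i <- r) f i); split=> //; exists f.
Qed.

(* Coefficient vectors of pairs (P, Q) representing an automorphism of degree < d
   and its inverse. *)
Section Coefficients.
Variable d : nat.
Definition coef_index : finType := ('I_N * 'X_{1..N < d} * bool)%type.
Definition ncoef := #|coef_index|.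

Definition coef_poly (b : bool) (c : 'I_ncoef -> k) (j : 'I_N) : {mpoly k[N]} :=
  \sum_(m : 'X_{1..N < d}) c (enum_rank (j, m, b)) *: 'X_[m].

Lemma coef_polyE b c j z :
  (coef_poly b c j).@[z] = \sum_(m : 'X_{1..N < d}) c (enum_rank (j, m, b)) * \prod_l z l ^+ (m : 'X_{1..N}) l.
Proof. by rewrite raddf_sum; apply: eq_bigr => m _; rewrite /= mevalZ mevalX. Qed.

Lemma coef_poly_eq b c c' j : c =1 c' -> coef_poly b c j = coef_poly b c' j.
Proof. by move=> cc'; apply: eq_bigr => m _; rewrite cc'. Qed.

Lemma coef_polyP (P Q : 'I_N -> {mpoly k[N]}) :
  (forall j, (msize (P j) <= d)%N /\ (msize (Q j) <= d)%N) ->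
  exists c, forall j, coef_poly true c j = P j /\ coef_poly false c j = Q j.
Proof.
move=> hd; exists (fun l => let: (j, m, b) := (enum_val l : coef_index) in
  if b then (P j)@_m else (Q j)@_m) => j; have [h1 h2] := hd j.
by split; [rewrite [RHS](mpolywE h1)|rewrite [RHS](mpolywE h2)]; apply: eq_bigr => m _; rewrite enum_rankK.
Qed.

(** A code determines its automorphism, but an automorphism may have several codes, since
    polynomials vanishing on [X] can be added. *)
Definition codes (c : 'I_ncoef -> k) g :=
  represents (coef_poly true c) g /\ represents (coef_poly false c) g^-1%g.

Lemma codes_inj c g h : codes c g -> codes c h -> g = h.
Proof. by move=> [hg _] [hh _]; apply: Aut_eq => x; apply: crd_inj => j; rewrite hg hh. Qed.

Lemma msize_coef_poly b c j : (msize (coef_poly b c j) <= d)%N.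
Proof.
rewrite /coef_poly.
apply: (big_ind (fun p => (msize p <= d)%N)) => [|p q hp hq|m _]; first by rewrite msize0.
  by rewrite (leq_trans (msizeD_le _ _)) // geq_max hp.
by rewrite (leq_trans (msizeZ_le _ _)) // msizeX bmdeg.
Qed.

Lemma degree_leP g : degree_le d g <-> exists c, codes c g.
Proof.
split=> [[P [Q [hP hQ /coef_polyP[c hc]]]]|[c [hP hQ]]].
  by exists c; split=> x j; have [e1 e2] := hc j; [rewrite e1|rewrite e2].
by exists (coef_poly true c), (coef_poly false c); split=> // j; rewrite !msize_coef_poly.
Qed.

Lemma polyfun_coef_poly b j (y : 'I_N -> ('I_ncoef -> k) -> k) :
  (forall l, polyfun (fun l c => c l) (y l)) ->
  polyfun (fun l c => c l) (fun c => (coef_poly b c j).@[y^~ c]).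
Proof.
move=> hy; apply: (@polyfun_eq _ _ _ _ (fun c =>
    \sum_(m : 'X_{1..N < d}) c (enum_rank (j, m, b)) * \prod_l y l c ^+ (m : 'X_{1..N}) l)).
  by move=> c; rewrite coef_polyE.
apply: polyfun_sum => m; apply: polyfunM; first exact: polyfun_var.
by apply: polyfun_prod => l; exact: polyfunX.
Qed.

(* Being the code of an automorphism centralizing a given set is a closed
   condition, hence given by finitely many equations. *)
Lemma codes_closed (Sigma : Aut X -> Prop) : exists Ps : seq {mpoly k[ncoef]},
  forall c, (forall p, p \in Ps -> p.@[c] = 0) <->
    exists2 g, (forall s, Sigma s -> commute g s) & codes c g.
Proof.
pose E c := exists2 g, (forall s, Sigma s -> commute g s) & codes c g.
have [Ps [PsE hPs]] := noetherian_zeros (fun p : {mpoly k[ncoef]} => forall c, E c -> p.@[c] = 0).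
exists Ps => c; split=> [hc|Ec p /PsE]; last exact.
(* Every polynomial identity valid for all members of [E] holds at [c]. The rest writes as such
   identities that [c] maps [X] to itself, that its two halves are mutually inverse and that it
   commutes with [Sigma]. *)
have Ecl (f : ('I_ncoef -> k) -> k) : polyfun (fun l c => c l) f -> (forall c, E c -> f c = 0) -> f c = 0.
  move=> [p hp] hf; rewrite hp; apply: hPs => // c' Ec'.
  by rewrite -hp; exact: hf.
have Xb b x : exists y : X, forall j, crd j y = (coef_poly b c j).@[crd^~ x].
  apply: (coordinates_closed (@coordinates_crd k X)) => p hp.
  apply: (Ecl (fun c => p.@[fun j => (coef_poly b c j).@[crd^~ x]])).
    apply: polyfun_meval => j; apply: polyfun_coef_poly => l; exact: polyfun_cst.
  move=> c' [g _ [h1 h2]]; case: b; [rewrite -(hp (g x))|rewrite -(hp (g^-1%g x))].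
    by apply: meval_eq => j; rewrite h1.
  by apply: meval_eq => j; rewrite h2.
have /choice[g hg] := Xb true; have /choice[h hh] := Xb false.
have inv b x j : (coef_poly b c j).@[fun l => (coef_poly (~~ b) c l).@[crd^~ x]] = crd j x.
  apply/eqP; rewrite -subr_eq0; apply/eqP.
  apply: (Ecl (fun c => (coef_poly b c j).@[fun l => (coef_poly (~~ b) c l).@[crd^~ x]] - crd j x)).
    apply: polyfunB; last exact: polyfun_cst.
    by apply: polyfun_coef_poly => l; apply: polyfun_coef_poly => l'; exact: polyfun_cst.
  move=> c' [g' _ [h1 h2]]; apply/eqP; rewrite subr_eq0; apply/eqP; case: b => /=.
    rewrite (meval_eq _ (v2 := crd^~ (g'^-1%g x))) => [|l]; last by rewrite h2.
    by rewrite -h1 Aut_invK.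
  rewrite (meval_eq _ (v2 := crd^~ (g' x))) => [|l]; last by rewrite h1.
  by rewrite -h2 -Aut_mulE mulVg.
have gK : cancel g h.
  move=> x; apply: crd_inj => j; rewrite hh -[RHS](inv false).
  by apply: meval_eq => l; rewrite hg.
have hK : cancel h g.
  move=> x; apply: crd_inj => j; rewrite hg -[RHS](inv true).
  by apply: meval_eq => l; rewrite hh.
have [||a ha] := Aut_of (@coordinates_crd k X) _ _ gK hK.
- by move=> j; exists (coef_poly true c j) => x; exact: hg.
- by move=> j; exists (coef_poly false c j) => x; exact: hh.
exists a; last first.
  split=> x j; first by rewrite ha hg.
  by rewrite -hh; congr (crd j _); rewrite -[in RHS](Aut_invK a x) ha gK.
move=> s Ss; apply: Aut_eq => x; apply: crd_inj => j; have [P hP] := iso_fun_regular s.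
have hsx y l : crd l (s y) = (P l).@[crd^~ y] by exact: hP.
rewrite !Aut_mulE ha hg hsx; apply/eqP; rewrite -subr_eq0; apply/eqP.
rewrite [X in _ - X](meval_eq _ (v2 := fun l => (coef_poly true c l).@[crd^~ x])); last first.
  by move=> l; rewrite ha hg.
apply: (Ecl (fun c => (coef_poly true c j).@[crd^~ (s x)] - (P j).@[fun l => (coef_poly true c l).@[crd^~ x]])).
  apply: polyfunB.
    by apply: polyfun_coef_poly => l; exact: polyfun_cst.
  by apply: polyfun_meval => l; apply: polyfun_coef_poly => l'; exact: polyfun_cst.
move=> c' [g' cg' [h1 h2]]; apply/eqP; rewrite subr_eq0; apply/eqP.
rewrite -h1 -Aut_mulE cg' // Aut_mulE hsx; apply: meval_eq => l; exact: h1.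
Qed.

End Coefficients.
End Degree.

(** Pigeonhole: if the first coordinate takes finitely many values, one of its fibres is infinite
    and is still separated by the remaining coordinates. *)
Lemma infinite_coordinate (T : Type) (U : choiceType) (I : eqType) (r : seq I) (f : I -> T -> U) (A : set T) :
  infinite_set A ->
  (forall a b, A a -> A b -> (forall l, l \in r -> f l a = f l b) -> a = b) ->
  exists l, infinite_set [set y | exists2 a, A a & f l a = y]%classic.
Proof.
elim: r A => [|l r IH] A infA inj.
  exfalso; apply: infA; have [[a Aa]|none] := pselect (exists a, A a).
    apply: (@sub_finite_set _ _ [set a]%classic); last exact: finite_set1.
    by move=> b Ab; apply: inj.
  by rewrite (_ : A = set0)%classic //; apply/seteqP; split=> // a Aa; apply: none; exists a.
have [fin|inf] := pselect (finite_set [set y | exists2 a, A a & f l a = y]%classic); last by exists l.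
have [[y infy]|none] := pselect (exists y, infinite_set [set a | A a /\ f l a = y]%classic); last first.
  exfalso; apply: infA.
  apply: (@sub_finite_set _ _ (\bigcup_(y in [set y | exists2 a, A a & f l a = y]) [set a | A a /\ f l a = y])%classic).
    by move=> a Aa /=; exists (f l a) => //=; exists a.
  apply: bigcup_finite => // y _; apply: contrapT => h; apply: none; by exists y.
have [|l' inf'] := IH _ infy.
  move=> a b [Aa ea] [Ab eb] h; apply: inj => // l'; rewrite inE => /orP[/eqP->|]; last exact: h.
  by rewrite ea eb.
exists l'; apply: sub_infinite_set inf' => z [a [Aa _] <-]; by exists a.
Qed.

Section BoundedDilations.
Variables (k : closedFieldType) (X : affine_variety k) (n : nat) (F : frame X n).
Hypothesis k_uncountable : ~ countable [set: k]%classic.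
Local Notation N := (ambient_dim X).

Lemma tr0 i : tr F i 0 = 1%g.
Proof. by apply: (mulgI (tr F i 0)); rewrite -trD addr0 mulg1. Qed.

Lemma trN i a : tr F i (- a) = (tr F i a)^-1%g.
Proof. by apply: (mulgI (tr F i a)); rewrite -trD subrr tr0 mulgV. Qed.

Lemma dil1 i : dil F i 1 = 1%g.
Proof. by apply: (mulgI (dil F i 1)); rewrite -dilM ?oner_neq0 // mulr1 mulg1. Qed.

Lemma dilV i l : l != 0 -> dil F i l^-1 = (dil F i l)^-1%g.
Proof.
by move=> l0; apply: (mulgI (dil F i l)); rewrite -dilM ?invr_eq0 // mulfV // dil1 mulgV.
Qed.

Lemma dilJ i l a : l != 0 -> tr F i (l * a) = (dil F i l * tr F i a * (dil F i l)^-1)%g.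
Proof. by move=> l0; rewrite dil_tr // mulgK. Qed.

Variable i : 'I_n.

(* The points [dil s x0], for finitely many s, have trivial common stabilizer:
   otherwise, all nontrivial translations being conjugate to [tr i 1] under the
   commuting dilations, a noetherian argument shows that [tr i 1] fixes x0. *)
Lemma free_points : exists m (pts : 'I_m -> X),
  forall a b, (forall j, tr F i a (pts j) = tr F i b (pts j)) -> a = b.
Proof.
have [x0 hx0] : exists x0, tr F i 1 x0 <> x0.
  apply: contrapT => none; have /tr_inj/eqP : tr F i 1 = tr F i 0.
    rewrite tr0; apply: Aut_eq => x; apply: contrapT => h; apply: none; by exists x.
  by rewrite oner_eq0.
pose f s j x := crd j (tr F i 1 (dil F i s x)) - crd j (dil F i s x).
have fr s j : regfun (f s j).
  apply: polyfunB; last by apply: (regfun_comp (dil F i s)); exact: polyfun_var.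
  by apply: (regfun_comp (tr F i 1 * dil F i s)%g); exact: polyfun_var.
have [Ps [PsS hPs]] := noetherian_zeros (fun p : {mpoly k[N]} =>
  exists s j, s != 0 /\ forall x, f s j x = p.@[crd^~ x]).
have /choice[sj hsj] (p : {mpoly k[N]}) : exists sj : k, p \in Ps ->
    sj != 0 /\ exists j, forall x, f sj j x = p.@[crd^~ x].
  have [/PsS[s [j [s0 h]]]|_] := boolP (p \in Ps); last by exists 0.
  by exists s => _; split=> //; exists j.
have key a : a != 0 -> (forall p, p \in Ps -> tr F i a (dil F i (sj p) x0) = dil F i (sj p) x0) -> False.
  move=> a0 fix_a; apply: hx0.
  (* [tr F i 1] composed with the dilation by [a^-1] is that dilation composed with [tr F i a], so
     the finitely many equations in [Ps] hold at [y]. Hence all of them do, and those with [s = a]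
     say that [tr F i 1] fixes [x0]. *)
  pose y := dil F i a^-1 x0.
  have hy s j : s != 0 -> f s j y = 0.
    move=> s0; have [p hp] := fr s j; rewrite hp; apply: hPs; last by exists s, j.
    move=> q qPs; have [s'0 [j' hq]] := hsj q qPs; rewrite -hq /f /y.
    have -> : dil F i (sj q) (dil F i a^-1 x0) = dil F i a^-1 (dil F i (sj q) x0).
      by rewrite -!Aut_mulE dilC // invr_eq0.
    rewrite -Aut_mulE -[X in (tr F i X * _)%g](mulVf a0) -dil_tr ?invr_eq0 // Aut_mulE fix_a //.
    by rewrite subrr.
  apply: crd_inj => j; have := hy a j a0; rewrite /f /y -!Aut_mulE -mulgA -dilM ?invr_eq0 // mulfV //.
  by rewrite dil1 mulg1 => /eqP; rewrite subr_eq0 => /eqP.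
exists (size Ps), (fun j => dil F i (sj (tnth (in_tuple Ps) j)) x0) => a b hab.
apply/eqP; rewrite -subr_eq0; apply: contraT => ab; exfalso; apply: (key _ ab) => p pPs.
have /tnthP[j ->] : p \in in_tuple Ps by [].
by rewrite addrC trD Aut_mulE hab -Aut_mulE -trD addNr tr0.
Qed.

Definition deg_tr d a := degree_le d (tr F i a).

Lemma infinite_deg_tr : exists d, infinite_set [set a | deg_tr d a]%classic.
Proof.
apply: contrapT => none; apply: k_uncountable.
apply: (@sub_countable _ _ _ (\bigcup_d [set a | deg_tr d a])%classic).
  by apply: subset_card_le => a _; have [d hd] := degree_exists (tr F i a); exists d.
apply: bigcup_countable => // d _; apply: finite_set_countable.
by apply: contrapT => h; apply: none; exists d.
Qed.

(** Chosen so that its centralizer is exactly the [i]-th translation group; through [codes_closed],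
    translations of bounded degree become a closed set of codes. *)
Definition cent_tr_set (g : Aut X) :=
  (exists j a, g = tr F j a) \/ exists j l, [/\ j != i, l != 0 & g = dil F j l].

Lemma cent_tr_setP g : (forall s, cent_tr_set s -> commute g s) <-> exists a, g = tr F i a.
Proof.
split=> [h|[a ->] s].
  apply: cent_tr1 => [j a|j l ji l0]; apply: h; first by left; exists j, a.
  by right; exists j, l.
case=> [[j [b ->]]|[j [l [ji l0 ->]]]]; first exact: trC.
by apply: commute_sym; apply: dil_trC.
Qed.

Section Relations.
Variables (d mp : nat) (pts : 'I_mp -> X).
Hypothesis pts_free : forall a b, (forall j, tr F i a (pts j) = tr F i b (pts j)) -> a = b.
Hypothesis inf_d : infinite_set [set a | deg_tr d a]%classic.

Let M := #|{: 'I_mp * 'I_N}|.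
Let J (l : 'I_M) (x : 'I_mp -> X) := crd (enum_val l).2 (x (enum_val l).1).

Lemma coordJ_inj a b : (forall l, J l (fun j => tr F i a (pts j)) = J l (fun j => tr F i b (pts j))) -> a = b.
Proof.
move=> h; apply: pts_free => j; apply: crd_inj => c.
by have := h (enum_rank (j, c)); rewrite /J enum_rankK.
Qed.

Definition independent_scalars m (a : 'I_m -> k) := (forall l, a l != 0) /\
  forall u u' : 'I_m -> k, (forall l, deg_tr d (u l)) -> (forall l, deg_tr d (u' l)) ->
    \sum_l a l * u l = \sum_l a l * u' l -> u =1 u'.

(** The translation by [s = \sum_l a l * u l] is seen through the [M] coordinates of the moved
    points [pts]. By independence these [M] values define every [u l], hence [m] field elements
    ranging freely over the infinite set [Y]; for [M < m] this contradicts
    [no_definable_section]. *)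
Lemma card_independent_scalars m (a : 'I_m -> k) : independent_scalars a -> (m <= M)%N.
Proof.
move=> [a0 inj]; rewrite leqNgt; apply/negP => ltMm.
have [l0 infY] : exists l0 : 'I_M, infinite_set [set y | exists2 b, deg_tr d b & J l0 (fun j => tr F i b (pts j)) = y]%classic.
  apply: (@infinite_coordinate _ _ _ (enum 'I_M) _ [set b | deg_tr d b]%classic) => // b b' _ _ h.
  by apply: coordJ_inj => l; apply: h; rewrite mem_enum.
set Y := (X in infinite_set X) in infY.
pose q := ncoef X d.
have [Ps hPs] := @codes_closed k X d cent_tr_set.
have /choice[Pd hPd] (b : k) : exists P : 'I_N -> {mpoly k[N]}, represents P (dil F i b).
  by have [P hP] := iso_fun_regular (dil F i b); exists P => x j; exact: hP.
(* the l-th block of variables holds the coefficients of the l-th translation *)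
pose c (e : seq k) (l : 'I_m) (t : 'I_q) := e`_(M.+1 + (l * q + t)).
(* The translation by [a l * u l] is the conjugate, by the fixed dilation by [a l], of the one coded
   by [c e l], so [orb] is polynomial in the environment. *)
pose step (e : seq k) l (z : 'I_N -> k) (j : 'I_N) :=
  (Pd (a l) j).@[fun j' => (coef_poly true (c e l) j').@[fun j'' => (Pd (a l)^-1 j'').@[z]]].
pose orb e (x : X) := foldr (step e) (crd^~ x) (enum 'I_m).
have orb_spec e (u : 'I_m -> k) : (forall l, codes (c e l) (tr F i (u l))) -> forall x j,
    orb e x j = crd j (tr F i (\sum_l a l * u l) x).
  move=> hu x; rewrite /orb -big_enum /=; elim: (enum 'I_m) => [|l r IH] j /=.
    by rewrite big_nil tr0.
  rewrite big_cons trD Aut_mulE dilJ // !Aut_mulE hPd /step; apply: meval_eq => j'.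
  have [hul _] := hu l; rewrite hul; apply: meval_eq => j''.
  by rewrite -dilV // hPd; apply: meval_eq => l'; rewrite IH.
have coef_term l b j (z : 'I_N -> seq k -> k) : (forall j, polynomial_term (z j)) ->
    polynomial_term (fun e => (coef_poly b (c e l) j).@[z^~ e]).
  move=> hz; apply: (@polynomial_eq _ (fun e => \sum_(mm : 'X_{1..N < d})
     c e l (enum_rank (j, mm, b)) * \prod_l' z l' e ^+ (mm : 'X_{1..N}) l')).
    by move=> e; rewrite coef_polyE.
  apply: polynomial_sum => mm; apply: polynomial_mul; first exact: polynomial_var.
  by apply: polynomial_prod => l'; apply: polynomial_exp.
have orb_term x j : polynomial_term (fun e => orb e x j).
  rewrite /orb; elim: (enum 'I_m) j => [|l r IH] j /=; first exact: polynomial_cst.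
  pose z (j' : 'I_N) e := foldr (step e) (crd^~ x) r j'.
  pose z1 (j' : 'I_N) e := (Pd (a l)^-1 j').@[z^~ e].
  apply: (@polynomial_meval k N (Pd (a l) j) (fun j' e => (coef_poly true (c e l) j').@[z1^~ e])) => j'.
  by apply: coef_term => j''; apply: polynomial_meval.
(* Position 0 holds the candidate for [y l] and positions 1 to [M] the coordinates of the points
   moved by [s]; the blocks after them code unknown translations whose combination has the effect of
   [s]. *)
pose Psi0 (l : 'I_m) (e : seq k) :=
  (forall l', {in Ps, forall p, p.@[c e l'] = 0}) /\
  ((coef_poly true (c e l) (enum_val l0).2).@[crd^~ (pts (enum_val l0).1)] = e`_0 /\
   forall l' : 'I_M, orb e (pts (enum_val l').1) (enum_val l').2 = e`_(l'.+1)).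
pose Psi l e := exists g : nat -> k,
  Psi0 l (mkseq (fun t => if (M.+1 <= t < M.+1 + m * q)%N then g t else e`_t) (maxn (M.+1 + m * q) (size e))).
have Psi0_def l : definable (Psi0 l).
  apply: definable_and; last apply: definable_and.
  - apply: definable_forall => l'; apply: definable_all_in => p.
    apply: definable_eqf (polynomial_cst 0).
    by apply: polynomial_meval => t; exact: polynomial_var.
  - apply: definable_eqf; last exact: polynomial_var.
    by apply: (coef_term _ _ _ (fun j e => crd j (pts (enum_val l0).1))) => j; exact: polynomial_cst.
  - by apply: definable_forall => l'; apply: definable_eqf; last exact: polynomial_var.
have Psi_def l : definable (Psi l) by exact: definable_exists.
apply: (@no_definable_section k M m Psi Y) => // y Yy.
have /choice[u hu] l : exists u, deg_tr d u /\ J l0 (fun j => tr F i u (pts j)) = y l.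
  by have [u] := Yy l; exists u.
pose s := \sum_l a l * u l.
exists (fun l => J l (fun j => tr F i s (pts j))) => l x.
split=> [[g]|->].
  set e := mkseq _ _ => -[hPs' [hx hs]].
  have /choice[u' hu'] l' : exists u', codes (c e l') (tr F i u').
    have [g' /cent_tr_setP[u' ->]] := (hPs _).1 (hPs' l').
    by exists u'.
  have du' l' : deg_tr d (u' l') by apply/degree_leP; exists (c e l').
  have e_small t : (t <= M)%N -> e`_t = (x :: seq_of (fun l => J l (fun j => tr F i s (pts j))))`_t.
    move=> tM; rewrite nth_mkseq; last by rewrite leq_max (leq_trans (_ : t < M.+1)%N) ?leq_addr.
    by rewrite ltnNge tM.
  have suu' : \sum_l a l * u' l = s.
    apply: coordJ_inj => l'; rewrite /J -(orb_spec _ _ hu') hs e_small //=.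
    by rewrite nth_mkseq // valK.
  have [hu1 _] := hu' l.
  have eu : u' =1 u by apply: inj => // l'; have [] := hu l'.
  have [_ <-] := hu l; rewrite -eu /J hu1 hx e_small //.
have /choice[cu hcu] l' : exists cu : 'I_(ncoef X d) -> k, codes cu (tr F i (u l')).
  by have [/degree_leP] := hu l'.
pose g t := if insub ((t - M.+1) %/ q)%N is Some l' then
  if insub ((t - M.+1) %% q)%N is Some t' then cu l' t' else 0 else 0.
exists g; set e := mkseq _ _.
have ce l' : c e l' =1 cu l'.
  move=> t; have tq := ltn_ord t.
  have lt_mq : (l' * q + t < m * q)%N.
    apply: (@leq_trans (l' * q + q)); first by rewrite ltn_add2l.
    by rewrite addnC -mulSn leq_mul2r ltn_ord orbT.
  rewrite /c nth_mkseq; last by rewrite leq_max ltn_add2l lt_mq.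
  rewrite leq_addr ltn_add2l lt_mq /= /g addKn divnMDl ?(leq_trans _ tq) // divn_small // addn0 modnMDl modn_small //.
  by rewrite !valK.
have e_small t : (t <= M)%N -> e`_t = (y l :: seq_of (fun l => J l (fun j => tr F i s (pts j))))`_t.
  move=> tM; rewrite nth_mkseq; last by rewrite leq_max (leq_trans (_ : t < M.+1)%N) ?leq_addr.
  by rewrite ltnNge tM.
have hce l' : codes (c e l') (tr F i (u l')).
  have [h1 h2] := hcu l'.
  by split=> x' j; rewrite (coef_poly_eq _ _ (ce l')).
split=> [l' p pPs|].
  by apply: (hPs _).2 => //; exists (tr F i (u l')) => //; apply/cent_tr_setP; exists (u l').
split=> [|l'].
  by have [h1 _] := hce l; rewrite -h1 e_small //; have [_ <-] := hu l.
by rewrite (orb_spec _ _ hce) e_small //= nth_mkseq // valK.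
Qed.

(** Adding [a] to a maximal independent family creates a coincidence between two sums. The
    coefficients [w] and [w'] of [a] differ, by independence of the family, and [a * (w - w')] is a
    combination, with fixed scalars, of differences of bounded parameters. *)
Lemma max_independent_scalars : exists d', forall a, a != 0 -> exists b b',
  [/\ b != 0, b' = a * b, deg_tr d' b & deg_tr d' b'].
Proof.
pose good m := exists a : 'I_m -> k, independent_scalars a.
have ex : exists m, `[< good m >].
  exists 0%N; apply/asboolP; exists (fun=> 0); split=> [[]//|u u' _ _ _ []//].
have bd m : `[< good m >] -> (m <= M)%N.
  by move=> /asboolP[a ha]; exact: card_independent_scalars ha.
case: (ex_maxnP ex bd) => m /asboolP[a [a0 inj]] hmax.
have [d1 hd1] : bounded (fun g => exists2 f : 'I_m -> Aut X,
    forall l, exists u u', [/\ deg_tr d u, deg_tr d u' & f l = tr F i (a l * (u' - u))] &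
    g = \big[*%g/1%g]_l f l).
  apply: (@bounded_prod _ _ _ (index_enum 'I_m) (fun l g => exists u u',
    [/\ deg_tr d u, deg_tr d u' & g = tr F i (a l * (u' - u))])) => l.
  have bd_d : bounded (fun g : Aut X => degree_le d g) by exists d.
  have := boundedM (boundedM (bounded1 (dil F i (a l))) (boundedM bd_d (boundedV bd_d)))
    (bounded1 (dil F i (a l))^-1%g).
  apply: bounded_sub => g [u [u' [du du' ->]]]; rewrite dilJ // trD trN.
  exists (dil F i (a l) * (tr F i u' * (tr F i u)^-1))%g, (dil F i (a l))^-1%g; split=> //.
  exists (dil F i (a l)), (tr F i u' * (tr F i u)^-1)%g; split=> //.
  exists (tr F i u'), (tr F i u)^-1%g; split=> //.
have [d2 hd2] : bounded (fun g => exists w w', [/\ deg_tr d w, deg_tr d w' & g = tr F i (w - w')]).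
  have bd_d : bounded (fun g : Aut X => degree_le d g) by exists d.
  apply: bounded_sub (boundedM bd_d (boundedV bd_d)) => g [w [w' [dw dw' ->]]].
  by exists (tr F i w), (tr F i w')^-1%g; rewrite trD trN; split.
exists (maxn d1 d2) => a1 a10.
have [u [u' [du du' suu' neq]]] : exists u u' : 'I_(m + 1) -> k, [/\ forall l, deg_tr d (u l),
    forall l, deg_tr d (u' l),
    \sum_l (match fintype.split l with inl l' => a l' | inr _ => a1 end) * u l =
    \sum_l (match fintype.split l with inl l' => a l' | inr _ => a1 end) * u' l & ~ u =1 u'].
  apply: contrapT => none; have : (m + 1 <= m)%N.
    apply: hmax; apply/asboolP; exists (fun l => match fintype.split l with inl l' => a l' | inr _ => a1 end).
    split=> [l|u u' du du' suu']; first by case: (fintype.split l).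
    by apply: contrapT => neq; apply: none; exists u, u'.
  by rewrite addn1 ltnn.
move: suu'; rewrite !big_split_ord !big_ord1 /=.
have sl l : fintype.split (lshift 1 l : 'I_(m + 1)) = inl l by exact: (unsplitK (inl l)).
have sr : fintype.split (rshift m 0 : 'I_(m + 1)) = inr 0 by exact: (unsplitK (inr 0)).
rewrite sr; under eq_bigr do rewrite sl; under [X in _ = X + _]eq_bigr do rewrite sl.
set w := u (rshift m 0); set w' := u' (rshift m 0) => suu'.
have eq1 : \sum_l a l * (u' (lshift 1 l) - u (lshift 1 l)) = a1 * (w - w').
  under eq_bigr do rewrite mulrBr.
  rewrite sumrB mulrBr (_ : \sum_l a l * u' _ = \sum_l a l * u (lshift 1 l) + a1 * w - a1 * w').
    ring.
  by rewrite suu' addrK.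
exists (w - w'), (a1 * (w - w')); split=> //.
- apply/eqP => ww'; apply: neq => l; have := splitK l.
  case: (fintype.split l) => [l' <-|l' <-] /=; last first.
    by rewrite ord1; apply/eqP; rewrite -subr_eq0; apply/eqP.
  apply: (inj (fun l => u (lshift 1 l)) (fun l => u' (lshift 1 l))) => //.
  by move/eqP: eq1; under eq_bigr do rewrite mulrBr; rewrite sumrB ww' mulr0 subr_eq0 => /eqP.
- apply: (@degree_leW _ _ d2); rewrite ?leq_maxr //; apply: hd2.
  by exists w, w'; split=> //; [exact: du | exact: du'].
- apply: (@degree_leW _ _ d1); rewrite ?leq_maxl //; apply: hd1.
  exists (fun l => tr F i (a l * (u' (lshift 1 l) - u (lshift 1 l)))).
    by move=> l; exists (u (lshift 1 l)), (u' (lshift 1 l)); split.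
  rewrite -eq1; apply: (big_morph (tr F i) (trD F i)); exact: tr0.
Qed.
End Relations.

Definition cent_dil_set (g : Aut X) :=
  (exists j a, j != i /\ g = tr F j a) \/ exists j l, l != 0 /\ g = dil F j l.

Lemma cent_dil_setP g : (forall s, cent_dil_set s -> commute g s) <->
  exists2 l, l != 0 & g = dil F i l.
Proof.
split=> [h|[l l0 ->] s].
  apply: cent_dil1 => [j a ji|j l l0]; apply: h; first by left; exists j, a.
  by right; exists j, l.
case=> [[j [b [ji ->]]]|[j [l' [l'0 ->]]]]; last exact: dilC.
by apply: dil_trC; rewrite // eq_sym.
Qed.

(** Each [l] is [s' / s] with both translations of degree at most [d], and the dilation by [l] is
    the one conjugating the first translation to the second. Having degree at most [r] is thus a
    definable condition on the two codes, to which saturation applies. *)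
Lemma bounded_dil : exists d, forall l, l != 0 -> degree_le d (dil F i l).
Proof.
have [mp [pts pts_free]] := free_points; have [d0 inf_d] := infinite_deg_tr.
have [d hd] := max_independent_scalars pts_free inf_d.
pose q := ncoef X d.
have [Ps hPs] := @codes_closed k X d cent_tr_set.
pose c1 (e : seq k) (t : 'I_q) := e`_t.
pose c2 (e : seq k) (t : 'I_q) := e`_(q + t).
(* Vacuous unless both halves of [e] code nonzero translations; hence every [e] admits some [r]. *)
pose Sem r e := forall s s', codes (c1 e) (tr F i s) -> codes (c2 e) (tr F i s') ->
  s != 0 -> s' != 0 -> degree_le r (dil F i (s' / s)).
have Sem_inc r e : Sem r e -> Sem r.+1 e.
  by move=> h s s' h1 h2 s0 s'0; apply: degree_leW (leqnSn r) _; exact: h.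
have codes_tr_inj (c : 'I_q -> k) s s' : codes c (tr F i s) -> codes c (tr F i s') -> s = s'.
  by move=> h h'; apply: (tr_inj (codes_inj h h')).
have Sem_cov e : exists r, Sem r e.
  have [[s [s' [h1 h2]]]|none] := pselect (exists s s', codes (c1 e) (tr F i s) /\ codes (c2 e) (tr F i s')).
    have [r hr] := degree_exists (dil F i (s' / s)); exists r => t t' h1' h2' _ _.
    by rewrite (codes_tr_inj _ _ _ h1' h1) (codes_tr_inj _ _ _ h2' h2).
  by exists 0%N => s s' h1 h2; exfalso; apply: none; exists s, s'.
suff Sem_def r : definable (Sem r).
  have [r hr] := saturation k_uncountable (q + q) Sem_def Sem_inc Sem_cov.
  exists r => l l0; have [s [s' [s0 ->]]] := hd l l0.
  move=> /degree_leP[cs hs] /degree_leP[cs' hs'].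
  pose e := mkseq (fun t => if insub t is Some t' then cs t' else
    if insub (t - q)%N is Some t' then cs' t' else 0) (q + q).
  have e1 : c1 e =1 cs.
    by move=> t; rewrite /c1 nth_mkseq ?(leq_trans (ltn_ord t)) ?leq_addr // valK.
  have e2 : c2 e =1 cs'.
    move=> t; rewrite /c2 nth_mkseq ?ltn_add2l // insubF ?addKn ?valK //.
    by apply/negbTE; rewrite -leqNgt leq_addr.
  rewrite -[l](mulfK s0); apply: (hr e _ s (l * s)); rewrite ?size_mkseq ?mulf_neq0 //.
    have [h1 h2] := hs; split=> x j; rewrite (coef_poly_eq _ _ e1) //.
  have [h1 h2] := hs'; split=> x j; rewrite (coef_poly_eq _ _ e2) //.
pose qr := ncoef X r.
have [Ts hTs] := @codes_closed k X r cent_dil_set.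
pose cb (e : seq k) (t : 'I_qr) := e`_(q + q + t).
pose act dd b (c : 'I_(ncoef X dd) -> k) (z : 'I_N -> k) j := (coef_poly b c j).@[z].
(* [cb e] codes a dilation that conjugates the first translation to a map agreeing with the second
   one on [pts]; freeness of [pts] then forces [l * s = s']. *)
pose cond e := (forall p, p \in Ts -> p.@[cb e] = 0) /\
  forall (j : 'I_mp) (l : 'I_N),
    act r true (cb e) (act d true (c1 e) (act r false (cb e) (crd^~ (pts j)))) l =
    act d true (c2 e) (crd^~ (pts j)) l.
pose hyp (c : seq k -> 'I_q -> k) e := (forall p, p \in Ps -> p.@[c e] = 0) /\
  ~ (forall (j : 'I_mp) (l : 'I_N), act d true (c e) (crd^~ (pts j)) l = crd l (pts j)).
have act_term dd b (c : seq k -> 'I_(ncoef X dd) -> k) (z : seq k -> 'I_N -> k) j :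
    (forall t, polynomial_term (fun e => c e t)) ->
    (forall l, polynomial_term (fun e => z e l)) -> polynomial_term (fun e => act dd b (c e) (z e) j).
  move=> hc hz; apply: (@polynomial_eq _ (fun e => \sum_(mm : 'X_{1..N < dd})
     c e (enum_rank (j, mm, b)) * \prod_l' z e l' ^+ (mm : 'X_{1..N}) l')).
    by move=> e; rewrite /act coef_polyE.
  apply: polynomial_sum => mm; apply: polynomial_mul; first exact: hc.
  by apply: polynomial_prod => l'; apply: polynomial_exp.
have hyp_def c : (forall t, polynomial_term (fun e => c e t)) -> definable (hyp c).
  move=> hc; apply: definable_and.
    apply: definable_all_in => p; apply: definable_eqf (polynomial_cst 0).
    exact: polynomial_meval.
  apply: definable_not; apply: definable_forall => j; apply: definable_forall => l.
  apply: definable_eqf (polynomial_cst _); apply: (act_term) => // l'; exact: polynomial_cst.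
have cond_def : definable cond.
  apply: definable_and.
    apply: definable_all_in => p; apply: definable_eqf (polynomial_cst 0).
    by apply: polynomial_meval => t; exact: polynomial_var.
  apply: definable_forall => j; apply: definable_forall => l; apply: definable_eqf.
    apply: (act_term) => [t|l1]; first exact: polynomial_var.
    apply: (act_term) => [t|l2]; first exact: polynomial_var.
    by apply: (act_term) => [t|l3]; [exact: polynomial_var | exact: polynomial_cst].
  by apply: (act_term) => [t|?]; [exact: polynomial_var | exact: polynomial_cst].
have hypP c e s : codes (c e) (tr F i s) -> s != 0 -> hyp c e.
  move=> hs s0; split.
    by apply: (hPs _).2; exists (tr F i s) => //; apply/cent_tr_setP; exists s.
  move=> h; move/eqP: s0; apply; apply: pts_free => j; apply: crd_inj => l.
  by rewrite tr0 -h; have [-> _] := hs.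
have hypE c e : hyp c e -> exists s, codes (c e) (tr F i s) /\ s != 0.
  move=> [/hPs[g /cent_tr_setP[s ->] hs] h]; exists s; split=> //.
  apply/eqP => s0; apply: h => j l; have [h1 _] := hs.
  by rewrite /act -h1 s0 tr0.
pose ext (e : seq k) (g : nat -> k) := mkseq (fun t => if (q + q <= t < q + q + qr)%N then g t else e`_t) (maxn (q + q + qr) (size e)).
apply: (@definable_eq _ (fun e => hyp c1 e -> hyp c2 e -> exists g, cond (ext e g))); last first.
  apply: definable_imp; first by apply: (hyp_def) => t; exact: polynomial_var.
  apply: definable_imp; first by apply: (hyp_def) => t; exact: polynomial_var.
  exact: definable_exists.
move=> e.
have ext1 g : c1 (ext e g) =1 c1 e.
  move=> t; have tq := ltn_ord t; rewrite /c1 nth_mkseq; last by rewrite leq_max; apply/orP; left; lia.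
  by rewrite (_ : (q + q <= t)%N = false) //; lia.
have ext2 g : c2 (ext e g) =1 c2 e.
  move=> t; have tq := ltn_ord t; rewrite /c2 nth_mkseq; last by rewrite leq_max; apply/orP; left; lia.
  by rewrite (_ : (q + q <= q + t)%N = false) //; lia.
have actJ l (b : 'I_qr -> k) : codes b (dil F i l) -> forall c s, codes c (tr F i s) -> l != 0 -> forall x j,
    act r true b (act d true c (act r false b (crd^~ x))) j = crd j (tr F i (l * s) x).
  move=> [b1 b2] c s [cs _] l0 x j; rewrite dilJ // !Aut_mulE b1; apply: meval_eq => j'.
  by rewrite cs; apply: meval_eq => j''; rewrite b2.
have act_eq dd b c c' z z' j : c =1 c' -> z =1 z' -> act dd b c z j = act dd b c' z' j.
  by move=> cc' zz'; rewrite /act (coef_poly_eq _ _ cc'); exact: meval_eq.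
split=> [h s s' hs hs' s0 s'0|h h1 h2].
  have [g [hT hact]] := h (hypP _ _ _ hs s0) (hypP _ _ _ hs' s'0).
  have [_ /cent_dil_setP[l l0 ->] hl] := (hTs _).1 hT.
  suff <- : l = s' / s by apply/degree_leP; exists (cb (ext e g)).
  apply: (canRL (mulfK s0)); apply: pts_free => j; apply: crd_inj => j'.
  rewrite -(actJ l (cb (ext e g)) hl (c1 e)) //.
  have [hs1 _] := hs'; rewrite hs1 -[RHS]/(act d true (c2 e) (crd^~ (pts j)) j').
  rewrite -[RHS](act_eq _ _ _ _ _ _ _ (ext2 g) (frefl _)) -hact.
  apply: (act_eq) => // l1; apply: (act_eq) => // t; by rewrite ext1.
have [s [hs s0]] := hypE _ _ h1; have [s' [hs' s'0]] := hypE _ _ h2.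
have /degree_leP[b hb] := h s s' hs hs' s0 s'0.
have l0 : s' / s != 0 by rewrite mulf_neq0 // invr_eq0.
exists (fun t => if insub (t - (q + q))%N is Some t' then b t' else 0).
set g := fun t => _.
have eb : cb (ext e g) =1 b.
  move=> t; have tq := ltn_ord t; rewrite /cb nth_mkseq; last by rewrite leq_max; apply/orP; left; lia.
  rewrite leq_addr ltn_add2l tq /= /g addKn valK //.
split=> [p pTs|j l].
  by apply: (hTs _).2 => //; exists (dil F i (s' / s)); [apply/cent_dil_setP; exists (s' / s) |
    have [b1 b2] := hb; split=> x j; rewrite (coef_poly_eq _ _ eb)].
rewrite (act_eq _ _ _ (c2 e) _ (crd^~ (pts j)) _ (ext2 g)) //.
transitivity (crd l (tr F i (s' / s * s) (pts j))).
  rewrite -(actJ _ b hb (c1 e)) //; apply: (act_eq) => // l1; apply: (act_eq) => // l2.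
  exact: act_eq.
rewrite divfK //; have [hs1 _] := hs'; exact: hs1.
Qed.

End BoundedDilations.

(** * The linear model and its torus *)

Section LinearModel.
Variables (k : closedFieldType) (X : affine_variety k) (n : nat) (F : frame X n).
Hypothesis k_uncountable : ~ countable [set: k]%classic.
Local Notation N := (ambient_dim X).

Definition trs (b : 'I_n -> k) := \big[*%g/1%g]_(i < n) tr F i (b i).
Definition dils (l : 'I_n -> k) := \big[*%g/1%g]_(i < n) dil F i (l i).

Lemma trsD b b' : (trs b * trs b')%g = trs (fun i => b i + b' i).
Proof.
rewrite /trs -prodgM_commute; first by apply: eq_bigr => i _; rewrite trD.
by move=> i j _ _; exact: trC.
Qed.

Lemma trs1 i a : tr F i a = trs (fun j => if j == i then a else 0).
Proof.
rewrite /trs.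
have h (r : seq 'I_n) : uniq r -> \big[*%g/1%g]_(j <- r) tr F j (if j == i then a else 0) =
    if i \in r then tr F i a else 1%g.
  elim: r => [|j r IH] /=; first by rewrite big_nil.
  case/andP=> jr ur; rewrite big_cons IH // inE; case: (eqVneq j i) => [<-|ji].
    by rewrite (negPf jr) mulg1.
  by rewrite tr0 mul1g.
by rewrite h ?mem_index_enum ?index_enum_uniq.
Qed.

Lemma dilsM l l' : (forall i, l i != 0) -> (forall i, l' i != 0) ->
  (dils l * dils l')%g = dils (fun i => l i * l' i).
Proof.
move=> l0 l'0; rewrite /dils -prodgM_commute; first by apply: eq_bigr => i _; rewrite dilM.
by move=> i j _ _; exact: dilC.
Qed.

Lemma dils1 i l : dil F i l = dils (fun j => if j == i then l else 1).
Proof.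
have h (r : seq 'I_n) : uniq r -> \big[*%g/1%g]_(j <- r) dil F j (if j == i then l else 1) =
    if i \in r then dil F i l else 1%g.
  elim: r => [|j r IH] /=; first by rewrite big_nil.
  case/andP=> jr ur; rewrite big_cons IH // inE; case: (eqVneq j i) => [<-|ji].
    by rewrite (negPf jr) mulg1.
  by rewrite dil1 mul1g.
by rewrite /dils h ?mem_index_enum ?index_enum_uniq.
Qed.

Lemma dils_tr l i a : (forall i, l i != 0) -> (dils l * tr F i a)%g = (tr F i (l i * a)%R * dils l)%g.
Proof.
move=> l0; rewrite /dils.
have h (r : seq 'I_n) : uniq r -> (\big[*%g/1%g]_(j <- r) dil F j (l j) * tr F i a)%g =
    (tr F i (if i \in r then (l i * a)%R else a) * \big[*%g/1%g]_(j <- r) dil F j (l j))%g.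
  elim: r => [|j r IH] /=; first by rewrite big_nil mulg1 mul1g.
  case/andP=> jr ur; rewrite big_cons -mulgA IH // inE; case: (eqVneq j i) => [ji|ji].
    by rewrite -ji (negPf jr) /= mulgA dil_tr // mulgA.
  by rewrite mulgA dil_trC // -mulgA.
by rewrite h ?mem_index_enum ?index_enum_uniq.
Qed.

Definition affine_part g := exists b l, (forall i, l i != 0) /\ g = (trs b * dils l)%g.

Lemma affine_part1 : affine_part 1%g.
Proof.
exists (fun=> 0), (fun=> 1); split=> [i|]; first exact: oner_neq0.
by rewrite /trs /dils !big1 ?mulg1 // => i _; rewrite ?tr0 ?dil1.
Qed.

Lemma affine_part_tr g i a : affine_part g -> affine_part (g * tr F i a)%g.
Proof.
move=> [b [l [l0 ->]]]; rewrite -mulgA dils_tr // mulgA trs1 trsD.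
by exists (fun j => b j + (if j == i then l i * a else 0)), l.
Qed.

Lemma affine_part_dil g i l : l != 0 -> affine_part g -> affine_part (g * dil F i l)%g.
Proof.
move=> l0 [b [l' [l'0 ->]]].
have l1 j : (if j == i then l else 1) != 0 by case: ifP => // _; exact: oner_neq0.
rewrite -mulgA dils1 dilsM //; exists b, (fun j => l' j * (if j == i then l else 1)).
by split=> // j; rewrite mulf_neq0.
Qed.

Lemma bounded_affine_part : bounded affine_part.
Proof.
have bdil i : bounded (fun g => exists2 l, l != 0 & g = dil F i l).
  by have [d hd] := bounded_dil F k_uncountable i; exists d => _ [l l0 ->]; exact: hd.
have btr i : bounded (fun g => exists a, g = tr F i a).
  have [d hd] := boundedM (boundedM (bdil i) (bounded1 (tr F i 1))) (boundedV (bdil i)).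
  have [d' hd'] := bounded1 (1%g : Aut X).
  exists (maxn d d') => _ [a ->]; case: (eqVneq a 0) => [->|a0].
    by rewrite tr0; apply: degree_leW (hd' _ erefl); rewrite leq_maxr.
  apply: (@degree_leW _ _ d); rewrite ?leq_maxl //; apply: hd.
  exists (dil F i a * tr F i 1)%g, (dil F i a)^-1%g; split.
  - by exists (dil F i a), (tr F i 1); split=> //; exists a.
  - by exists a; rewrite ?invgK.
  - by rewrite -dilJ // mulr1.
apply: bounded_sub (boundedM (bounded_prod (index_enum 'I_n) btr) (bounded_prod (index_enum 'I_n) bdil)).
move=> _ [b [l [l0 ->]]]; exists (trs b), (dils l); split=> //.
  by exists (fun i => tr F i (b i)) => // i; exists (b i).
by exists (fun i => dil F i (l i)) => // i; exists (l i).
Qed.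

Definition linear_on r (w : 'I_r -> X -> k) (g : X -> X) (A : 'M[k]_r) :=
  forall x j, w j (g x) = \sum_l A j l * w l x.

(** Linear independence of [w], certified by evaluation points. *)
Definition spanning r (w : 'I_r -> X -> k) :=
  exists x : 'I_r -> X, \matrix_(j, i) w j (x i) \in unitmx.

Lemma spanning_inj r (w : 'I_r -> X -> k) (u : 'rV[k]_r) : spanning w ->
  (forall x, \sum_l u 0 l * w l x = 0) -> u = 0.
Proof.
move=> [x ux] hu; rewrite -[u](mulmxK ux) (_ : u *m _ = 0) ?mul0mx //.
apply/rowP => i; rewrite !mxE -[RHS](hu (x i)); apply: eq_bigr => l _.
by rewrite mxE.
Qed.

Lemma linear_on_uniq r (w : 'I_r -> X -> k) g A B : spanning w ->
  linear_on w g A -> linear_on w g B -> A = B.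
Proof.
move=> sw hA hB; apply/row_matrixP => j; apply/eqP; rewrite -subr_eq0; apply/eqP.
apply: (spanning_inj sw) => x; under eq_bigr do rewrite !mxE mulrBl.
by rewrite sumrB -hA -hB subrr.
Qed.

Lemma linear_onM r (w : 'I_r -> X -> k) (g h : X -> X) A B :
  linear_on w g A -> linear_on w h B -> linear_on w (g \o h) (A *m B).
Proof.
move=> hA hB x j; rewrite /= hA.
rewrite (eq_bigr (fun l => \sum_l' A j l * (B l l' * w l' x))); last first.
  by move=> l _; rewrite hB mulr_sumr.
rewrite exchange_big /=; apply: eq_bigr => l _; rewrite mxE mulr_suml.
by apply: eq_bigr => l' _; rewrite mulrA.
Qed.

Lemma linear_on1 r (w : 'I_r -> X -> k) : linear_on w id 1%:M.
Proof.
move=> x j; rewrite (bigD1 j) //= mxE eqxx mul1r big1 ?addr0 // => l lj.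
by rewrite mxE eq_sym (negPf lj) mul0r.
Qed.

(** The transforms of the coordinates under translations and dilations have bounded degree, so they
    span a stable space of finite dimension. A basis of it generates all regular functions because
    the coordinates are among the transforms. *)
Lemma linear_model0 : exists r (w : 'I_r -> X -> k), [/\ coordinates w, spanning w,
  forall i a, exists A, linear_on w (tr F i a) A &
  forall i l, l != 0 -> exists A, linear_on w (dil F i l) A].
Proof.
have [E hE] := bounded_affine_part.
pose phi (m : 'I_#|{: 'X_{1..N < E}}|) (x : X) := \prod_l crd l x ^+ (enum_val m : 'X_{1..N}) l.
pose Fs f := exists j g, affine_part g /\ f = (fun x => crd j (g x)).
have FsM f g : (forall h, affine_part h -> affine_part (h * g)%g) -> Fs f -> Fs (f \o g).
  by move=> hg [j [h [/hg h' ->]]]; exists j, (h * g)%g.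
have [|r [w [x [Fw uw span]]]] := @function_basis k X _ phi Fs.
  move=> _ [j [g [/hE[P [Q [hP _ hd]]] ->]]]; have [sP _] := hd j.
  exists (fun m : 'I_#|{: 'X_{1..N < E}}| => (P j)@_(enum_val m)) => x; rewrite hP {1}(mpolywE sP) raddf_sum /=.
  rewrite (reindex (fun m : 'I_#|{: 'X_{1..N < E}}| => enum_val m)) /=; last first.
    by apply: onW_bij; exact: enum_val_bij.
  by apply: eq_bigr => m _; rewrite mevalZ mevalX.
have lin (g : Aut X) : (forall h, affine_part h -> affine_part (h * g)%g) -> exists A, linear_on w g A.
  move=> hg; have /choice[c hc] j := span _ (FsM _ _ hg (Fw j)).
  by exists (\matrix_(j, l) c j l) => y j; rewrite -[LHS]/((w j \o g) y) hc; apply: eq_bigr => l _; rewrite mxE.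
exists r, w; split.
- split=> [j|f [p hp]].
    by have [l [g [_ ->]]] := Fw j; apply: (regfun_comp g); exact: polyfun_var.
  have /choice[c hc] j : exists c : 'I_r -> k, forall y, crd j y = \sum_l c l * w l y.
    by apply: span; exists j, 1%g; split=> //; exact: affine_part1.
  have [|q hq] := @polyfun_meval k X _ w _ p (fun j => crd j); last by exists q => y; rewrite hp hq.
  move=> j; apply: polyfun_eq (fun y => esym (hc j y)) _.
  by apply: polyfun_sum => l; apply: polyfunZ; exact: polyfun_var.
- exists x; rewrite -unitmx_tr; move: uw; congr (_ \in unitmx).
  by apply/matrixP => a b; rewrite !mxE.
- by move=> i a; apply: lin => h; exact: affine_part_tr.
- by move=> i l l0; apply: lin => h; exact: affine_part_dil.
Qed.

(** The order is invertible in [k], so that ['X^m - 1] is separable; by injectivity of the Frobenius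
    this excludes no root of unity. *)
Definition root_of_unity (z : k) := exists2 m, m%:R != 0 :> k & z ^+ m = 1.

Lemma root_of_unity_neq0 z : root_of_unity z -> z != 0.
Proof.
move=> [m m0 zm]; apply: contraNneq m0 => z0; move: zm; rewrite z0 expr0n.
by case: m => [|m] //= /esym/eqP; rewrite oner_eq0.
Qed.

Lemma linear_model : exists r (w : 'I_r -> X -> k), [/\ coordinates w, spanning w,
  forall i a, exists A, linear_on w (tr F i a) A,
  forall i l, l != 0 -> exists A, linear_on w (dil F i l) A &
  forall i z, root_of_unity z -> exists d : 'I_r -> k, forall x j, w j (dil F i z x) = d j * w j x].
Proof.
have [r [w [cw sw lin_tr lin_dil]]] := linear_model0.
pose Fs A := exists i z, root_of_unity z /\ linear_on w (dil F i z) A.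
have lin_com (g h : Aut X) A B : commute g h -> linear_on w g A -> linear_on w h B -> A *m B = B *m A.
  move=> gh hA hB; apply: (linear_on_uniq sw (linear_onM hA hB)) => x j.
  by rewrite -[LHS]/(w j ((g * h)%g x)) gh; exact: (linear_onM hB hA).
have [||P uP hP] := @codiagonalizable_family k r Fs.
- move=> A B [i [z [hz hA]]] [j [z' [hz' hB]]]; apply: lin_com hA hB.
  by apply: dilC; exact: root_of_unity_neq0.
- move=> A [i [z [hz hA]]]; have z0 := root_of_unity_neq0 hz.
  have [m m0 zm] := hz; exists m => //.
  apply: (linear_on_uniq sw _ (linear_on1 w)).
  have -> : id = dil F i (z ^+ m) by rewrite zm dil1.
  elim: (m) => [|m' IH] /=; first by rewrite expr0 dil1; exact: linear_on1.
  by rewrite exprS dilM ?expf_neq0 //; exact: (linear_onM hA IH).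
pose w' (j : 'I_r) x := \sum_l P j l * w l x.
have wE x j : w j x = \sum_l (invmx P) j l * w' l x.
  have := linear_on1 w x j; rewrite -(mulVmx uP) => {1}->.
  rewrite (eq_bigr (fun l => \sum_l' invmx P j l' * P l' l * w l x)); last first.
    by move=> l _; rewrite mxE mulr_suml.
  rewrite exchange_big /=; apply: eq_bigr => l _; rewrite mulr_sumr.
  by apply: eq_bigr => l' _; rewrite mulrA.
have lin' g A : linear_on w g A -> linear_on w' g (P *m A *m invmx P).
  move=> hA x j; rewrite -[LHS]/(\sum_l P j l * w l (g x)).
  transitivity (\sum_l (P *m A) j l * w l x).
    rewrite (eq_bigr (fun l => \sum_l' P j l * (A l l' * w l' x))); last first.
      by move=> l _; rewrite hA mulr_sumr.
    rewrite exchange_big /=; apply: eq_bigr => l _; rewrite mxE mulr_suml.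
    by apply: eq_bigr => l' _; rewrite mulrA.
  rewrite (eq_bigr (fun l => \sum_l' (P *m A) j l * (invmx P l l' * w' l' x))); last first.
    by move=> l _; rewrite wE mulr_sumr.
  rewrite exchange_big /=; apply: eq_bigr => l _; rewrite [X in _ = X * _]mxE mulr_suml.
  by apply: eq_bigr => l' _; rewrite mulrA.
exists r, w'; split.
- have [wr wg] := cw; split=> [j|f [p hp]].
    by apply: polyfun_sum => l; apply: polyfunZ.
  have /choice[c hc] j := wg _ (polyfun_var crd j).
  have [|q hq] := @polyfun_meval k X _ w' _ p (fun j => crd j); last by exists q => y; rewrite hp hq.
  move=> j; apply: polyfun_eq (fun y => esym (hc j y)) _.
  apply: polyfun_meval => l; apply: polyfun_eq (fun y => esym (wE y l)) _.
  by apply: polyfun_sum => l'; apply: polyfunZ; exact: polyfun_var.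
- have [x ux] := sw; exists x.
  have -> : \matrix_(j, i) w' j (x i) = P *m \matrix_(j, i) w j (x i).
    by apply/matrixP => a b; rewrite !mxE; apply: eq_bigr => l _; rewrite mxE.
  by rewrite unitmx_mul uP.
- by move=> i a; have [A /lin' hA] := lin_tr i a; exists (P *m A *m invmx P).
- by move=> i l /(lin_dil i)[A /lin' hA]; exists (P *m A *m invmx P).
move=> i z hz; have [A hA] := lin_dil i z (root_of_unity_neq0 hz).
have [|d hd] := hP A; first by exists i, z.
exists (d 0) => x j; rewrite (lin' _ _ hA) hd mulmxK //.
rewrite (bigD1 j) //= mxE eqxx mulr1n big1 ?addr0 // => l lj.
by rewrite mxE eq_sym (negPf lj) mulr0n mul0r.
Qed.

End LinearModel.

(** * Roots of unity and the algebraic torus *)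

Section RootsOfUnity.
Variable k : closedFieldType.

Lemma root_of_unity_order (z : k) m : (0 < m)%N -> z ^+ m = 1 -> root_of_unity z.
Proof.
elim/ltn_ind: m => m IH m0 zm; have [mk|mk] := boolP (m%:R == 0 :> k); last by exists m.
have [p pk] := natf0_pchar m0 mk; rewrite -(dvdn_pcharf pk) in mk.
have p1 := prime_gt1 (pcharf_prime pk).
have [m1 e] := dvdnP mk; have m10 : (0 < m1)%N by case: m1 e m0 => // ->.
apply: (IH m1) => //; first by rewrite e ltn_Pmulr.
apply: (fmorph_inj (pFrobenius_aut pk)).
by rewrite rmorph1 /= pFrobenius_autE -exprM -e.
Qed.

Lemma root_of_unityM (z z' : k) : root_of_unity z -> root_of_unity z' -> root_of_unity (z * z').
Proof.
move=> [m m0 zm] [m' m'0 zm']; exists (m * m')%N; first by rewrite natrM mulf_neq0.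
by rewrite exprMn exprM zm expr1n mulnC exprM zm' expr1n mul1r.
Qed.

Lemma root_of_unity1 : root_of_unity (1 : k).
Proof. by exists 1%N; rewrite ?expr1n ?oner_neq0. Qed.

Lemma root_of_unityX (z : k) m : root_of_unity z -> root_of_unity (z ^+ m).
Proof. by case=> l l0 zl; exists l => //; rewrite exprAC zl expr1n. Qed.

Lemma closed_root (z : k) m : (0 < m)%N -> exists y, y ^+ m = z.
Proof.
move=> m0; have [|y] := @closed_rootP k ('X^m - z%:P) _.
  by rewrite size_XnsubC // eqSS -lt0n.
by rewrite rootE !hornerE subr_eq0 => /eqP; exists y.
Qed.

Lemma root_of_unity_root (z : k) m : (0 < m)%N -> root_of_unity z ->
  exists2 y, root_of_unity y & y ^+ m = z.
Proof.
move=> m0 [l l0 zl]; have [y ym] := closed_root z m0; exists y => //.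
apply: (@root_of_unity_order _ (m * l)); last by rewrite exprM ym.
by rewrite muln_gt0 m0 lt0n; apply: contraNneq l0 => ->.
Qed.

Lemma root_of_unity_neq1 : exists2 z : k, root_of_unity z & z != 1.
Proof.
have [e2|e2] := eqVneq (2%:R : k) 0; last first.
  exists (-1); first by exists 2%N; rewrite // sqrrN expr1n.
  by apply: contraNneq e2 => e; rewrite mulr2n -{1}e addNr.
have /closed_rootP[z] : size ('X^2 + 'X + 1 : {poly k}) != 1%N.
  by rewrite -addrA size_polyDl ?size_polyXn // -polyC1 size_XaddC.
rewrite rootE !hornerE => /eqP ez; exists z.
  apply: (@root_of_unity_order _ 3) => //; apply/eqP; rewrite -subr_eq0.
  have -> : z ^+ 3 - 1 = (z - 1) * (z ^+ 2 + z + 1) by ring.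
  by rewrite ez mulr0.
apply/eqP => z1; move/eqP: ez; rewrite z1 expr1n.
by rewrite -[1 + 1]/(2%:R) e2 add0r oner_eq0.
Qed.

End RootsOfUnity.

Section Twist.
Variables (k : closedFieldType) (X G : Type) (mul : G -> G -> G) (one : G) (act : G -> X -> X).
Variables (r : nat) (w : 'I_r -> X -> k) (chi : 'I_r -> G -> k).
Hypothesis chi1 : forall j, chi j one = 1.
Hypothesis chiM : forall j g h, chi j (mul g h) = chi j g * chi j h.
Hypothesis w_act : forall j g x, w j (act g x) = chi j g * w j x.

Definition monomial_char (m : 'X_{1..r}) g := \prod_j chi j g ^+ m j.

Lemma monomial_act (m : 'X_{1..r}) g x :
  \prod_j w j (act g x) ^+ m j = monomial_char m g * \prod_j w j x ^+ m j.
Proof. by rewrite -big_split; apply: eq_bigr => j _; rewrite w_act exprMn. Qed.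

(** A relation along a whole orbit is a relation between monomial characters; by independence it
    survives when each character is replaced by an arbitrary function [W] of it. Choices of [W] will
    give the torus, the homogeneous components and the torus-fixed point. *)
Lemma twist (p : {mpoly k[r]}) x (W : (G -> k) -> k) : (forall g, p.@[w^~ (act g x)] = 0) ->
  \sum_(m <- msupp p) p@_m * \prod_j w j x ^+ m j * W (monomial_char m) = 0.
Proof.
move=> p0; apply: (artin (mul := mul) (one := one) (chi := monomial_char)) => [m|g].
  split=> [|g h]; first by rewrite /monomial_char big1 // => j _; rewrite chi1 expr1n.
  by rewrite /monomial_char -big_split; apply: eq_bigr => j _; rewrite chiM exprMn.
rewrite -[RHS](p0 g) mevalE; apply: eq_bigr => m _.
by rewrite monomial_act [monomial_char m g * _]mulrC mulrA.
Qed.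

End Twist.

Lemma factor_through (k : Type) (I J : Type) (k0 : k) (chi : I -> J) (e : I -> k) :
  (forall i j, chi i = chi j -> e i = e j) -> exists W : J -> k, forall i, W (chi i) = e i.
Proof.
move=> h; have /choice[W hW] (f : J) : exists y, forall i, chi i = f -> e i = y.
  have [[i <-]|none] := pselect (exists i, chi i = f); first by exists (e i) => j /h.
  by exists k0 => i hi; case: none; exists i.
by exists W => i; rewrite -(hW _ i).
Qed.

Lemma exprz_prod (k : fieldType) (I : Type) (s : seq I) (f : I -> k) (c : int) :
  (\prod_(i <- s) f i) ^ c = \prod_(i <- s) f i ^ c.
Proof. by apply: (big_morph (fun x => x ^ c)) => [x y|]; rewrite ?expfzMl ?exp1rz. Qed.

Section Torus.
Variables (k : closedFieldType) (X : affine_variety k) (n : nat) (F : frame X n).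
Variables (r : nat) (w : 'I_r -> X -> k).
Hypotheses (cw : coordinates w) (sw : spanning w).
Hypothesis lin_tr : forall i a, exists A, linear_on w (tr F i a) A.
Hypothesis lin_dil : forall i l, l != 0 -> exists A, linear_on w (dil F i l) A.
Hypothesis diag : forall i z, root_of_unity z ->
  exists d : 'I_r -> k, forall x j, w j (dil F i z x) = d j * w j x.

Lemma spanning_neq0 j : exists x, w j x != 0.
Proof.
apply: contrapT => none; have h0 : (forall x, \sum_l (delta_mx 0 j : 'rV[k]_r) 0 l * w l x = 0).
  move=> x; rewrite big1 // => l _; rewrite mxE eqxx /=; case: eqVneq => [->|]; rewrite ?mul0r //.
  by apply/eqP; rewrite mul1r; apply: contrapT => /negP h; apply: none; exists x.
by move: (spanning_inj sw h0) => /matrixP/(_ 0 j)/eqP; rewrite !mxE !eqxx oner_eq0.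
Qed.

(** Eigenvalues [d z j] are available only for roots of unity [z]. Their multiplicative relations
    form a saturated lattice [L], and a vector [h] orthogonal to [L] defines diagonal maps
    preserving the equations of [X]. These commute with the linear automorphisms that commute with
    the roots of unity, so [cent_dil1] places them among the dilations. *)
Lemma torus i : exists (h : 'I_r -> int) (lam : k -> k), (exists j, h j != 0) /\
  forall c, c != 0 -> lam c != 0 /\ forall x j, w j (dil F i (lam c) x) = c ^ h j * w j x.
Proof.
have /choice[d hd] (z : k) : exists d : 'I_r -> k,
    root_of_unity z -> forall x j, w j (dil F i z x) = d j * w j x.
  have [hz|nz] := pselect (root_of_unity z); last by exists (fun=> 0).
  by have [d hd] := diag i hz; exists d.
have d1 j : d 1 j = 1.
  have [x wx] := spanning_neq0 j; apply: (mulIf wx).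
  by rewrite -hd ?dil1 ?mul1r //; exact: root_of_unity1.
have dM j z z' : root_of_unity z -> root_of_unity z' -> d (z * z') j = d z j * d z' j.
  move=> hz hz'; have [x wx] := spanning_neq0 j; apply: (mulIf wx).
  rewrite -hd; last exact: root_of_unityM.
  by rewrite dilM ?root_of_unity_neq0 // Aut_mulE !hd // mulrA.
have dX j z m : root_of_unity z -> d (z ^+ m) j = d z j ^+ m.
  move=> hz; elim: m => [|m IH]; rewrite ?expr0 ?d1 // !exprS dM ?IH //.
  exact: root_of_unityX.
have d0 j z : root_of_unity z -> d z j != 0.
  move=> hz; have [m m0 zm] := hz; apply: contraNneq m0 => dz.
  have := dX j z m hz; rewrite zm d1 dz; case: (m) => [|m'] //.
  by rewrite expr0n => /eqP; rewrite oner_eq0.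
pose L (a : 'I_r -> int) := forall z, root_of_unity z -> \prod_j d z j ^ a j = 1.
have [j0 hj0] : exists j, ~ L (fun l => (l == j)%:R).
  apply: contrapT => none; have [z hz z1] := root_of_unity_neq1 k.
  move/eqP: z1; apply; have dz j : d z j = 1.
    have := contrapT (fun h => none (ex_intro _ j h)) => /(_ z hz).
    by rewrite (bigD1 j) //= eqxx expr1z big1 ?mulr1 // => l /negPf ->; rewrite expr0z.
  have e : dil F i z = 1%g.
    by apply: Aut_eq => x; apply: (coordinates_inj cw) => j; rewrite hd // dz mul1r.
  have := dil_tr F i 1 (root_of_unity_neq0 hz).
  by rewrite e mul1g mulg1 mulr1 => /tr_inj.
have [||||h [hn hL]] := @saturated_orthogonal r L (fun l => (l == j0)%:R).
- by move=> z _; rewrite big1 // => j _; rewrite expr0z.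
- move=> c a b La Lb z hz.
  rewrite (eq_bigr (fun j => (d z j ^ a j) ^ c * d z j ^ b j)) => [|j _].
    by rewrite big_split /= -exprz_prod La // exp1rz mul1r Lb.
  by rewrite exprz_exp -expfzDr ?d0 // mulrC.
(* Saturation comes from divisibility of the group of roots of unity. *)
- move=> c a c0 La z hz.
  have [|z' hz' zz'] := @root_of_unity_root _ z `|c|%N _ hz; first by rewrite absz_gt0.
  have e : (\prod_j d z' j ^ a j) ^ c = 1.
    by rewrite exprz_prod -[RHS](La z' hz'); apply: eq_bigr => j _; rewrite exprz_exp mulrC.
  rewrite -zz' (eq_bigr (fun j => (d z' j ^ a j) ^ `|c|%N)) => [|j _].
    rewrite -exprz_prod; case: (intP c) e => [|m|m]; rewrite ?expr0z //.
    by rewrite abszN -invr_expz => /(congr1 (@GRing.inv k)); rewrite invrK invr1.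
  by rewrite dX // exprnP !exprz_exp mulrC.
- exact: hj0.
pose U := {z : k | root_of_unity z}.
pose mulU (z z' : U) : U := exist _ (sval z * sval z') (root_of_unityM (svalP z) (svalP z')).
pose oneU : U := exist _ 1 (root_of_unity1 k).
pose chi j (z : U) := d (sval z) j.
(* Orthogonality to [L] makes the exponent a function of the character of [m], as [twist]
   requires. *)
have hchi (m m' : 'X_{1..r}) : monomial_char chi m = monomial_char chi m' ->
    \sum_j h j * (m j)%:Z = \sum_j h j * (m' j)%:Z.
  move=> e; apply/eqP; rewrite -subr_eq0 -sumrB; apply/eqP.
  rewrite -[RHS](hL (fun j => (m j)%:Z - (m' j)%:Z)).
    by apply: eq_bigr => j _; rewrite mulrBr.
  move=> z hz; have := congr1 (fun f => f (exist _ z hz)) e; rewrite /monomial_char /chi /= => ez.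
  rewrite (eq_bigr (fun j => d z j ^+ m j / d z j ^+ m' j)) => [|j _].
    rewrite prodf_div ez divff //; apply/prodf_neq0 => j _.
    by rewrite expf_neq0 // d0.
  by rewrite expfzDr ?d0 // -invr_expz.
have twisted (c : k) : c != 0 -> exists psi : X -> X, forall x j, w j (psi x) = c ^ h j * w j x.
  move=> c0; suff /choice[psi hpsi] : forall x, exists y, forall j, w j y = c ^ h j * w j x by exists psi.
  move=> x; apply: (coordinates_closed cw) => p p0.
  have [|W hW] := @factor_through k _ _ 0 (monomial_char chi) (fun m => c ^ (\sum_j h j * (m j)%:Z)).
    by move=> m m' /hchi ->.
  have := @twist k X U mulU oneU (fun z => dil F i (sval z)) r w chi _ _ _ p x W.
  move=> tw; rewrite -[RHS]tw; last first.
  - by move=> z; exact: p0.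
  - by move=> j z y; rewrite hd //; exact: (svalP z).
  - by move=> j z z'; apply: dM; exact: svalP.
  - by move=> j; exact: d1.
  rewrite mevalE; apply: eq_bigr => m _; rewrite hW -mulrA; congr (_ * _).
  rewrite (big_morph (fun e => c ^ e) (fun a b => expfzDr a b c0) (expr0z c)) -big_split; apply: eq_bigr => j _.
  by rewrite exprMn mulrC [(c ^ h j) ^+ _]exprnP exprz_exp.
have twistedA (c : k) : c != 0 -> exists psi : Aut X, forall x j, w j (psi x) = c ^ h j * w j x.
  move=> c0; have [g hg] := twisted c c0; have [|g' hg'] := twisted c^-1; first by rewrite invr_eq0.
  have [wr _] := cw.
  have [||||a ha] := @Aut_of _ _ _ w g g' cw.
  - by move=> j; apply: polyfun_eq (polyfunZ (c ^ h j) (wr j)) => x; rewrite -hg.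
  - by move=> j; apply: polyfun_eq (polyfunZ (c^-1 ^ h j) (wr j)) => x; rewrite -hg'.
  - move=> x; apply: (coordinates_inj cw) => j.
    by rewrite hg' hg mulrA -expfzMl mulVf // exp1rz mul1r.
  - move=> x; apply: (coordinates_inj cw) => j.
    by rewrite hg hg' mulrA -expfzMl mulfV // exp1rz mul1r.
  by exists a => x j; rewrite ha.
have com (c : k) (psi g : Aut X) A : (forall x j, w j (psi x) = c ^ h j * w j x) ->
    linear_on w g A -> (forall z, root_of_unity z -> commute g (dil F i z)) -> commute psi g.
  (* A nonzero entry [A j l] forces [w j] and [w l] to have the same character on roots of unity,
     hence the same exponent. *)
  move=> hpsi hA gcom; have hAh j l : A j l != 0 -> h j = h l.
    move=> Ajl; have Lj : L (fun a => (a == j)%:R - (a == l)%:R).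
      move=> z hz.
      have D1 : linear_on w (dil F i z) (diag_mx (\row_j d z j)).
        move=> x j'; rewrite hd // (bigD1 j') //= !mxE eqxx mulr1n big1 ?addr0 // => l' lj.
        by rewrite !mxE eq_sym (negPf lj) mulr0n mul0r.
      have /matrixP/(_ j l) : A *m diag_mx (\row_j d z j) = diag_mx (\row_j d z j) *m A.
        apply: (linear_on_uniq sw (linear_onM hA D1)) => x j'.
        by rewrite -[LHS]/(w j' ((g * dil F i z)%g x)) gcom //; exact: (linear_onM D1 hA).
      rewrite mul_mx_diag mul_diag_mx !mxE [RHS]mulrC => /(mulfI Ajl) e.
      rewrite (eq_bigr (fun a => d z a ^ (a == j)%:R / d z a ^ (a == l)%:R)) => [|a _].
        rewrite prodf_div (bigD1 j) //= eqxx big1 ?mulr1 => [|a /negPf ->]; last by rewrite expr0z.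
        rewrite (bigD1 l) //= eqxx big1 ?mulr1 => [|a /negPf ->]; last by rewrite expr0z.
        by rewrite e divff // expfz_neq0 // d0.
      by rewrite expfzDr ?d0 // -invr_expz.
    have := hL _ Lj; under eq_bigr do rewrite mulrBr.
    rewrite sumrB (bigD1 j) //= eqxx mulr1 big1 ?addr0 => [|a /negPf ->]; last by rewrite mulr0.
    rewrite (bigD1 l) //= eqxx mulr1 big1 ?addr0 => [|a /negPf ->]; last by rewrite mulr0.
    by move=> /eqP; rewrite subr_eq0 => /eqP.
  apply: Aut_eq => x; apply: (coordinates_inj cw) => j; rewrite !Aut_mulE hpsi !hA mulr_sumr.
  apply: eq_bigr => l _; rewrite hpsi; have [->|/hAh ->] := eqVneq (A j l) 0; first by rewrite !mul0r mulr0.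
  by rewrite mulrCA.
have /choice[lam hlam] (c : k) : exists l, c != 0 -> l != 0 /\ forall x j, w j (dil F i l x) = c ^ h j * w j x.
  have [->|c0] := eqVneq c 0; first by exists 0.
  have [psi hpsi] := twistedA c c0.
  have [||l l0 e] := @cent_dil1 _ _ _ F i psi.
  - move=> j a ji; have [A hA] := lin_tr j a; apply: com hpsi hA _ => z hz.
    by apply/commute_sym; apply: dil_trC; [rewrite eq_sym | exact: root_of_unity_neq0].
  - move=> j l l0; have [A hA] := lin_dil j l0; apply: com hpsi hA _ => z hz.
    by apply: dilC; rewrite // root_of_unity_neq0.
  by exists l => _; rewrite -e.
by exists h, lam; split.
Qed.

End Torus.

(** * Parametrization of the translations *)

Section AdditiveCoefficient.
Variable k : closedFieldType.

(** In characteristic p, [eta a ^+ p] is [eta (a *+ p)], hence 1, and the Frobenius is injective. In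
    characteristic 0 all values have order at most [size q], and [a] is divisible by the factorial
    of [size q]. *)
Lemma finite_image_character (eta : k -> k) (q : {poly k}) : q != 0 ->
  eta 0 = 1 -> (forall a b, eta (a + b) = eta a * eta b) -> (forall a, root q (eta a)) ->
  forall a, eta a = 1.
Proof.
move=> q0 eta0 etaD qeta a.
have etaMn b m : eta (b *+ m) = eta b ^+ m.
  by elim: m => [|m IH]; rewrite ?expr0 // mulrS exprS etaD IH.
have [[p pk]|pk] := pselect (exists p, p \in [pchar k]).
  apply: (fmorph_inj (pFrobenius_aut pk)).
  by rewrite rmorph1 /= pFrobenius_autE -etaMn mulrn_pchar.
have nat0 m : (0 < m)%N -> m%:R != 0 :> k.
  by move=> m0; apply/negP => mk; apply: pk; have [p] := natf0_pchar m0 mk; exists p.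
have fin b : exists2 m, (0 < m <= size q)%N & eta b ^+ m = 1.
  have : ~~ uniq [seq eta b ^+ j | j <- iota 0 (size q)].
    apply/negP => u; have := max_poly_roots q0 _ u; rewrite size_map size_iota ltnn.
    by case/(_ _)/notF; apply/allP => _ /mapP[j _ ->]; rewrite -etaMn.
  have eb0 : eta b != 0.
    by apply/eqP => e; have := etaD b (- b); rewrite subrr eta0 e mul0r => /eqP; rewrite oner_eq0.
  case/(uniqPn 0) => i [j [ij]]; rewrite size_map size_iota => js.
  rewrite !(nth_map 0%N) ?size_iota ?(ltn_trans ij) // !nth_iota ?(ltn_trans ij) // !add0n => e.
  exists (j - i)%N; first by rewrite subn_gt0 ij (leq_trans (leq_subr _ _) (ltnW js)).
  by apply: (mulfI (expf_neq0 i eb0)); rewrite -exprD subnKC ?mulr1 // ltnW.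
have [m /andP[m0 ms] em] := fin (a / (size q)`!%:R).
have sq0 := nat0 _ (fact_gt0 (size q)).
rewrite -[a](divfK sq0) mulr_natr etaMn.
have /dvdnP[c e] : (m %| (size q)`!)%N by apply: dvdn_fact; rewrite m0.
by rewrite [X in _ ^+ X]e mulnC exprM em expr1n.
Qed.

(** A common eigenvector of [N] modulo the fixed vectors [U0] has trivial character, so some [u]
    outside [U0] has all its displacements [de a] in [U0]; these are then additive in [a]. Choosing
    [u], and after it the functional [v], as eigenvectors of the dilations modulo [U0] and modulo
    the annihilator [K] gives semi-invariance. *)
Lemma additive_coefficient r (N T : k -> 'M[k]_r) :
  N 0 = 1%:M -> (forall a b, N (a + b) = N a *m N b) -> N 1 <> 1%:M ->
  T 1 = 1%:M -> (forall l m, l != 0 -> m != 0 -> T (l * m) = T l *m T m) ->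
  (forall l a, l != 0 -> T l *m N a = N (l * a) *m T l) ->
  exists (u : 'rV_r) (v : 'cV_r), let al a := ((u *m N a - u) *m v) 0 0 in
    [/\ forall a b, al (a + b) = al a + al b, exists a, al a != 0 &
      forall l, l != 0 -> exists c, forall a, al (l * a) = c * al a].
Proof.
move=> N0 ND N1 T1 TM TN.
have NC a b : N a *m N b = N b *m N a by rewrite -!ND addrC.
have TC l m : l != 0 -> m != 0 -> T l *m T m = T m *m T l by move=> l0 m0; rewrite -!TM // mulrC.
have TK l : l != 0 -> T l *m T l^-1 = 1%:M by move=> l0; rewrite -TM ?invr_eq0 // mulfV.
have TK' l : l != 0 -> T l^-1 *m T l = 1%:M by move=> l0; rewrite -TM ?invr_eq0 // mulVf.
have [U0 hU0] : exists U0 : 'M[k]_r, forall u : 'rV_r, (u <= U0)%MS <-> forall a, u *m N a = u.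
  apply: (@subspace_mx k r (fun u => forall a, u *m N a = u)) => [a|c u v hu hv a].
    by rewrite mul0mx.
  by rewrite mulmxDl -scalemxAl hu hv.
have U0N (u : 'rV_r) a : (u <= U0)%MS -> u *m N a = u by move=> /hU0 ->.
have nU0 : ~~ (1%:M <= U0)%MS.
  apply/negP => h; apply: N1; apply/row_matrixP => j.
  by rewrite -[N 1]mul1mx row_mul U0N // (submx_trans (row_sub _ _) h).
have U0T (u : 'rV_r) l : l != 0 -> (u <= U0)%MS -> (u *m T l <= U0)%MS.
  move=> l0 hu; apply/hU0 => a; rewrite -mulmxA TN // mulmxA; congr (_ *m _).
  exact: U0N.
have subU0 (u v : 'rV_r) : (u <= U0)%MS -> (v <= U0)%MS -> (u - v <= U0)%MS.
  by move=> hu hv; rewrite addmx_sub // eqmx_opp.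
have [u0 [_ u0U0 /(_ _ (ex_intro _ _ erefl))hu0]] :
    exists u0 : 'rV_r, [/\ (u0 <= (1%:M : 'M_r))%MS, ~~ (u0 <= U0)%MS &
      forall F, (exists a, F = N a) -> exists l, (u0 *m F - l *: u0 <= U0)%MS].
  apply: common_eigenvector_mod => //; rewrite ?submx1 //.
  - by move=> _ _ [a ->] [b ->].
  - by move=> _ [a ->]; apply/row_subP => j; rewrite row_mul U0N ?row_sub.
  - by move=> *; rewrite submx1.
have /choice[eta heta] := hu0.
have scal (u : 'rV_r) c c' : ~~ (u <= U0)%MS -> (c *: u - c' *: u <= U0)%MS -> c = c'.
  move=> uU0; rewrite -scalerBl => h; apply/eqP; rewrite -subr_eq0; apply: contraNT uU0 => cc.
  by rewrite (eqmx_scale u cc) in h.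
have eta1 : forall a, eta a = 1.
  have eta0 : eta 0 = 1.
    by apply/esym; apply: (scal u0 _ _ u0U0); rewrite scale1r -{1}[u0]mulmx1 -N0.
  (* Unless [N a] fixes [u0], the displacement of [u0] multiplied by [T a] is an eigenvector of
     [N 1]; so [eta a] is 1 or an eigenvalue of [N 1]. *)
  apply: (@finite_image_character eta (char_poly (N 1) * ('X - 1%:P))) => //.
  - by rewrite mulf_neq0 ?polyXsubC_eq0 // monic_neq0 // char_poly_monic.
  - move=> a b; apply: (scal u0 _ _ u0U0).
    have -> : eta (a + b) *: u0 - (eta a * eta b) *: u0 =
        ((u0 *m N a - eta a *: u0) *m N b + eta a *: (u0 *m N b - eta b *: u0))
        - (u0 *m N (a + b) - eta (a + b) *: u0).
      rewrite ND mulmxBl -scalemxAl scalerBr scalerA mulmxA.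
      by move: (u0 *m N a *m N b) (u0 *m N b) => A B; apply/rowP => j; rewrite !mxE; ring.
    by rewrite subU0 // addmx_sub ?scalemx_sub // U0N.
  move=> a; rewrite rootM; have [->|a0] := eqVneq a 0.
    by rewrite eta0 orbC root_XsubC eqxx.
  have ha := heta a.
  have [e|ne] := eqVneq (u0 *m N a - u0) 0.
    rewrite orbC root_XsubC; apply/orP; left; apply/eqP/esym; apply: (scal u0 _ _ u0U0).
    by move/eqP: e; rewrite subr_eq0 scale1r => /eqP e; rewrite -{1}e.
  apply/orP; left; rewrite -eigenvalue_root_char; apply/eigenvalueP.
  exists ((u0 *m N a - u0) *m T a).
    rewrite -mulmxA TN // mulr1 mulmxA scalemxAl; congr (_ *m _).
    have := U0N _ a ha; rewrite !mulmxBl -scalemxAl => /eqP; rewrite -subr_eq0 => /eqP e.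
    apply/eqP; rewrite -subr_eq0 -{}e scalerBr; apply/eqP.
    by move: (u0 *m N a *m N a) (u0 *m N a) => A B; apply/rowP => j; rewrite !mxE; ring.
  apply: contra ne => /eqP e.
  by rewrite -[_ - _]mulmx1 -(TK a) // mulmxA e mul0mx.
have [U1 hU1] : exists U1 : 'M[k]_r, forall u : 'rV_r, (u <= U1)%MS <-> forall a, (u *m N a - u <= U0)%MS.
  apply: (@subspace_mx k r (fun u => forall a, (u *m N a - u <= U0)%MS)) => [a|c u v hu hv a].
    by rewrite mul0mx subrr sub0mx.
  rewrite mulmxDl -scalemxAl opprD addrACA -scalerBr addmx_sub //.
  by rewrite scalemx_sub.
have U01 : (U0 <= U1)%MS.
  by apply/row_subP => j; apply/hU1 => a; rewrite U0N ?row_sub // subrr sub0mx.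
have nU10 : ~~ (U1 <= U0)%MS.
  apply: contra u0U0; apply: submx_trans; apply/hU1 => a.
  by have := heta a; rewrite eta1 scale1r.
have [u [uU1 uU0 hu]] : exists u : 'rV_r, [/\ (u <= U1)%MS, ~~ (u <= U0)%MS &
    forall F, (exists2 l, l != 0 & F = T l) -> exists l, (u *m F - l *: u <= U0)%MS].
  apply: common_eigenvector_mod => //.
  - by move=> _ _ [l l0 ->] [m m0 ->]; exact: TC.
  - by move=> _ [l l0 ->]; apply/row_subP => j; rewrite row_mul U0T ?row_sub.
  move=> _ [l l0 ->]; apply/row_subP => j; rewrite row_mul; apply/hU1 => a.
  rewrite -mulmxA TN // mulmxA -mulmxBl; apply: U0T => //.
  by move/hU1: (row_sub j U1); apply.
pose de a := u *m N a - u.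
have deU0 a : (de a <= U0)%MS by move/hU1: uU1; apply.
have deD a b : de (a + b) = de a + de b.
  by rewrite -[de a](U0N _ b) // /de ND mulmxBl mulmxA addrA subrK.
have [K hK] : exists K : 'M[k]_r, forall v : 'rV_r, (v <= K)%MS <-> forall a, de a *m v^T = 0.
  apply: (@subspace_mx k r (fun v => forall a, de a *m v^T = 0)) => [a|c v v' hv hv' a].
    by rewrite trmx0 mulmx0.
  by rewrite linearD linearZ /= mulmxDr -scalemxAr hv hv' scaler0 addr0.
have deT l a c : l != 0 -> (u *m T l - c *: u <= U0)%MS -> de (l * a) *m T l = c *: de a.
  move=> l0 h; have := U0N _ a h; rewrite /de !mulmxBl -[u *m N (l * a) *m _]mulmxA -TN // mulmxA -scalemxAl scalerBr.
  move: (u *m T l *m N a) (u *m T l) (u *m N a) => A B C e.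
  apply/rowP => j; have := congr1 (fun M : 'rV_r => M 0 j) e; rewrite !mxE => /eqP.
  rewrite -subr_eq0 => {}e; apply/eqP; rewrite -subr_eq0; move: e; congr (is_true (_ == 0)); ring.
have [v [_ vK hv]] : exists v : 'rV_r, [/\ (v <= (1%:M : 'M_r))%MS, ~~ (v <= K)%MS &
    forall F, (exists2 l, l != 0 & F = (T l)^T) -> exists l, (v *m F - l *: v <= K)%MS].
  apply: common_eigenvector_mod; rewrite ?submx1 //.
  - by move=> _ _ [l l0 ->] [m m0 ->]; rewrite -!trmx_mul TC.
  - move=> _ [l l0 ->]; apply/row_subP => j; rewrite row_mul; apply/hK => a.
    have [c hc] := hu _ (ex_intro2 _ _ l l0 erefl).
    rewrite trmx_mul trmxK mulmxA -(mulVKf l0 a) (deT _ _ _ l0 hc) -scalemxAl.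
    by move/hK: (row_sub j K) => ->; rewrite scaler0.
  - by move=> *; rewrite submx1.
  apply/negP => h1K; move/negP: uU0; apply; apply/hU0 => a; apply/eqP.
  rewrite -subr_eq0 -/(de a); apply/eqP/rowP => j; rewrite [RHS]mxE.
  have /hK/(_ a)/matrixP/(_ 0 0) := submx_trans (row_sub j 1%:M) h1K.
  rewrite [RHS]mxE => e; rewrite -[RHS]e [RHS]mxE (bigD1 j) //= [X in _ * X]mxE row1 [X in _ * X]mxE !eqxx mulr1 big1 ?addr0 // => l lj.
  by rewrite [X in _ * X]mxE [X in _ * X]mxE (negPf lj) andbF mulr0.
exists u, v^T => al.
have al0 : exists a, al a != 0.
  apply: contrapT => none; move/negP: vK; apply; apply/hK => a; apply/matrixP => i j; rewrite !ord1 [RHS]mxE.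
  by apply: contrapT => /eqP h; apply: none; exists a.
split=> // [a b|l l0]; first by rewrite /al -!/(de _) deD mulmxDl [LHS]mxE.
have [c hc] := hu _ (ex_intro2 _ _ l l0 erefl).
have [th hth] := hv _ (ex_intro2 _ _ l l0 erefl).
have e a : th * al (l * a) = c * al a.
  move/hK: hth => /(_ (l * a))/eqP; rewrite linearB linearZ /= trmx_mul trmxK mulmxBr mulmxA.
  rewrite (deT _ _ _ l0 hc) subr_eq0 -scalemxAr -scalemxAl => /eqP/matrixP/(_ 0 0).
  by rewrite [LHS]mxE [RHS]mxE => <-.
have c0 : c != 0.
  apply: contraNneq uU0 => c0; rewrite -[u]mulmx1 -(TK l) // mulmxA U0T ?invr_eq0 //.
  by move: hc; rewrite c0 scale0r subr0.
have th0 : th != 0.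
  have [a ha] := al0; apply: contraTneq (mulf_neq0 c0 ha) => th0.
  by rewrite -e th0 mul0r eqxx.
by exists (c / th) => a; apply: (mulfI th0); rewrite e mulrA [th * _]mulrC divfK.
Qed.

End AdditiveCoefficient.

Section ClosedField.
Variable k : closedFieldType.

Lemma poly_eq_off (z p q : {poly k}) : z != 0 -> (forall b, z.[b] != 0 -> p.[b] = q.[b]) -> p = q.
Proof.
move=> z0 pq; apply/eqP; rewrite -subr_eq0; apply: contraT => pq0.
have /closed_nonrootP[b] := mulf_neq0 pq0 z0.
by rewrite rootE hornerM mulf_eq0 negb_or hornerD hornerN => /andP[h /pq e]; move: h; rewrite e subrr eqxx.
Qed.

Lemma exprz_surj (e : int) (z : k) : e != 0 -> z != 0 -> exists2 c, c != 0 & c ^ e = z.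
Proof.
move=> e0 z0; have [|y hy] := @closed_root k z `|e|%N; first by rewrite absz_gt0.
have y0 : y != 0 by apply: contraNneq z0 => y0; rewrite -hy y0 expr0n absz_eq0 (negPf e0).
case: (intP e) e0 hy => [|m|m] // _ hy; first by exists y.
by exists y^-1; rewrite ?invr_eq0 // exprz_inv opprK -hy abszN.
Qed.

(** [q] is the largest power of the characteristic dividing [m], and 1 in characteristic 0. *)
Lemma frobenius_split m : (0 < m)%N -> exists q d, [/\ (0 < q)%N, m = (q * d)%N, d%:R != 0 :> k &
  forall x y : k, (x + y) ^+ q = x ^+ q + y ^+ q].
Proof.
elim/ltn_ind: m => m IH m0; have [mk|mk] := boolP (m%:R == 0 :> k); last first.
  by exists 1%N, m; rewrite mul1n; split=> // x y; rewrite !expr1.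
have [p pk] := natf0_pchar m0 mk; rewrite -(dvdn_pcharf pk) in mk.
have p1 := prime_gt1 (pcharf_prime pk).
have [m1 e] := dvdnP mk; have m10 : (0 < m1)%N by case: m1 e m0 => // ->.
have [||q [d [q0 em1 d0 qD]]] := IH m1 => //; first by rewrite e ltn_Pmulr.
exists (p * q)%N, d; split=> //; first by rewrite muln_gt0 q0 (ltnW p1).
  by rewrite e em1; ring.
move=> x y; rewrite !exprM -!(pFrobenius_autE pk) rmorphD; exact: qD.
Qed.

(** Otherwise ['X^s - 1], with [s] the nonzero remainder of [e], would have all [d] distinct [d]-th
    roots of unity as roots, although [s < d]. *)
Lemma root_of_unity_dvdz d (e : int) : d%:R != 0 :> k ->
  (forall c : k, c ^+ d = 1 -> c ^ e = 1) -> (d %| e)%Z.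
Proof.
move=> d0 hd; have d_gt0 : (0 < d)%N by case: d d0 {hd} => //; rewrite eqxx.
have [rs urs ers] := uniq_roots_of_unity d0.
have dz : d%:Z != 0 by rewrite -lt0n.
apply/dvdz_mod0P; have := ltz_pmod e (_ : 0 < d%:Z); have := modz_ge0 e dz.
case es : (e %% d)%Z => [s|//] _ /(_ d_gt0) sd.
congr Posz; apply/eqP; apply: contraT; rewrite -lt0n => s0.
have sizeX t : (0 < t)%N -> size ('X^t - 1 : {poly k}) = t.+1.
  by move=> t0; rewrite -polyC1 size_XnsubC.
have := @max_poly_roots k ('X^s - 1) rs _ _ urs.
rewrite -size_poly_eq0 sizeX // => /(_ isT) h; have : (size rs < s.+1)%N.
  apply: h; apply/allP => c crs; have : root ('X^d - 1) c by rewrite ers root_prod_XsubC.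
  rewrite !rootE !hornerE !subr_eq0 => /eqP cd; have := hd c cd.
  have c0 : c != 0 by apply/eqP => c0; move: cd; rewrite c0 expr0n eqn0Ngt d_gt0 => /eqP; rewrite eq_sym oner_eq0.
  by rewrite (divz_eq e d) es expfzDr // [(e %/ d)%Z * _]mulrC -exprz_exp -exprnP cd exp1rz mul1r -exprnP => ->.
have : (size rs).+1 = d.+1 by rewrite -(size_prod_XsubC rs id) -ers sizeX.
by case=> ->; rewrite ltnS leqNgt => /negP; case.
Qed.

End ClosedField.

Section Parametrization.
Variables (k : closedFieldType) (X : affine_variety k) (n : nat) (F : frame X n).
Variables (r : nat) (w : 'I_r -> X -> k).
Hypotheses (cw : coordinates w) (sw : spanning w).
Hypothesis lin_tr : forall i a, exists A, linear_on w (tr F i a) A.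
Hypothesis lin_dil : forall i l, l != 0 -> exists A, linear_on w (dil F i l) A.

Definition scales i (h : 'I_r -> int) (lam : k -> k) :=
  forall c, c != 0 -> lam c != 0 /\ forall x j, w j (dil F i (lam c) x) = c ^ h j * w j x.

Lemma dil_inj i l m : l != 0 -> m != 0 -> dil F i l = dil F i m -> l = m.
Proof.
move=> l0 m0 e; have := dil_tr F i 1 l0; rewrite e dil_tr // => /mulIg/tr_inj.
by rewrite !mulr1.
Qed.

Lemma scalesM i h lam c c' : scales i h lam -> c != 0 -> c' != 0 -> lam (c * c') = lam c * lam c'.
Proof.
move=> hl c0 c'0; have [l0 e] := hl c c0; have [l'0 e'] := hl c' c'0.
have [l''0 e''] := hl _ (mulf_neq0 c0 c'0).
apply: (@dil_inj i) => //; first exact: mulf_neq0.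
apply: Aut_eq => x; apply: (coordinates_inj cw) => j.
by rewrite dilM // Aut_mulE e e' e'' expfzMl mulrA.
Qed.

Lemma linear_on_coordinates (g h : Aut X) A : linear_on w g A -> linear_on w h A -> g = h.
Proof.
by move=> hg hh; apply: Aut_eq => x; apply: (coordinates_inj cw) => j; rewrite hg hh.
Qed.

Lemma scales_diag i h lam c : scales i h lam -> c != 0 ->
  linear_on w (dil F i (lam c)) (diag_mx (\row_j c ^ h j)).
Proof.
move=> hl c0 x j; have [_ ->] := hl c c0; rewrite (bigD1 j) //= !mxE eqxx mulr1n big1 ?addr0 // => l lj.
by rewrite !mxE eq_sym (negPf lj) mulr0n mul0r.
Qed.

Lemma linear_on_conj i h lam c a A A' : scales i h lam -> c != 0 ->
  linear_on w (tr F i a) A -> linear_on w (tr F i (lam c * a)) A' ->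
  forall j l, A' j l = c ^ (h j - h l) * A j l.
Proof.
move=> hl c0 hA hA' j l; have D := scales_diag hl c0; have [l0 _] := hl c c0.
have /matrixP/(_ j l) : diag_mx (\row_j c ^ h j) *m A = A' *m diag_mx (\row_j c ^ h j).
  apply: (linear_on_uniq sw (linear_onM D hA)) => x j'.
  by rewrite -[LHS]/(w j' ((dil F i (lam c) * tr F i a)%g x)) dil_tr //; exact: (linear_onM hA' D).
rewrite mul_mx_diag mul_diag_mx !mxE => e.
by rewrite expfzDr // -invr_expz mulrAC e mulfK // expfz_neq0.
Qed.

(* The dilations act on the i-th translation group through a field
   automorphism A, which the torus turns into a power map. *)
Lemma field_twist i h lam : scales i h lam -> (exists j, h j != 0) ->
  exists (A : k -> k) (m : int),
    [/\ [/\ m != 0, forall a b, A (a + b) = A a + A b & forall a b, A (a * b) = A a * A b],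
        injective A & forall c, c != 0 -> A (lam c) = c ^ m].
Proof.
move=> hl [j0 hj0].
have /choice[N hN] := lin_tr i.
have /choice[T hT] (l : k) : exists A, l != 0 -> linear_on w (dil F i l) A.
  have [->|l0] := eqVneq l 0; first by exists 0.
  by have [A hA] := lin_dil i l0; exists A.
have uq := linear_on_uniq sw.
have N0 : N 0 = 1%:M by apply: uq (hN 0) _; rewrite tr0; exact: linear_on1.
have ND a b : N (a + b) = N a *m N b.
  by apply: uq (hN _) _; rewrite trD; exact: linear_onM.
have T1 : T 1 = 1%:M.
  by apply: uq (hT 1 (oner_neq0 _)) _; rewrite dil1; exact: linear_on1.
have TM l m : l != 0 -> m != 0 -> T (l * m) = T l *m T m.
  move=> l0 m0; apply: uq (hT _ (mulf_neq0 l0 m0)) _; rewrite dilM //.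
  by apply: linear_onM; exact: hT.
have TN l a : l != 0 -> T l *m N a = N (l * a) *m T l.
  move=> l0; apply: uq (linear_onM (hT l l0) (hN a)) _ => x j.
  rewrite -[LHS]/(w j ((dil F i l * tr F i a)%g x)) dil_tr //.
  exact: (linear_onM (hN _) (hT l l0)).
have N1 : N 1 <> 1%:M.
  move=> e; have := hN 1; rewrite e => h1.
  have /tr_inj/eqP : tr F i 1 = tr F i 0.
    by rewrite tr0; apply: linear_on_coordinates h1 _; exact: linear_on1.
  by rewrite oner_eq0.
have [u [v [alD [a0 ala0] alZ]]] := additive_coefficient N0 ND N1 T1 TM TN.
pose al a := ((u *m N a - u) *m v) 0 0.
have {}alD a b : al (a + b) = al a + al b by exact: alD.
have {}alZ l : l != 0 -> exists c, forall a, al (l * a) = c * al a by exact: alZ.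
have {}ala0 : al a0 != 0 by exact: ala0.
have al0 : al 0 = 0 by apply: (addrI (al 0)); rewrite -alD !addr0.
have al1 : al 1 != 0.
  have a00 : a0 != 0 by apply: contraNneq ala0 => ->; rewrite al0.
  apply: contraNneq ala0 => al1; have [c hc] := alZ a0 a00.
  by rewrite -[a0]mulr1 hc al1 mulr0.
pose A a := al a / al 1.
have AD a b : A (a + b) = A a + A b by rewrite /A alD mulrDl.
have A0 : A 0 = 0 by rewrite /A al0 mul0r.
have A1 : A 1 = 1 by rewrite /A divff.
have AM a b : A (a * b) = A a * A b.
  have [->|a'0] := eqVneq a 0; first by rewrite !mul0r A0 mul0r.
  have [c hc] := alZ a a'0; rewrite /A -{2}[a]mulr1 !hc mulfK //.
  by rewrite mulrA.
have A_inj : injective A.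
  move=> a b /eqP; rewrite -subr_eq0 => e; apply/eqP; rewrite -subr_eq0.
  have {}e : A (a - b) = 0.
    apply/eqP; move: e; congr (is_true (_ == 0)); apply: (addIr (A b)).
    by rewrite -AD !subrK.
  apply: contraT => ab; have := A1; rewrite -{1}(mulVf ab) AM e mulr0 => /esym/eqP.
  by rewrite oner_eq0.
pose M := (N 1 - 1%:M).
have alE a : al a = \sum_(jl : 'I_r * 'I_r) u 0 jl.1 * (N a - 1%:M) jl.1 jl.2 * v jl.2 0.
  rewrite /al -[X in _ - X]mulmx1 -mulmxBr mxE.
  rewrite (eq_bigr (fun l => \sum_j u 0 j * (N a - 1%:M) j l * v l 0)).
    by rewrite exchange_big pair_bigA.
  by move=> l _; rewrite mxE mulr_suml.
have allam c : c != 0 -> al (lam c) =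
    \sum_(jl : 'I_r * 'I_r) u 0 jl.1 * M jl.1 jl.2 * v jl.2 0 * c ^ (h jl.1 - h jl.2).
  move=> c0; rewrite alE; apply: eq_bigr => -[j l] _ /=; rewrite -!mulrA; congr (_ * _).
  have e := linear_on_conj hl c0 (hN 1) (hN (lam c * 1)) j l; rewrite mulr1 in e.
  rewrite !mxE e; have [->|] := eqVneq j l; first by rewrite subrr expr0z mul1r mulr1.
  by rewrite mulr0n !subr0 => _; ring.
pose U := {c : k | c != 0}.
pose mulU (c c' : U) : U := exist _ (val c * val c') (mulf_neq0 (valP c) (valP c')).
pose oneU : U := exist _ 1 (oner_neq0 k).
pose chi (o : option ('I_r * 'I_r)) (c : U) : k :=
  if o is Some jl then val c ^ (h jl.1 - h jl.2) else A (lam (val c)).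
have lam1 : lam 1 = 1.
  apply: (@dil_inj i); rewrite ?oner_neq0 //; first by have [] := hl 1 (oner_neq0 k).
  apply: Aut_eq => x; apply: (coordinates_inj cw) => j.
  by have [_ ->] := hl 1 (oner_neq0 k); rewrite exp1rz mul1r dil1.
(* [A \o lam] is a character of the multiplicative group and, by [allam], a combination of the power
   characters [c ^ (h j - h l)]; independence makes it one of them. *)
have [m hm] : exists m : int, forall c, c != 0 -> A (lam c) = c ^ m.
  apply: contrapT => none.
  have := @artin k U mulU oneU _ (None :: map Some (index_enum ('I_r * 'I_r)%type))
    (fun o => if o is Some jl then - (u 0 jl.1 * M jl.1 jl.2 * v jl.2 0) else al 1) chi
    (fun f => if `[< f = chi None >] then 1 else 0).
  rewrite big_cons asboolT // mulr1 big_map big1 => [|jl _]; last first.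
    rewrite asboolF ?mulr0 // => e; apply: none; exists (h jl.1 - h jl.2) => c c0.
    by have := congr1 (fun f => f (exist _ c c0 : U)) e.
  rewrite addr0 => H; move/eqP: (al1); apply; apply: H.
    case=> [[j l]|] /=; split; rewrite /chi /= ?exp1rz ?lam1 // => c c'.
      by rewrite expfzMl.
    by rewrite (scalesM hl (valP c) (valP c')) AM.
  have alA a : al 1 * A a = al a by rewrite mulrC divfK.
  move=> c; rewrite big_cons big_map /chi /= alA (allam _ (valP c)).
  by rewrite -big_split big1 //= => jl _; rewrite mulNr subrr.
(* With [m = 0] the map [lam] would be constantly 1, while the nonzero weight [h j0] makes the torus
   act nontrivially. *)
exists A, m; split=> //; split=> //; apply/negP => /eqP m0.
have [x wx] := spanning_neq0 sw j0; have [z z0 z1] := scalar_neq01 k.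
have [c c0 cz] := exprz_surj hj0 z0.
have lc : lam c = 1 by apply: A_inj; rewrite hm // m0 expr0z A1.
have [_ /(_ x j0)] := hl c c0; rewrite lc dil1 cz -{1}[w j0 _]mul1r => /(mulIf wx) e.
by rewrite -e eqxx in z1.
Qed.

(** [bet] reparametrizes the translations additively so that their matrices become polynomial in
    [b]; [d] is the torus weight of the new parameter. *)
Definition unipotent_model i (h : 'I_r -> int) (lam bet : k -> k) (d : nat) (P : 'M[{poly k}]_r) :=
  [/\ [/\ (0 < d)%N, scales i h lam & forall l, l != 0 -> exists2 c, c != 0 & lam c = l],
    [/\ forall a b, bet (a + b) = bet a + bet b, injective bet & forall a, exists b, bet b = a],
    forall c b, c != 0 -> bet (c ^+ d * b) = lam c * bet b &
    forall b x j, w j (tr F i (bet b) x) = \sum_l (P j l).[b] * w l x].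

(** Inverting [A] undoes the field automorphism; precomposing with [b ^+ q], where [m = q * d],
    preserves additivity and leaves a weight [d] invertible in [k]. There are then enough [d]-th
    roots of unity to force integral exponents of [b] in the translation matrices. *)
Lemma unipotent_model_pos i h lam A m : scales i h lam -> (0 < m)%N ->
  (forall a b, A (a + b) = A a + A b) -> (forall a b, A (a * b) = A a * A b) -> injective A ->
  (forall c, c != 0 -> A (lam c) = c ^+ m) ->
  exists bet d P, unipotent_model i h lam bet d P.
Proof.
move=> hl m0 AD AM A_inj hA.
have A0 : A 0 = 0 by apply: (addrI (A 0)); rewrite -AD !addr0.
have lam_surj l : l != 0 -> exists2 c, c != 0 & lam c = l.
  move=> l0; have [c hc] := closed_root (A l) m0.
  have c0 : c != 0.
    apply: contraNneq l0 => c0; apply/eqP/A_inj; rewrite A0 -hc c0 expr0n.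
    by rewrite eqn0Ngt m0.
  by exists c => //; apply: A_inj; rewrite hA.
have A_surj a : exists b, A b = a.
  have [->|a0] := eqVneq a 0; first by exists 0.
  have [c hc] := closed_root a m0; exists (lam c); rewrite hA //.
  by apply: contraNneq a0 => c0; rewrite -hc c0 expr0n eqn0Ngt m0.
have /choice[B hB] := A_surj.
have AK a : B (A a) = a by apply: A_inj; rewrite hB.
have BD a b : B (a + b) = B a + B b by apply: A_inj; rewrite AD !hB.
have BM a b : B (a * b) = B a * B b by apply: A_inj; rewrite AM !hB.
have [q [d [q0 mqd d0 qD]]] := @frobenius_split k m m0.
have d_gt0 : (0 < d)%N by case: (d) d0 => //; rewrite eqxx.
pose bet b := B (b ^+ q).
have betD a b : bet (a + b) = bet a + bet b by rewrite /bet qD BD.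
have bet0 : bet 0 = 0 by apply: (addrI (bet 0)); rewrite -betD !addr0.
have bet_inj : injective bet.
  move=> a b e; apply/eqP; rewrite -subr_eq0; suff : (a - b) ^+ q = 0.
    by move/eqP; rewrite expf_eq0 => /andP[].
  have /(congr1 A) : bet (a - b) = 0 by apply: (addIr (bet b)); rewrite -betD subrK e add0r.
  by rewrite /bet hB A0.
have betZ c b : c != 0 -> bet (c ^+ d * b) = lam c * bet b.
  by move=> c0; rewrite /bet exprMn -exprM mulnC -mqd BM -hA // AK.
have /choice[N hN] b := lin_tr i (bet b).
have N0 : N 0 = 1%:M.
  by apply: (linear_on_uniq sw (hN 0)); rewrite bet0 tr0; exact: linear_on1.
have ND a b : N (a + b) = N a *m N b.
  by apply: (linear_on_uniq sw (hN _)); rewrite betD trD; exact: linear_onM.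
have NZ c j l : c != 0 -> N (c ^+ d) j l = c ^ (h j - h l) * N 1 j l.
  move=> c0; apply: (linear_on_conj hl c0 (hN 1)).
  by rewrite -betZ // mulr1; exact: hN.
have dvd j l : N 1 j l != 0 -> (d %| h j - h l)%Z.
  move=> njl; apply: root_of_unity_dvdz d0 _ => c cd.
  have c0 : c != 0 by apply/eqP => c0; move/eqP: cd; rewrite c0 expr0n eqn0Ngt d_gt0 eq_sym oner_eq0.
  by apply: (mulIf njl); rewrite -NZ // cd mul1r.
pose e j l := ((h j - h l) %/ d)%Z.
have Ne b j l : b != 0 -> N b j l = b ^ e j l * N 1 j l.
  move=> b0; have [c hc] := closed_root b d_gt0.
  have c0 : c != 0 by apply: contraNneq b0 => c0; rewrite -hc c0 expr0n eqn0Ngt d_gt0.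
  rewrite -hc NZ //; have [->|njl] := eqVneq (N 1 j l) 0; first by rewrite !mulr0.
  by rewrite -{1}(divzK (dvd _ _ njl)) mulrC -/(e j l) [_ * d%:Z]mulrC -exprz_exp -exprnP mulrC.
have z0 : 'X * ('X + 1) != 0 :> {poly k}.
  by rewrite mulf_neq0 ?polyX_eq0 // -[1]opprK -polyC1 -polyCN polyXsubC_eq0.
have zP b : ('X * ('X + 1) : {poly k}).[b] != 0 -> b != 0 /\ b + 1 != 0.
  by rewrite !hornerE mulf_eq0 negb_or => /andP.
have shift b : N b = N (b + 1) *m N (- 1) by rewrite -ND addrK.
(* A negative exponent would be a pole of [N b] at [b = 0], but
   [N b = N (b + 1) *m N (- 1)] can only have a pole at [b = - 1]. *)
have e_ge0 j l : N 1 j l != 0 -> 0 <= e j l.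
  move=> njl; rewrite leNgt; apply/negP => e_lt0.
  pose M := (\sum_s `|e j s|)%N.
  have hM s : 0 <= M%:Z + e j s.
    have : (`|e j s| <= M)%N by rewrite /M (bigD1 s) //= leq_addr.
    by lia.
  pose R := \sum_s (N 1 j s * N (-1) s l) *: ('X + 1) ^+ absz (M%:Z + e j s).
  have : (N 1 j l) *: ('X + 1) ^+ M = 'X ^+ `|e j l|%N * R.
    apply: (poly_eq_off z0) => b /zP[b0 b1].
    have := congr1 (fun K : 'M_r => K j l) (shift b); rewrite Ne // mxE.
    rewrite (eq_bigr (fun s => (b + 1) ^ e j s * N 1 j s * N (-1) s l)) => [E|s _]; last by rewrite (Ne _ _ _ b1).
    have be : b ^+ `|e j l|%N = b ^ (- e j l) by rewrite exprnP; congr (_ ^ _); lia.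
    rewrite hornerZ horner_exp hornerM hornerXn horner_sum !hornerE be.
    have -> : N 1 j l * (b + 1) ^+ M = b ^ (- e j l) * ((b + 1) ^+ M * (b ^ e j l * N 1 j l)).
      by rewrite [RHS]mulrCA -invr_expz mulKf ?expfz_neq0 // mulrC.
    rewrite E mulr_sumr; congr (_ * _); apply: eq_bigr => s _.
    rewrite hornerZ horner_exp !hornerE [_ ^+ M]exprnP [(b + 1) ^+ absz _]exprnP gez0_abs //.
    have aux (u v x y : k) : u * v * x * y = x * y * (u * v) by ring.
    by rewrite expfzDr //; exact: aux.
  move/(congr1 (fun p => p.[0])); rewrite hornerZ horner_exp hornerM hornerXn !hornerE.
  rewrite expr1n mulr1 expr0n absz_eq0 (lt_eqF e_lt0) mul0r => /eqP.
  by rewrite (negPf njl).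
pose P := \matrix_(j, l) (N 1 j l *: 'X ^+ `|e j l|%N : {poly k}).
have PE b j l : b != 0 -> (P j l).[b] = N b j l.
  move=> b0; rewrite mxE hornerZ hornerXn (Ne b) // mulrC.
  have [->|/e_ge0 eh] := eqVneq (N 1 j l) 0; first by rewrite !mulr0.
  by rewrite exprnP gez0_abs.
(* The monomial formula holds only for nonzero [b]. The value at 0 comes from the relation between
   [N b] and [N (b + 1)], a polynomial identity since it holds off 0 and -1. *)
have P0 j l : (P j l).[0] = N 0 j l.
  have : P j l = \sum_s N (-1) s l *: (P j s \Po ('X + 1)).
    apply: (poly_eq_off z0) => b /zP[b0 b1]; rewrite PE // (shift b) mxE horner_sum.
    by apply: eq_bigr => s _; rewrite hornerZ horner_comp !hornerE PE // mulrC.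
  move/(congr1 (fun p => p.[0])) => ->; rewrite horner_sum (shift 0) mxE; apply: eq_bigr => s _.
  by rewrite hornerZ horner_comp !hornerE ?add0r PE ?oner_neq0 // mulrC.
exists bet, d, P; split=> //.
  split=> // a; have [y hy] := closed_root (A a) q0.
  by exists y; rewrite /bet hy AK.
move=> b x j; rewrite hN; apply: eq_bigr => l _; congr (_ * _).
by have [->|b0] := eqVneq b 0; rewrite ?P0 ?PE.
Qed.

Lemma unipotent_model_exists i h0 lam0 : scales i h0 lam0 -> (exists j, h0 j != 0) ->
  exists h lam bet d P, (exists j, h j != 0) /\ unipotent_model i h lam bet d P.
Proof.
move=> hl hj; have [A [m [[m0 AD AM] A_inj hA]]] := field_twist hl hj.
case: (intP m) m0 hA => [|{}m|{}m] // _ hA.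
  have [bet [d [P hP]]] := unipotent_model_pos hl (ltn0Sn m) AD AM A_inj hA.
  by exists h0, lam0, bet, d, P.
(* Inverting the torus parameter makes a negative power positive and negates the weights. *)
have hl' : scales i (fun j => - h0 j) (fun c => lam0 c^-1).
  move=> c c0; have [|l0 e] := hl c^-1; first by rewrite invr_eq0.
  by split=> // x j; rewrite e exprz_inv.
have [|bet [d [P hP]]] := unipotent_model_pos hl' (ltn0Sn m) AD AM A_inj.
  by move=> c c0; rewrite hA ?invr_eq0 // exprz_inv opprK.
exists (fun j => - h0 j), (fun c => lam0 c^-1), bet, d, P; split=> //.
by have [j hj0] := hj; exists j; rewrite oppr_eq0.
Qed.

End Parametrization.

(** * Invariants, weights and the dense orbit *)

Section PolynomialFamilies.
Variables (k : closedFieldType) (X : affine_variety k).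

(** Elements of k[X][b], seen pointwise; hence the degree bound uniform in [x]. *)
Definition polyfam (Q : X -> {poly k}) :=
  (exists E, forall x, (size (Q x) <= E)%N) /\ forall e, regfun (fun x => (Q x)`_e).

Lemma polyfam_cst q : polyfam (fun=> q).
Proof. by split=> [|e]; [exists (size q) | exact: polyfun_cst]. Qed.

Lemma polyfamZ f Q : regfun f -> polyfam Q -> polyfam (fun x => f x *: Q x).
Proof.
move=> hf [[E hE] hQ]; split=> [|e].
  by exists E => x; apply: leq_trans (size_scale_leq _ _) _.
by apply: polyfun_eq (polyfunM hf (hQ e)) => x; rewrite coefZ.
Qed.

Lemma polyfamD Q Q' : polyfam Q -> polyfam Q' -> polyfam (fun x => Q x + Q' x).
Proof.
move=> [[E hE] hQ] [[E' hE'] hQ']; split=> [|e].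
  exists (maxn E E') => x; apply: leq_trans (size_polyD _ _) _.
  by rewrite geq_max !leq_max hE hE' orbT.
by apply: polyfun_eq (polyfunD (hQ e) (hQ' e)) => x; rewrite coefD.
Qed.

Lemma polyfamM Q Q' : polyfam Q -> polyfam Q' -> polyfam (fun x => Q x * Q' x).
Proof.
move=> [[E hE] hQ] [[E' hE'] hQ']; split=> [|e].
  exists (E + E')%N => x; apply: leq_trans (size_polyMleq _ _) _.
  by apply: leq_trans (leq_pred _) _; rewrite leq_add.
apply: (@polyfun_eq _ _ _ _ (fun x => \sum_(i < e.+1) (Q x)`_i * (Q' x)`_(e - i))).
  by move=> x; rewrite coefM.
by apply: polyfun_sum => i; exact: polyfunM.
Qed.

Lemma polyfam_sum (I : Type) (s : seq I) (Q : I -> X -> {poly k}) :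
  (forall i, polyfam (Q i)) -> polyfam (fun x => \sum_(i <- s) Q i x).
Proof.
move=> hQ; elim: s => [|i s IH]; under eq_fun do rewrite ?big_nil ?big_cons.
  exact: polyfam_cst.
exact: polyfamD.
Qed.

Lemma polyfam_prod (I : Type) (s : seq I) (Q : I -> X -> {poly k}) :
  (forall i, polyfam (Q i)) -> polyfam (fun x => \prod_(i <- s) Q i x).
Proof.
move=> hQ; elim: s => [|i s IH]; under eq_fun do rewrite ?big_nil ?big_cons.
  exact: polyfam_cst.
exact: polyfamM.
Qed.

Lemma polyfamX Q e : polyfam Q -> polyfam (fun x => Q x ^+ e).
Proof.
move=> hQ; elim: e => [|e IH]; under eq_fun do rewrite ?expr0 ?exprS.
  exact: polyfam_cst.
exact: polyfamM.
Qed.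

End PolynomialFamilies.

Lemma poly_ext (k : closedFieldType) (p q : {poly k}) : (forall b, p.[b] = q.[b]) -> p = q.
Proof. by move=> pq; apply: (poly_eq_off (oner_neq0 _)) => b _. Qed.

Lemma coef_comp_shift (k : fieldType) (p : {poly k}) b e : (size p <= e.+1)%N ->
  (p \Po ('X + b%:P))`_e = p`_e.
Proof.
move=> sp; have s2 : size ('X + b%:P) = 2 by rewrite size_XaddC.
have [se|ne] := eqVneq (size p) e.+1; last first.
  have {ne}sp : (size p <= e)%N by rewrite -ltnS ltn_neqAle ne.
  by rewrite !nth_default // size_comp_poly2.
have : lead_coef (p \Po ('X + b%:P)) = lead_coef p * lead_coef ('X + b%:P) ^+ (size p).-1.
  by rewrite lead_coef_comp ?s2.
rewrite lead_coefXaddC expr1n mulr1.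
by rewrite /lead_coef size_comp_poly2 // se.
Qed.

Lemma coef_binomial (k : closedFieldType) m e : ((1 + 'X : {poly k}) ^+ m)`_e = 'C(m, e)%:R.
Proof.
have -> : (1 + 'X) ^+ m = \poly_(i < m.+1) 'C(m, i)%:R :> {poly k}.
  rewrite exprDn poly_def; apply: eq_bigr => i _.
  by rewrite expr1n mul1r scaler_nat.
by rewrite poly.coef_poly; case: ltnP => // me; rewrite bin_small.
Qed.

Lemma sum_fibers (R : nmodType) (I J : eqType) (s : seq I) (chi : I -> J) (a : I -> R) :
  \sum_(i <- s) a i = \sum_(f <- undup [seq chi i | i <- s]) \sum_(i <- s | chi i == f) a i.
Proof.
rewrite (exchange_big_dep xpredT) //= big_seq [RHS]big_seq; apply: eq_bigr => i si.
rewrite -big_filter (_ : seq.filter _ _ = [:: chi i]) ?big_seq1 //.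
rewrite (@eq_filter _ _ (pred1 (chi i))) => [|f]; last by rewrite /= eq_sym.
by rewrite filter_pred1_uniq ?undup_uniq // mem_undup map_f.
Qed.

(* Expanding [beta (1 + y) = beta' ((1 + y) ^+ N)] with N = 2 (N = 3 in
   characteristic 2), additivity makes [beta'] kill the cross terms. *)
Lemma no_additive_power (k : closedFieldType) : exists2 N, (0 < N)%N & forall beta beta' : k -> k,
  (forall x y, beta (x + y) = beta x + beta y) -> (forall x y, beta' (x + y) = beta' x + beta' y) ->
  (forall y, y != 0 -> beta y != 0) -> ~ forall y, y != 0 -> beta y = beta' (y ^+ N).
Proof.
have [y] : exists y : k, ('X * ('X + 1) : {poly k}).[y] != 0.
  have /closed_nonrootP[y] : ('X * ('X + 1) : {poly k}) != 0.
    by rewrite mulf_neq0 ?polyX_eq0 // -[1]opprK -polyC1 -polyCN polyXsubC_eq0.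
  by exists y.
rewrite !hornerE mulf_eq0 negb_or addrC => /andP[y0 y1].
have [e2|e2] := eqVneq (2%:R : k) 0.
  exists 3%N => // be be' beD be'D be0 H.
  have be'0 z : z != 0 -> be' z != 0.
    move=> z0; have [x xz] := @closed_root k z 3 isT; rewrite -xz -H ?be0 //.
      by apply: contraNneq z0 => x0; rewrite -xz x0 expr0n.
    by apply: contraNneq z0 => x0; rewrite -xz x0 expr0n.
  have := beD 1 y; rewrite !H ?oner_neq0 // expr1n => e.
  have e3 : (1 + y) ^+ 3 = (1 + y ^+ 3) + y * (1 + y).
    have -> : (1 + y) ^+ 3 = (1 + y ^+ 3) + y * (1 + y) + 2%:R * (y * (1 + y)) by ring.
    by rewrite e2 mul0r addr0.
  move: e; rewrite e3 be'D be'D -[RHS]addr0 => /addrI/eqP.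
  by rewrite (negPf (be'0 _ _)) // mulf_neq0.
exists 2%N => // be be' beD be'D be0 H.
have be'0 z : z != 0 -> be' z != 0.
  move=> z0; have [x xz] := @closed_root k z 2 isT; rewrite -xz -H ?be0 //.
    by apply: contraNneq z0 => x0; rewrite -xz x0 expr0n.
  by apply: contraNneq z0 => x0; rewrite -xz x0 expr0n.
have := beD 1 y; rewrite !H ?oner_neq0 // expr1n => e.
have e3 : (1 + y) ^+ 2 = (1 + y ^+ 2) + 2%:R * y by ring.
move: e; rewrite e3 be'D be'D -[RHS]addr0 => /addrI/eqP.
by rewrite (negPf (be'0 _ _)) // mulf_neq0.
Qed.

Section Model.
Variables (k : closedFieldType) (X : affine_variety k) (n : nat) (F : frame X n).
Variables (r : nat) (w : 'I_r -> X -> k).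
Hypotheses (cw : coordinates w) (sw : spanning w).
Variables (h : 'I_n -> 'I_r -> int) (lam bet : 'I_n -> k -> k) (d : 'I_n -> nat).
Variable P : 'I_n -> 'M[{poly k}]_r.
Hypothesis model : forall i, unipotent_model F w i (h i) (lam i) (bet i) (d i) (P i).

Definition ut i b := tr F i (bet i b).
Definition psi i c := dil F i (lam i c).

Lemma psi_w i c x j : c != 0 -> w j (psi i c x) = c ^ h i j * w j x.
Proof. by move=> c0; have [[_ /(_ c c0)[_ ->]]] := model i. Qed.

Lemma ut_w i b x j : w j (ut i b x) = \sum_l (P i j l).[b] * w l x.
Proof. by have [_ _ _ ->] := model i. Qed.

Lemma lam_neq0 i c : c != 0 -> lam i c != 0.
Proof. by move=> c0; have [[_ /(_ c c0)[]]] := model i. Qed.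

Lemma utD i b b' : ut i (b + b') = (ut i b * ut i b')%g.
Proof. by have [_ [betD _ _] _ _] := model i; rewrite /ut betD trD. Qed.

Lemma ut0 i : ut i 0 = 1%g.
Proof. by apply: (mulgI (ut i 0)); rewrite -utD !addr0 mulg1. Qed.

Lemma utC i j b b' x : ut i b (ut j b' x) = ut j b' (ut i b x).
Proof. by rewrite -!Aut_mulE (trC F i j). Qed.

Lemma utN i b x : ut i b (ut i (- b) x) = x.
Proof. by rewrite -Aut_mulE -utD subrr ut0. Qed.

Lemma ut_tr i a : exists b, tr F i a = ut i b.
Proof. by have [_ [_ _ /(_ a)[b <-]] _ _] := model i; exists b. Qed.

Lemma psi_dil i l : l != 0 -> exists2 c, c != 0 & dil F i l = psi i c.
Proof.
move=> l0; have [[_ _ /(_ l l0)[c c0 lc]] _ _ _] := model i.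
by exists c; rewrite // /psi lc.
Qed.

Lemma psi_ut i c b x : c != 0 -> psi i c (ut i b x) = ut i (c ^+ d i * b) (psi i c x).
Proof.
move=> c0; have [_ _ bZ _] := model i.
by rewrite -!Aut_mulE /psi /ut bZ // dil_tr // lam_neq0.
Qed.

Lemma psi_utC i j c b x : c != 0 -> i != j -> psi i c (ut j b x) = ut j b (psi i c x).
Proof. by move=> c0 ij; rewrite -!Aut_mulE dil_trC ?lam_neq0. Qed.

Lemma psiV i c x : c != 0 -> psi i c (psi i c^-1 x) = x.
Proof.
move=> c0; apply: (coordinates_inj cw) => j.
by rewrite !psi_w ?invr_eq0 // mulrA -expfzMl divff // exp1rz mul1r.
Qed.

Lemma expansion i f : regfun f -> exists Q : X -> {poly k}, polyfam Q /\
  forall b x, f (ut i b x) = (Q x).[b].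
Proof.
move=> hf; have [wr wg] := cw; have [p hp] := wg f hf.
exists (fun x => \sum_(m <- msupp p) p@_m *: \prod_j (\sum_l w l x *: P i j l) ^+ m j); split.
  apply: polyfam_sum => m; apply: polyfamZ; first exact: polyfun_cst.
  apply: polyfam_prod => j; apply: polyfamX; apply: polyfam_sum => l; apply: polyfamZ => //.
  exact: polyfam_cst.
move=> b x; rewrite hp mevalE horner_sum; apply: eq_bigr => m _.
rewrite hornerZ horner_prod; congr (_ * _); apply: eq_bigr => j _.
rewrite horner_exp ut_w horner_sum; congr (_ ^+ _); apply: eq_bigr => l _.
by rewrite hornerZ mulrC.
Qed.

Definition homogeneous (om : 'I_n -> int) (f : X -> k) :=
  forall i c x, c != 0 -> f (psi i c x) = c ^ om i * f x.

Definition ut_invariant i (f : X -> k) := forall b x, f (ut i b x) = f x.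

Definition ut_stable (Z : X -> Prop) := forall i b x, Z x -> Z (ut i b x).

Definition psi_stable (Z : X -> Prop) := forall i c x, c != 0 -> Z x -> Z (psi i c x).

(** Conjugation by the torus of axis [i] rescales [b] by [c ^+ d i], so the coefficient of [b ^+ e]
    loses [d i * e] from its weight. *)
Lemma coefficient_homogeneous i om f (Q : X -> {poly k}) e :
  (forall b x, f (ut i b x) = (Q x).[b]) -> homogeneous om f ->
  homogeneous (fun l => om l - (if l == i then (d i * e)%N else 0%N)%:Z) (fun x => (Q x)`_e).
Proof.
move=> hQ homf l c x c0; case: (eqVneq l i) => [->|li]; last first.
  have -> : Q (psi l c x) = c ^ om l *: Q x.
    by apply: poly_ext => b; rewrite hornerZ -!hQ -psi_utC // homf.
  by rewrite coefZ subr0.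
have cd0 : c ^+ d i != 0 by rewrite expf_neq0.
have -> : Q (psi i c x) = c ^ om i *: \poly_(j < size (Q x)) ((Q x)`_j * (c ^+ d i)^-1 ^+ j).
  apply: poly_ext => b; rewrite hornerZ -hQ -[b in LHS](mulVKf cd0) -psi_ut // homf // hQ.
  congr (_ * _); rewrite horner_poly horner_coef; apply: eq_bigr => j _.
  by rewrite exprMn mulrA.
rewrite coefZ poly.coef_poly; case: ltnP => [_|/(nth_default 0) ->]; last by rewrite !mulr0.
by rewrite expfzDr // -invr_expz -exprnP exprM exprVn -mulrA [_ * (Q x)`_e]mulrC.
Qed.

(** [e] is the largest degree attained anywhere on [X]. Translation along axis [i] only shifts the
    variable of [Q x], which leaves the coefficient in degree [e] unchanged. The last clauses allow
    iteration over the axes and control zeros on stable sets. *)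
Lemma top_coefficient i om f : regfun f -> homogeneous om f -> (exists x, f x != 0) ->
  exists (e : nat) f', [/\ regfun f', exists x, f' x != 0,
    homogeneous (fun l => om l - (if l == i then (d i * e)%N else 0%N)%:Z) f',
    ut_invariant i f' /\ (forall j, ut_invariant j f -> ut_invariant j f') &
    forall Z, ut_stable Z -> (forall x, Z x -> f x = 0) -> forall x, Z x -> f' x = 0].
Proof.
move=> hf homf [x0 fx0]; have [Q [[[E hE] Qr] hQ]] := expansion i hf.
have Q0 x : (Q x)`_0 = f x by rewrite -horner_coef0 -hQ ut0.
have ex : exists e, `[< exists x, (Q x)`_e != 0 >].
  by exists 0%N; apply/asboolP; exists x0; rewrite Q0.
have bd e : `[< exists x, (Q x)`_e != 0 >] -> (e <= E)%N.
  move=> /asboolP[x]; apply: contraNT; rewrite -ltnNge => lt; apply/eqP/nth_default.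
  exact: leq_trans (hE x) (ltnW lt).
case: (ex_maxnP ex bd) => e /asboolP[x1 hx1] hmax.
have sQ x : (size (Q x) <= e.+1)%N.
  rewrite leqNgt; apply/negP => lt.
  have : ((size (Q x)).-1 <= e)%N.
    apply: hmax; apply/asboolP; exists x; rewrite -[_`_ _]/(lead_coef _) lead_coef_eq0.
    by rewrite -size_poly_gt0 (leq_trans _ lt).
  by case: (size (Q x)) lt => // s; rewrite ltnS /= => lt /(leq_trans lt); rewrite ltnn.
have QD j b x : (forall b', f (ut i b' (ut j b x)) = f (ut i b' x)) -> Q (ut j b x) = Q x.
  by move=> inv; apply: poly_ext => b'; rewrite -!hQ.
exists e, (fun x => (Q x)`_e); split=> //; first by exists x1.
- exact: coefficient_homogeneous hQ homf.
- split=> [b x|j fj b x] /=; last by rewrite QD // => b'; rewrite utC fj.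
  suff -> : Q (ut i b x) = Q x \Po ('X + b%:P) by rewrite coef_comp_shift.
  apply: poly_ext => b'.
  by rewrite -hQ -Aut_mulE -utD hQ horner_comp !hornerE.
move=> Z Zst fZ x Zx; have -> : Q x = 0; last by rewrite coef0.
by apply: poly_ext => b; rewrite -hQ horner0 fZ //; exact: Zst.
Qed.

Lemma invariant_coefficient om f : regfun f -> homogeneous om f -> (exists x, f x != 0) ->
  exists (gam : 'I_n -> nat) f', [/\ regfun f', exists x, f' x != 0,
    homogeneous (fun l => om l - (d l * gam l)%N%:Z) f', forall i, ut_invariant i f' &
    forall Z, ut_stable Z -> (forall x, Z x -> f x = 0) -> forall x, Z x -> f' x = 0].
Proof.
move=> hf homf f0.
suff gen (s : seq 'I_n) : exists (gam : 'I_n -> nat) f', [/\ regfun f', exists x, f' x != 0,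
    homogeneous (fun l => om l - (d l * gam l)%N%:Z) f', forall i, i \in s -> ut_invariant i f' &
    forall Z, ut_stable Z -> (forall x, Z x -> f x = 0) -> forall x, Z x -> f' x = 0].
  have [gam [f' [h1 h2 h3 h4 h5]]] := gen (enum 'I_n); exists gam, f'; split=> // i.
  by apply: h4; rewrite mem_enum.
elim: s => [|i s [gam [f' [h1 h2 h3 h4 h5]]]].
  exists (fun=> 0%N), f; split=> // i c x c0.
  by rewrite muln0 subr0 homf.
have [e [f'' [g1 g2 g3 [g4 g4'] g5]]] := top_coefficient i h1 h3 h2.
exists (fun l => gam l + (if l == i then e else 0))%N, f''; split=> //.
- move=> l c x c0; rewrite g3 //; congr (_ ^ _ * _).
  by case: eqVneq => [->|_]; rewrite ?addn0 ?subr0 // mulnDr PoszD opprD addrA.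
- by move=> j; rewrite inE => /orP[/eqP->//|js]; apply: g4'; exact: h4.
by move=> Z Zst fZ; apply: (g5) => //; exact: h5.
Qed.

(** Words in one-parameter dilations stand for the torus: independence of characters uses no more
    structure than concatenation and the empty word. *)
Let G := seq ('I_n * {c : k | c != 0}).

Definition torus_act (g : G) x := foldr (fun ic => psi ic.1 (val ic.2) : X -> X) x g.

Definition torus_char j (g : G) := \prod_(ic <- g) val ic.2 ^ h ic.1 j.

Lemma torus_charM j g g' : torus_char j (g ++ g') = torus_char j g * torus_char j g'.
Proof. by rewrite /torus_char big_cat. Qed.

Lemma torus_char1 j : torus_char j [::] = 1.
Proof. by rewrite /torus_char big_nil. Qed.

Lemma w_torus_act j g x : w j (torus_act g x) = torus_char j g * w j x.
Proof.
elim: g => [|ic g IH] /=; first by rewrite torus_char1 mul1r.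
by rewrite psi_w ?(valP ic.2) // IH /torus_char big_cons mulrA.
Qed.

Lemma torus_twist (p : {mpoly k[r]}) x (W : (G -> k) -> k) : (forall g, p.@[w^~ (torus_act g x)] = 0) ->
  \sum_(m <- msupp p) p@_m * \prod_j w j x ^+ m j * W (monomial_char torus_char m) = 0.
Proof. exact: (twist torus_char1 torus_charM w_torus_act). Qed.

Lemma monomial_char1 (m : 'X_{1..r}) i (c : {c : k | c != 0}) :
  monomial_char torus_char m [:: (i, c)] = val c ^ (\sum_j h i j * (m j)%:Z).
Proof.
rewrite /monomial_char (big_morph (fun e => val c ^ e) (fun a b => expfzDr a b (valP c)) (expr0z _)).
by apply: eq_bigr => j _; rewrite /torus_char big_seq1 /= -exprz_exp.
Qed.

(** Grouping monomials by character splits [f]; the indicator of a character, used as [W] in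
    [torus_twist], shows that each part vanishes on [Z]. *)
Lemma homogeneous_component (Z : X -> Prop) f : regfun f -> psi_stable Z ->
  (forall x, Z x -> f x = 0) -> (exists x, f x != 0) ->
  exists om f', [/\ regfun f', homogeneous om f', exists x, f' x != 0 & forall x, Z x -> f' x = 0].
Proof.
move=> hf Zst fZ [x0 fx0]; have [wr wg] := cw; have [p hp] := wg f hf.
have Zact g x : Z x -> Z (torus_act g x).
  by move=> Zx; elim: g => [//|ic g IH] /=; apply: Zst; first exact: (valP ic.2).
pose T m x := p@_m * \prod_j w j x ^+ (m : 'X_{1..r}) j.
have [ch hch] : exists ch, \sum_(m <- msupp p | monomial_char torus_char m == ch) T m x0 != 0.
  apply: contrapT => none; move/negP: fx0; apply.
  rewrite hp mevalE (sum_fibers _ (monomial_char torus_char)) big1 // => ch _.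
  by apply/eqP; apply: contrapT => /negP hch; apply: none; exists ch.
have [m0 hm0] : exists m0, monomial_char torus_char m0 = ch.
  apply: contrapT => none; move/negP: hch; apply; rewrite big_pred0 // => m.
  by apply/eqP => e; apply: none; exists m.
exists (fun i => \sum_j h i j * (m0 j)%:Z), (fun x => \sum_(m <- msupp p | monomial_char torus_char m == ch) T m x).
split.
- apply: polyfun_sum => m; apply: polyfunZ; apply: polyfun_prod => j; exact: polyfunX.
- move=> i c x c0; rewrite mulr_sumr; apply: eq_bigr => m /eqP em.
  rewrite -(monomial_char1 m0 i (exist _ c c0)) hm0 -em.
  by rewrite /T mulrCA -(monomial_act w_torus_act m [:: (i, exist _ c c0)] x).
- by exists x0.
move=> x Zx; rewrite big_mkcond /= -[RHS](@torus_twist p x (fun f => (f == ch)%:R)).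
  by apply: eq_bigr => m _; rewrite -/(T m x); case: eqP => _; rewrite ?mulr1 ?mulr0.
by move=> g; rewrite -hp fZ //; exact: Zact.
Qed.

Lemma dil_trs j l b : l != 0 ->
  (dil F j l * trs F b = trs F (fun i => if i == j then l * b i else b i)%R * dil F j l)%g.
Proof.
move=> l0; rewrite /trs; elim: (index_enum _) => [|i s IH]; first by rewrite !big_nil mulg1 mul1g.
rewrite !big_cons mulgA; case: (eqVneq i j) => [->|ij].
  by rewrite dil_tr // -mulgA IH mulgA.
have e : commute (dil F j l) (tr F i (b i)) by apply: dil_trC => //; rewrite eq_sym.
by rewrite e -mulgA IH mulgA.
Qed.

(** Conjugating a trivial product by a dilation along [j] multiplies only its [j]-th parameter by
    [l]; comparison shows that the translation by [(l - 1) * c j] is trivial. *)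
Lemma trs_inj b b' : trs F b = trs F b' -> b = b'.
Proof.
have [l l0 l1] := scalar_neq01 k.
suff kernel c : trs F c = 1%g -> c = fun=> 0.
  move=> e; have /kernel e0 : trs F (fun i => b i + - b' i) = 1%g.
    rewrite -trsD e trsD /trs big1 // => i _; by rewrite subrr tr0.
  by apply/funext => i; have := congr1 (fun f => f i) e0; move/eqP; rewrite subr_eq0 => /eqP.
move=> c1; apply/funext => j; have := dil_trs j c l0; rewrite c1 mulg1 => e.
have {e}: trs F (fun i => if i == j then l * c i else c i) = 1%g by apply: (mulIg (dil F j l)); rewrite -e mul1g.
rewrite (_ : (fun i => _) = (fun i => c i + (if i == j then (l - 1) * c j else 0))); last first.
  by apply/funext => i; case: eqVneq => [->|]; [ring | rewrite addr0].
rewrite -trsD -trs1 c1 mul1g -(tr0 F j) => /tr_inj/eqP.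
by rewrite mulf_eq0 subr_eq0 (negPf l1) => /eqP.
Qed.

(** * Shears and invariant functions *)

Variable i0 : 'I_n.
Definition ut_fixed x := forall b, ut i0 b x = x.

Lemma shear f : regfun f -> (forall i, ut_invariant i f) -> exists g : k -> Aut X,
  [/\ forall s x, g s x = ut i0 (s * f x) x, forall s s', g (s + s') = (g s * g s')%g &
    forall s i a, commute (g s) (tr F i a)].
Proof.
move=> hf inv; have [wr wg] := cw.
have reg s j : regfun (w j \o (fun x => ut i0 (s * f x) x)).
  apply: (@polyfun_eq _ _ _ _ (fun x => \sum_l (\sum_(e < size (P i0 j l)) (P i0 j l)`_e * (s * f x) ^+ e) * w l x)).
    by move=> x; rewrite /= ut_w; apply: eq_bigr => l _; rewrite horner_coef.
  apply: polyfun_sum => l; apply: polyfunM => //; apply: polyfun_sum => e; apply: polyfunZ.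
  by apply: polyfunX; exact: polyfunZ.
have can s : cancel (fun x => ut i0 (s * f x) x) (fun x => ut i0 (- s * f x) x).
  by move=> x /=; rewrite inv -Aut_mulE -utD mulNr addNr ut0.
have /choice[g hg] s : exists g : Aut X, forall x, g x = ut i0 (s * f x) x.
  apply: (Aut_of cw (reg s) (reg (- s)) (can s)).
  by have := can (- s); rewrite opprK.
exists g; split=> // [s s'|s i a].
  by apply: Aut_eq => x; rewrite Aut_mulE !hg inv -Aut_mulE -utD mulrDl.
have [b ->] := ut_tr i a; apply: Aut_eq => x.
by rewrite !Aut_mulE !hg inv utC.
Qed.

(** The shear is a product of translations with parameters [a s]. Conjugation by the torus along [j]
    multiplies [s] by a power of [c], the [j]-th parameter by [lam j c] and no other; the other
    parameters, additive and unchanged by scaling, vanish. *)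
Lemma shear_weight f om j : regfun f -> (forall i, ut_invariant i f) -> homogeneous om f ->
  j != i0 -> om j != 0 -> (forall x, f x = 0 \/ ut_fixed x) \/
  exists be : k -> k, (forall s s', be (s + s') = be s + be s') /\
    forall c, c != 0 -> be (c ^ (- om j)) = lam j c.
Proof.
move=> hf inv homf ji0 omj; have [g [hg gD gC]] := shear hf inv.
have /choice[a ha] s : exists a, g s = trs F a by exact: cent_tr (gC s).
have aD s s' : a (s + s') = fun i => a s i + a s' i.
  by apply: trs_inj; rewrite -trsD -!ha gD.
have aZ s c : c != 0 -> a (s * c ^ (- om j)) = fun i => if i == j then lam j c * a s i else a s i.
  move=> c0; apply: trs_inj; apply: (mulIg (psi j c)); rewrite /psi -dil_trs ?lam_neq0 // -!ha.
  apply: Aut_eq => x; rewrite !Aut_mulE !hg -/(psi j c) psi_utC // homf //.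
  by rewrite -mulrA [_ * (_ * f x)]mulrA -expfzDr // addNr expr0z mul1r.
have surj (y : k) : y != 0 -> exists2 c : k, c != 0 & c ^ (- om j) = y.
  by move=> y0; apply: exprz_surj; rewrite ?oppr_eq0.
have a0 s l : l != j -> a s l = 0.
  move=> lj; have [z z0 z1] := scalar_neq01 k.
  have const y : y != 0 -> a (s * y) l = a s l.
    by move=> y0; have [c c0 <-] := surj y y0; rewrite aZ // (negPf lj).
  have := congr1 (fun f => f l) (aD (s * 1) (s * (z - 1))).
  rewrite -mulrDr subrKC !const ?oner_neq0 // ?subr_eq0 //.
  by move/esym/eqP; rewrite -subr_eq0 addrK => /eqP.
have [a1|a1] := eqVneq (a 1 j) 0.
  left=> x; have [->|fx] := eqVneq (f x) 0; [by left | right=> b].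
  rewrite -{2}[x]/((1%g : Aut X) x) -[b](divfK fx) -hg ha.
  have -> : a (b / f x) = fun=> 0; last by rewrite /trs big1 // => l _; rewrite tr0.
  apply/funext => l; have [->|] := eqVneq l j; last exact: a0.
  have [->|b0] := eqVneq (b / f x) 0.
    by have /(congr1 (fun f => f j))/eqP := aD 0 0; rewrite addr0 -subr_eq0 opprD addNKr oppr_eq0 => /eqP.
  by have [c c0 <-] := surj _ b0; rewrite -[c ^ _]mul1r aZ // eqxx a1 mulr0.
right; exists (fun s => a s j / a 1 j); split=> [s s'|c c0]; first by rewrite aD mulrDl.
by rewrite -[c ^ _]mul1r aZ // eqxx mulfK.
Qed.

(** Applying [shear_weight] to [f] and to its [N]-th power gives two additive functions related by
    [y ^+ N], which [no_additive_power] excludes. *)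
Lemma shear_vanishes f om j : regfun f -> (forall i, ut_invariant i f) -> homogeneous om f ->
  j != i0 -> om j != 0 -> forall x, f x = 0 \/ ut_fixed x.
Proof.
move=> hf inv homf ji0 omj; have [N N0 hN] := no_additive_power k.
have [//|[be [beD hbe]]] := shear_weight hf inv homf ji0 omj.
have surj (y : k) : y != 0 -> exists2 c : k, c != 0 & c ^ (- om j) = y.
  by move=> y0; apply: exprz_surj; rewrite ?oppr_eq0.
have be0 y : y != 0 -> be y != 0.
  by move=> /surj[c c0 <-]; rewrite hbe // lam_neq0.
have hfN : regfun (fun x => f x ^+ N) by exact: polyfunX.
have invN i : ut_invariant i (fun x => f x ^+ N) by move=> b x; rewrite inv.
have homfN : homogeneous (fun i => om i * N%:Z) (fun x => f x ^+ N).
  by move=> i c x c0; rewrite homf // exprMn -exprz_exp.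
have [|v|[be' [be'D hbe']]] := shear_weight hfN invN homfN ji0.
- by rewrite mulf_neq0 // eqz_nat -lt0n.
- by move=> x; have [/eqP|] := v x; [rewrite expf_eq0 N0 => /eqP; left | right].
move=> x; case: (hN be be' beD be'D be0) => y /surj[c c0 <-].
by rewrite hbe // -hbe' // exprnP exprz_exp mulNr.
Qed.

(** The shear is now a translation by some [b s] along the same axis, so [s * f x - b s] stabilizes
    [x] and takes finitely many values when [x] is not fixed. Subtracting, so does [s * (f x - f y)]
    as [s] varies. *)
Lemma shear_constant f om : regfun f -> (forall i, ut_invariant i f) -> homogeneous om f ->
  (forall j, j != i0 -> om j = 0) -> forall x y, ~ ut_fixed x -> ~ ut_fixed y -> f x = f y.
Proof.
move=> hf inv homf om0 x y; have [g [hg _ gC]] := shear hf inv.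
have /choice[b hb] s : exists b, g s = ut i0 b.
  have [a ->] : exists a, g s = tr F i0 a; last exact: ut_tr.
  apply: cent_tr1 => // j l ji0 l0; have [c c0 ->] := psi_dil j l0.
  apply: Aut_eq => z; rewrite !Aut_mulE !hg psi_utC // homf // om0 //.
  by rewrite expr0z mul1r.
have stab z : ~ ut_fixed z -> exists2 q : {poly k}, q != 0 & forall s, root q (s * f z - b s).
  move=> nz; have [t ht] : exists t, ut i0 t z <> z.
    by apply: contrapT => none; apply: nz => t; apply: contrapT => ht; apply: none; exists t.
  have [j hj] : exists j, w j (ut i0 t z) <> w j z.
    apply: contrapT => none; apply: ht; apply: (coordinates_inj cw) => j.
    by apply: contrapT => hj; apply: none; exists j.
  pose q := \sum_l w l z *: P i0 j l - (w j z)%:P.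
  have qE c : q.[c] = w j (ut i0 c z) - w j z.
    rewrite hornerD hornerN hornerC horner_sum ut_w; congr (_ - _).
    by apply: eq_bigr => l _; rewrite hornerZ mulrC.
  exists q => [|s]; first by apply/eqP => q0; apply: hj; apply/eqP; rewrite -subr_eq0 -qE q0 horner0.
  have fixed : ut i0 (s * f z - b s) z = z.
    by rewrite addrC utD Aut_mulE -hg hb -Aut_mulE -utD addNr ut0.
  by rewrite rootE qE fixed subrr.
move=> /stab[q q0 hq] /stab[q' q'0 hq']; apply/eqP; rewrite -subr_eq0; apply: contraT => fxy.
have [rs q'E] := closed_field_poly_normal q'.
(* [R] vanishes at every difference of a root of [q] and a root of [q']. *)
pose R := \prod_(z <- rs) (q \Po ('X + z%:P)).
have /closed_nonrootP[t /negP[]] : R != 0.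
  rewrite /R; elim: (rs) => [|z s IH]; first by rewrite big_nil oner_neq0.
  rewrite big_cons mulf_neq0 // -size_poly_eq0 size_comp_poly2 ?size_poly_eq0 //.
  by rewrite size_XaddC.
pose s := t / (f x - f y).
have srs : s * f y - b s \in rs.
  have := hq' s; rewrite q'E rootZ ?lead_coef_eq0 // root_prod_XsubC //.
rewrite /R (big_rem _ srs) /= rootM; apply/orP; left.
rewrite rootE horner_comp hornerD hornerX hornerC (_ : t + _ = s * f x - b s); first exact: hq.
by rewrite -{1}[t](divfK fxy) -/s; ring.
Qed.

Hypothesis hX : connected (@points k X).

Lemma connected_values (f : X -> k) (kap : k) x1 : regfun f -> kap != 0 ->
  (forall x, f x = 0 \/ f x = kap) -> f x1 = kap -> forall x, f x = kap.
Proof.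
move=> [p hp] kap0 f01 fx1 x.
pose B : set (affine_space k (ambient_dim X)) := fun y => @points k X y /\ p.@[y] = kap.
have fE y (Xy : @points k X y) : f (exist _ y (mem_set Xy)) = p.@[y] by rewrite hp.
have BX : B = @points k X.
  apply: hX.
  - by exists (val x1); split; [exact: set_mem (valP x1) | rewrite -fx1 hp].
  - exists (~` zero_locus (fun q => q = p))%classic; first by exists (fun q => q = p).
    apply/funext => y; apply/propext; split=> [[Xy py]|[Xy yp]]; split=> //.
      by move=> /(_ p erefl); rewrite py => /eqP; rewrite (negPf kap0).
    rewrite -(fE _ Xy); have [f0|//] := f01 (exist _ y (mem_set Xy)).
    by case: yp => _ ->; rewrite -(fE _ Xy).
  - exists (zero_locus (fun q => q = p - kap%:MP)).
      by rewrite -openC; exists (fun q => q = p - kap%:MP).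
    apply/funext => y; apply/propext; split=> [[Xy py]|[Xy yp]]; split=> //.
      by move=> _ ->; rewrite mevalB mevalC py subrr.
    by have := yp _ erefl; rewrite mevalB mevalC => /eqP; rewrite subr_eq0 => /eqP.
have [_] : B (val x) by rewrite BX; exact: set_mem (valP x).
by rewrite hp.
Qed.

Lemma ut_fixed_ut i b x : ut_fixed (ut i b x) -> ut_fixed x.
Proof. by move=> hx b'; have := hx b'; rewrite utC => /(can_inj (iso_funK _)). Qed.

Lemma ut_fixed_psi i c x : c != 0 -> ut_fixed (psi i c x) -> ut_fixed x.
Proof.
move=> c0 hx b'; apply: (can_inj (iso_funK (psi i c))); move: hx.
have [->|ii0] := eqVneq i i0 => hx; first by rewrite psi_ut // hx.
by rewrite psi_utC // hx.
Qed.

Lemma not_ut_fixed : exists x, ~ ut_fixed x.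
Proof.
apply: contrapT => none; have [_ [_ bet_inj _] _ _] := model i0.
have /tr_inj/bet_inj : ut i0 1 = ut i0 0.
  rewrite ut0; apply: Aut_eq => x; apply: contrapT => hx; apply: none.
  by exists x => /(_ 1).
by move/eqP; rewrite oner_eq0.
Qed.

Lemma invariant_constant f om : regfun f -> (forall i, ut_invariant i f) -> homogeneous om f ->
  exists kap, forall x, ~ ut_fixed x -> f x = kap.
Proof.
move=> hf inv homf; have [[j [ji0 /negP omj]]|none] := pselect (exists j, j != i0 /\ ~ om j == 0).
  by exists 0 => x nx; have [|//] := shear_vanishes hf inv homf ji0 omj x.
have [x0 nx0] := not_ut_fixed; exists (f x0) => x nx.
apply: (shear_constant hf inv homf) => // j ji0.
by apply/eqP; apply: contrapT => omj; apply: none; exists j.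
Qed.

(* The zero set [Z] of the ideal below is stable under translations and torus;
   if nonempty it would carry a homogeneous invariant function equal to 0 on
   [Z] and to a nonzero constant off [Z], disconnecting [X]. *)
Lemma fixed_points_sparse (g : X -> k) : regfun g -> (forall x, ~ ut_fixed x -> g x = 0) -> forall x, g x = 0.
Proof.
pose I (g : X -> k) := regfun g /\ forall x, ~ ut_fixed x -> g x = 0.
move=> hg hg0 z0; apply: contrapT => gz0.
pose Z x := exists g, I g /\ g x <> 0.
have Zz0 : Z z0 by exists g.
have ZY x : Z x -> ut_fixed x.
  by case=> g' [[_ hg'] gx]; apply: contrapT => /hg'.
have Zut : ut_stable Z.
  move=> i b x [g' [[rg' hg'] gx]]; exists (g' \o ut i (- b)); split.
    split=> [|y ny /=]; first exact: regfun_comp.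
    by apply: hg' => /ut_fixed_ut.
  by rewrite /= -{2}[b]opprK utN.
have Zpsi : psi_stable Z.
  move=> i c x c0 [g' [[rg' hg'] gx]]; exists (g' \o psi i c^-1); split.
    split=> [|y ny /=]; first exact: regfun_comp.
    by apply: hg' => /ut_fixed_psi; rewrite invr_eq0 => /(_ c0).
  by rewrite /= -{2}[c]invrK psiV ?invr_eq0.
have [x0 nx0] := not_ut_fixed; have [wr wg] := cw.
have [b [j hj]] : exists b j, w j (ut i0 b x0) <> w j x0.
  apply: contrapT => none; apply: nx0 => b; apply: (coordinates_inj cw) => j.
  by apply: contrapT => hj; apply: none; exists b, j.
have [||x Zx||om [f1 [rf1 homf1 f10 f1Z]]] :=
    @homogeneous_component Z (fun x => w j (ut i0 b x) - w j x).
- by apply: polyfunB => //; apply: (regfun_comp (ut i0 b)).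
- exact: Zpsi.
- by rewrite (ZY x Zx b) subrr.
- by exists x0; rewrite subr_eq0; apply/eqP.
have [gam [f2 [rf2 [x2 f2x2] homf2 inv f2Z]]] := invariant_coefficient rf1 homf1 f10.
have [kap hkap] := invariant_constant rf2 inv homf2.
have f2Z0 x : Z x -> f2 x = 0 by apply: f2Z.
have [kap0|kap0] := eqVneq kap 0.
  move/eqP: (f2x2); apply; apply: f2Z0; exists f2; split; last exact/eqP.
  by split=> // x /hkap ->.
have f2nZ x : ~ Z x -> f2 x = kap.
  move=> nZ; apply/eqP; rewrite -subr_eq0; apply: contrapT => /negP ne; apply: nZ.
  exists (fun x => f2 x - kap); split; last exact/eqP.
  by split=> [|y /hkap ->]; [apply: polyfunB => //; exact: polyfun_cst | rewrite subrr].
have f20 x : f2 x = 0 \/ f2 x = kap.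
  by have [/f2Z0|/f2nZ] := pselect (Z x); [left | right].
have := connected_values rf2 kap0 f20 (hkap x0 nx0) z0.
by rewrite f2Z0 // => /eqP; rewrite eq_sym (negPf kap0).
Qed.

(** The invariant coefficient of a nonzero [f] is a nonzero constant, yet it inherits the zeros of
    [f] on [Z]. *)
Lemma invariant_nonvanishing om f (Z : X -> Prop) x0 : regfun f -> homogeneous om f ->
  ut_stable Z -> Z x0 -> (forall x, Z x -> f x = 0) -> forall x, f x = 0.
Proof.
move=> hf homf Zst Zx0 fZ x; apply: contrapT => /eqP fx.
have [gam [f' [rf' [x1 f'x1] homf' inv f'Z]]] := invariant_coefficient hf homf (ex_intro _ x fx).
have [kap hkap] := invariant_constant rf' inv homf'.
have f'E : forall y, f' y - kap = 0.
  apply: fixed_points_sparse => [|y ny]; first by apply: polyfunB => //; exact: polyfun_cst.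
  by rewrite hkap // subrr.
have f'E' y : f' y = kap by apply/eqP; rewrite -subr_eq0 f'E.
by move/eqP: f'x1; apply; rewrite f'E' -(f'E' x0) (f'Z Z).
Qed.

(** The invariant coefficient is a nonzero constant, so its weight [om i - d i * gam i] is 0. *)
Lemma homogeneous_weight om f : regfun f -> homogeneous om f -> (exists x, f x != 0) ->
  exists gam : 'I_n -> nat, forall i, om i = (d i * gam i)%N%:Z.
Proof.
move=> hf homf f0.
have [gam [f' [rf' [x1 f'x1] homf' inv f'Z]]] := invariant_coefficient hf homf f0.
have [kap hkap] := invariant_constant rf' inv homf'.
have f'E y : f' y = kap.
  apply/eqP; rewrite -subr_eq0; apply/eqP; move: y.
  apply: (fixed_points_sparse (g := fun y => f' y - kap)) => [|y ny].
    by apply: polyfunB => //; exact: polyfun_cst.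
  by rewrite hkap // subrr.
exists gam => i; apply/eqP; rewrite -subr_eq0; apply: contraT => ne.
have [z z0 z1] := scalar_neq01 k; have [c c0 cz] := exprz_surj ne z0.
have := homf' i c x1 c0; rewrite cz !f'E -{1}[kap]mul1r => /eqP.
rewrite -subr_eq0 -mulrBl mulf_eq0 -(f'E x1) (negPf f'x1) orbF subr_eq0 eq_sym.
by rewrite (negPf z1).
Qed.

(** * The torus-fixed point, its orbit and the monoid of weights *)

Hypothesis h_neq0 : forall i, exists j, h i j != 0.

Definition weight (gam : 'I_n -> nat) i := (d i * gam i)%N%:Z.

Lemma d_gt0 i : (0 < d i)%N.
Proof. by have [[]] := model i. Qed.

Lemma w_homogeneous j : homogeneous (fun i => h i j) (w j).
Proof. by move=> i c x c0; exact: psi_w. Qed.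

Lemma w_weight j : exists gam : 'I_n -> nat, forall i, h i j = weight gam i.
Proof.
have [wr _] := cw.
exact: homogeneous_weight (wr j) (@w_homogeneous j) (spanning_neq0 sw j).
Qed.

Lemma trivial_character (e : int) : (forall c : k, c != 0 -> c ^ e = 1) -> e = 0.
Proof.
move=> he; apply/eqP; apply: contraT => e0; have [z z0 z1] := scalar_neq01 k.
by have [c c0 cz] := exprz_surj e0 z0; move: z1; rewrite -cz he // eqxx.
Qed.

(** The point plays the role of a limit of [x1] under the torus: coordinates of nonzero weight are
    set to 0. Since weights are nonnegative, a monomial of weight 0 involves only coordinates of
    weight 0, and [torus_twist] extracts the weight-0 part of each relation. *)
Lemma torus_fixed_point (x1 : X) : exists x0, forall i c, c != 0 -> psi i c x0 = x0.
Proof.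
have /choice[gam hgam] := w_weight.
pose triv j := [forall i, h i j == 0].
pose y j := if triv j then w j x1 else 0.
have [|x0 hx0] := @coordinates_closed k X r w y cw.
  move=> p p0; rewrite mevalE.
  rewrite -[RHS](@torus_twist p x1 (fun f => (f == fun=> 1)%:R)); last by move=> g; exact: p0.
  apply: eq_bigr => m _; rewrite -mulrA; congr (_ * _); case: eqP => [m1|m1].
    rewrite mulr1; apply: eq_bigr => j _; rewrite /y; case: ifP => // /negP ntriv.
    have [->|mj] := eqVneq (m j) 0%N; first by rewrite !expr0.
    case: ntriv; apply/forallP => i.
    have : \sum_j h i j * (m j)%:Z = 0.
      apply: trivial_character => c c0.
      by rewrite -(monomial_char1 m i (exist _ c c0)) m1.
    under eq_bigr do rewrite hgam /weight -PoszM.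
    move/eqP; rewrite Num.Theory.psumr_eq0 // => /allP/(_ j (mem_index_enum _)).
    by rewrite hgam /weight /= !eqz_nat muln_eq0 (negPf mj) orbF.
  rewrite mulr0; apply/eqP/prodf_eq0.
  have [j /andP[mj ntriv]] : exists j, (m j != 0)%N && ~~ triv j.
    apply: contrapT => none; apply: m1; apply/funext => g; rewrite /monomial_char big1 // => j _.
    have [->|mj] := eqVneq (m j) 0%N; first by rewrite expr0.
    have /forallP tj : triv j.
      by apply: contrapT => /negP ntriv; apply: none; exists j; rewrite mj.
    rewrite /torus_char big1 ?expr1n // => ic _.
    by rewrite (eqP (tj _)) expr0z.
  by exists j => //; rewrite /y (negPf ntriv) expr0n (negPf mj).
exists x0 => i c c0; apply: (coordinates_inj cw) => j; rewrite psi_w // hx0 /y.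
by case: ifP => [/forallP/(_ i)/eqP ->|_]; rewrite ?expr0z ?mul1r ?mulr0.
Qed.

Definition uts (b : 'I_n -> k) (s : seq 'I_n) x := foldr (fun i => ut i (b i) : X -> X) x s.

Lemma uts_shift i t b s x : i \in s -> uniq s ->
  ut i t (uts b s x) = uts (fun l => if l == i then t + b l else b l) s x.
Proof.
have out l0 t0 s0 : l0 \notin s0 -> uts (fun l => if l == l0 then t0 + b l else b l) s0 x = uts b s0 x.
  elim: s0 => //= j s0 IH; rewrite inE negb_or => /andP[lj ls]; rewrite IH //.
  by rewrite eq_sym (negPf lj).
elim: s => //= j s IH; rewrite inE => /orP[/eqP ->|is_] /andP[js us].
  by rewrite eqxx out // utD.
have ij : i != j by apply: contraNneq js => <-.
by rewrite utC IH // eq_sym (negPf ij).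
Qed.

Variable x0 : X.
Hypothesis x0_fixed : forall i c, c != 0 -> psi i c x0 = x0.

Lemma psi_uts i c b s : c != 0 -> i \notin s -> psi i c (uts b s x0) = uts b s x0.
Proof.
move=> c0; elim: s => [_|j s IH] /=; first exact: x0_fixed.
by rewrite inE negb_or => /andP[ij /IH e]; rewrite psi_utC // e.
Qed.

(** Along a further axis [i], [f] is a polynomial in [b i] based at a point fixed by the torus of
    that axis, and comparing weights leaves the single degree [gam i]. *)
Lemma orbit_value s gam f : uniq s -> regfun f -> homogeneous (weight gam) f ->
  exists kap, forall b, f (uts b s x0) = kap * \prod_(i <- s) b i ^+ gam i.
Proof.
elim: s gam f => [|i s IH] gam f /=; first by exists (f x0) => b; rewrite big_nil mulr1.
case/andP=> is_ us hf homf; have [Q [[_ Qr] hQ]] := expansion i hf.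
have Qhom e := coefficient_homogeneous e hQ homf.
have [|kap hkap] := IH (fun l => if l == i then 0 else gam l)%N _ us (Qr (gam i)).
  move=> l c x c0; rewrite Qhom //; congr (_ ^ _ * _); rewrite /weight.
  by case: eqVneq => [->|_]; rewrite ?muln0 ?subrr ?subr0.
exists kap => b; rewrite big_cons mulrCA.
have -> : \prod_(l <- s) b l ^+ gam l = \prod_(l <- s) b l ^+ (if l == i then 0 else gam l)%N.
  rewrite big_seq [RHS]big_seq; apply: eq_bigr => l ls.
  by case: eqP => // e; move: is_; rewrite -e ls.
rewrite -hkap hQ; set y := uts b s x0.
have e : Q y = (Q y)`_(gam i) *: 'X^(gam i).
  apply/polyP => e; rewrite coefZ coefXn; have [->|ne] := eqVneq e (gam i); first by rewrite mulr1.
  rewrite mulr0; apply/eqP; apply: contraT => Qe.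
  have /eqP : weight gam i - (d i * e)%N%:Z = 0.
    apply: trivial_character => c c0; apply: (mulIf Qe).
    by have := Qhom e i c y c0; rewrite eqxx psi_uts // -/y mul1r.
  rewrite subr_eq0 /weight eqz_nat eqn_mul2l [gam i == e]eq_sym (negPf ne) orbF.
  by rewrite eqn0Ngt d_gt0.
by rewrite {1}e hornerZ hornerXn mulrC.
Qed.

Definition orbit b := uts b (enum 'I_n) x0.

Lemma orbit_ut i t b : ut i t (orbit b) = orbit (fun l => if l == i then t + b l else b l).
Proof. by apply: uts_shift; rewrite ?mem_enum ?enum_uniq. Qed.

Lemma orbit_eq0 f gam : regfun f -> homogeneous (weight gam) f -> (forall b, f (orbit b) = 0) ->
  forall x, f x = 0.
Proof.
move=> hf homf f0.
apply: (@invariant_nonvanishing (weight gam) f (fun x => exists b, x = orbit b) (orbit (fun=> 0))) => //.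
- by move=> i t _ [b ->]; rewrite orbit_ut; eexists.
- by eexists.
by move=> _ [b ->].
Qed.

Definition occurs (gam : 'I_n -> nat) :=
  exists f : X -> k, [/\ regfun f, homogeneous (weight gam) f & exists x, f x != 0].

Lemma occurs_orbit f gam : regfun f -> homogeneous (weight gam) f -> (exists x, f x != 0) ->
  exists2 kap, kap != 0 & forall b, f (orbit b) = kap * \prod_i b i ^+ gam i.
Proof.
move=> hf homf [x fx]; have [kap hkap] := orbit_value (enum_uniq 'I_n) hf homf.
exists kap; last by move=> b; rewrite /orbit hkap big_enum.
apply: contraNneq fx => kap0; apply/eqP; apply: (orbit_eq0 hf homf) => b.
by rewrite /orbit hkap kap0 mul0r.
Qed.

(** On the orbit [f] is a monomial; translating [b i] by [t] expands it binomially, and the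
    coefficient of [t ^+ e] is again regular and homogeneous. *)
Lemma occurs_sub gam i e : occurs gam -> 'C(gam i, e)%:R != 0 :> k ->
  occurs (fun l => if l == i then gam i - e else gam l)%N.
Proof.
move=> [f [hf homf f0]] bin0; have [kap kap0 hkap] := occurs_orbit hf homf f0.
have ei : (e <= gam i)%N.
  by rewrite leqNgt; apply: contraNN bin0 => /bin_small ->.
have [Q [[_ Qr] hQ]] := expansion i hf.
exists (fun x => (Q x)`_e); split=> //.
  move=> l c x c0; rewrite (coefficient_homogeneous e hQ homf) //; congr (_ ^ _ * _).
  rewrite /weight; case: eqVneq => [->|_]; last by rewrite subr0.
  by rewrite mulnBr subzn // leq_mul2l ei orbT.
exists (orbit (fun=> 1)).
have -> : Q (orbit (fun=> 1)) = kap *: (1 + 'X) ^+ gam i.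
  apply: poly_ext => t; rewrite -hQ orbit_ut hkap hornerZ horner_exp !hornerE; congr (_ * _).
  rewrite (bigD1 i) //= eqxx big1 ?mulr1 1?addrC // => l /negPf ->.
  by rewrite expr1n.
by rewrite coefZ coef_binomial mulf_neq0.
Qed.

Definition axis i s := occurs (fun l => if l == i then s else 0%N).

(** The full exponent can be removed on every other axis, the binomial coefficient then being 1. *)
Lemma occurs_axis gam i : occurs gam -> axis i (gam i).
Proof.
move=> hg; suff kill (s : seq 'I_n) : i \notin s -> occurs (fun l => if l \in s then 0%N else gam l).
  have := kill (rem i (enum 'I_n)); rewrite mem_rem_uniq ?enum_uniq // inE eqxx => /(_ isT).
  congr occurs; apply/funext => l; rewrite mem_rem_uniq ?enum_uniq // inE mem_enum andbT.
  by case: eqVneq => [->|].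
elim: s => [//|l s IH]; rewrite inE negb_or => /andP[il /IH hs].
have := @occurs_sub _ l (if l \in s then 0%N else gam l) hs.
rewrite binn subnn oner_neq0 => /(_ isT); congr occurs; apply/funext => l'.
by rewrite inE; case: eqVneq.
Qed.

Lemma axis_sub i s e : axis i s -> 'C(s, e)%:R != 0 :> k -> axis i (s - e).
Proof.
move=> hs bin0; have := @occurs_sub _ i e hs; rewrite eqxx => /(_ bin0).
by congr occurs; apply/funext => l; case: eqVneq.
Qed.

(* For the least positive [q], all the intermediate binomial coefficients of
   [(1 + 'X) ^+ q] vanish, so that [(1 + 'X) ^+ s] has a nonzero coefficient
   at [s %% q]. *)
Lemma axis_generator i : exists q, [/\ (0 < q)%N, axis i q & forall s, axis i s -> (q %| s)%N].
Proof.
have ex : exists s, (0 < s)%N && `[< axis i s >].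
  have [j hj] := h_neq0 i; have [gam hgam] := w_weight j; have [wr _] := cw.
  exists (gam i); apply/andP; split.
    by rewrite lt0n; apply: contraNneq hj => g0; rewrite hgam /weight g0 muln0.
  apply/asboolP/occurs_axis; exists (w j); split=> //; last exact: spanning_neq0.
  by move=> l c x c0; rewrite -hgam psi_w.
case: (ex_minnP ex) => q /andP[q0 /asboolP hq] qmin; exists q; split=> // s hs.
have bin_q e : (0 < e < q)%N -> 'C(q, e)%:R = 0 :> k.
  case/andP=> e0 eq; apply/eqP; apply: contraT => /(axis_sub hq) hqe.
  have := qmin (q - e)%N; rewrite subn_gt0 eq asboolT // => /(_ isT).
  by lia.
have expq : (1 + 'X) ^+ q = 1 + 'X^q :> {poly k}.
  apply/polyP => e; rewrite coef_binomial coefD coef1 coefXn.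
  have [->|e0] := posnP e; first by rewrite bin0 eq_sym eqn0Ngt q0 addr0.
  rewrite add0r; have [eq|qe|->] := ltngtP e q; last by rewrite binn.
    by rewrite bin_q // e0.
  by rewrite bin_small.
rewrite /dvdn; apply: contraT; rewrite -lt0n => t0; set t := (s %% q)%N in t0.
have tq : (t < q)%N by rewrite ltn_mod.
have bin_s : 'C(s, t)%:R = 1 :> k.
  rewrite -coef_binomial {1}(divn_eq s q) -/t exprD mulnC exprM expq.
  have [R ->] : exists R, (1 + 'X^q) ^+ (s %/ q) = 1 + 'X^q * R :> {poly k}.
    elim: (s %/ q)%N => [|a [R e]]; first by exists 0; rewrite expr0 mulr0 addr0.
    by exists (1 + R + 'X^q * R); rewrite exprS e; ring.
  rewrite mulrDl mul1r coefD -mulrA coefXnM tq addr0 coef_binomial binn //.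
have ts : (t <= s)%N by exact: leq_mod.
have := @axis_sub i s (s - t)%N hs; rewrite bin_sub // bin_s oner_neq0 subKn // => /(_ isT) ht.
by have := qmin t; rewrite t0 asboolT // => /(_ isT); rewrite leqNgt tq.
Qed.

Lemma isomorphic_affine_space : isomorphic X (affine_space_variety k n).
Proof.
have [wr wg] := cw.
have /choice[q hq] := axis_generator.
have /choice[f hf] i : exists f : X -> k, [/\ regfun f,
    homogeneous (weight (fun l => if l == i then q i else 0%N)) f &
    forall b, f (orbit b) = b i ^+ q i].
  have [_ [f [rf homf f0]] _] := hq i; have [kap kap0 hkap] := occurs_orbit rf homf f0.
  exists (fun x => kap^-1 * f x); split; first exact: polyfunZ.
    by move=> l c x c0; rewrite homf // mulrCA.
  move=> b; rewrite hkap mulKf // (bigD1 i) //= eqxx big1 ?mulr1 // => l /negPf ->.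
  by rewrite expr0.
have /choice[gam hgam] := w_weight.
have wocc j : homogeneous (weight (gam j)) (w j).
  by move=> l c x c0; rewrite -hgam psi_w.
have /choice[kap hkap] j : exists kap, forall b, w j (orbit b) = kap * \prod_i b i ^+ gam j i.
  by have [kap _ hkap] := occurs_orbit (wr j) (wocc j) (spanning_neq0 sw j); exists kap.
pose ex j i := (gam j i %/ q i)%N.
have exE j i : gam j i = (q i * ex j i)%N.
  have [_ _ hdiv] := hq i; rewrite mulnC divnK //; apply: hdiv; apply: occurs_axis.
  by exists (w j); split=> //; exact: spanning_neq0.
(* Both sides have the same weight and agree on the orbit, hence everywhere. *)
have wE j x : w j x = kap j * \prod_i f i x ^+ ex j i.
  apply/eqP; rewrite -subr_eq0; apply/eqP; move: x.
  apply: (@orbit_eq0 (fun x => w j x - kap j * \prod_i f i x ^+ ex j i) (gam j)).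
  - apply: polyfunB => //; apply: polyfunZ; apply: polyfun_prod => i; apply: polyfunX.
    by have [] := hf i.
  - move=> l c x c0; rewrite wocc // mulrBr; congr (_ - _); rewrite mulrCA; congr (_ * _).
    rewrite (bigD1 l) //= [in RHS](bigD1 l) //= mulrA; congr (_ * _).
      have [_ homf _] := hf l; rewrite homf // exprMn; congr (_ * _).
      by rewrite /weight eqxx exE mulnA exprnP exprz_exp.
    apply: eq_bigr => i il; have [_ homf _] := hf i; rewrite homf // /weight.
    by rewrite eq_sym (negPf il) muln0 expr0z mul1r.
  move=> b; rewrite hkap; apply/eqP; rewrite subr_eq0; apply/eqP; congr (_ * _).
  by apply: eq_bigr => i _; have [_ _ ->] := hf i; rewrite exE exprM.
(* Any choice of roots works: the values [w j] on the orbit depend only on the powers [b i ^+ q i],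
   so [Psi] is regular even if [rt] is not. *)
have /choice[rt hrt] (iz : 'I_n * k) : exists y, y ^+ q iz.1 = iz.2.
  by apply: closed_root; have [] := hq iz.1.
pose Phi x : affine_space_variety k n := pt (fun i => f i x).
pose Psi (y : affine_space_variety k n) := orbit (fun i => rt (i, @crd k (affine_space_variety k n) i y)).
have wPsi j y : w j (Psi y) = kap j * \prod_i @crd k (affine_space_variety k n) i y ^+ ex j i.
  by rewrite hkap; congr (_ * _); apply: eq_bigr => i _; rewrite exE exprM hrt.
have PhiK : cancel Phi Psi.
  move=> x; apply: (coordinates_inj cw) => j; rewrite wPsi wE; congr (_ * _).
  by apply: eq_bigr => i _; rewrite crd_pt.
have PsiK : cancel Psi Phi.
  by move=> y; apply: crd_inj => i; rewrite crd_pt; have [_ _ ->] := hf i; rewrite hrt.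
have rPhi : regular Phi.
  have /choice[p hp] i : regfun (f i) by have [] := hf i.
  by exists p => x i; rewrite -hp; exact: crd_pt.
have rPsi : regular Psi.
  have /choice[p hp] l : polyfun (@crd k (affine_space_variety k n)) (crd l \o Psi).
    have [p hp] := wg _ (polyfun_var crd l).
    apply: (@polyfun_eq _ _ _ _ (fun y => p.@[fun j => w j (Psi y)])) => [y|]; first by rewrite /= hp.
    apply: polyfun_meval => j; apply: polyfun_eq (fun y => esym (wPsi j y)) _.
    by apply: polyfunZ; apply: polyfun_prod => i; apply: polyfunX; exact: polyfun_var.
  by exists p => y l; rewrite -hp.
exact: inhabits (VarietyIso rPhi rPsi PhiK PsiK).
Qed.

End Model.

Local Open Scope classical_set_scope.

Theorem theoremA (k : closedFieldType) (hk : ~ countable [set: k])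
    (n : nat) (hn : (0 < n)%N)
    (X : affine_variety k) (hX : connected X)
    (hAut : exists phi : {multiplicative Aut X -> Aut (affine_space_variety k n)},
      bijective phi) :
  isomorphic X (affine_space_variety k n).
Proof.
have [phi bij] := hAut; have F := frame_transport bij (frame_affine_space k n).
have [r [w [cw sw lin_tr lin_dil diag]]] := linear_model F hk.
have /choice[M hM] (i : 'I_n) :
    exists M : ('I_r -> int) * (k -> k) * (k -> k) * nat * 'M[{poly k}]_r,
      (exists j, M.1.1.1.1 j != 0) /\
      unipotent_model F w i M.1.1.1.1 M.1.1.1.2 M.1.1.2 M.1.2 M.2.
  have [h [lam [h0 hl]]] := torus cw sw lin_tr lin_dil diag i.
  have [h' [lam' [bet [d [P hP]]]]] := unipotent_model_exists cw sw lin_tr lin_dil hl h0.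
  by exists (h', lam', bet, d, P).
have model i := (hM i).2; have h0 i := (hM i).1; have i0 := Ordinal hn.
have [x1 _] := not_ut_fixed model i0.
have [x0 hx0] := torus_fixed_point cw sw model i0 hX x1.
exact (isomorphic_affine_space cw sw model i0 hX h0 hx0).
Qed.
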